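(* Let $\operatorname{Gold}_{g_+}(n)$ be the number of chambers of the fine chamber decomposition of $\mathcal{D}_{g,n}$ for $g>0$ (independent of $g>0$), equivalently the number of Semi-Goldilocks linear threshold functions in $n$ variables, and let $\operatorname{Gold}_0(n)$ be the number of chambers of the fine chamber decomposition of $\mathcal{D}_{0,n}$, equivalently the number of Goldilocks linear threshold functions in $n$ variables. Then, as $n\to\infty$, $$\operatorname{Gold}_{g_+}(n)\sim 2^{\,n^2-n\log_2 n+O(n)},$$ that is, there is a function $e(n)=O(n)$ with $\operatorname{Gold}_{g_+}(n)\big/2^{\,n^2-n\log_2 n+e(n)}\to 1$; and $$\operatorname{Gold}_0(n)\sim\frac{\operatorname{Gold}_{g_+}(n)}{2}.$$
   Context: For integers $g\ge 0$, $n\ge 1$, the space of admissible weights is $\mathcal{D}_{g,n}=\{(w_1,\dots,w_n)\in\mathbb{R}^n : 0<w_j\le 1\ \forall j,\ w_1+\dots+w_n>2-2g\}$; it is the same set for all $g>0$. The fine chamber decomposition of $\mathcal{D}_{g,n}$ has as walls the hyperplanes $\{\sum_{j\in S}w_j=1\}$ for all nonempty $S\subseteq\{1,\dots,n\}$; its chambers are the connected components of the complement in $\mathcal{D}_{g,n}$ of the union of all walls. A linear threshold function (LTF) in $n$ variables is a function $f:\{0,1\}^n\to\{0,1\}$ of the form $f(\mathbf{x})=\operatorname{sgn}(\mathbf{w}\cdot\mathbf{x}-\theta)$ with $\mathbf{w}\in\mathbb{Q}^n$, $\theta\in\mathbb{Q}$, where $\operatorname{sgn}(t)=1$ if $t>0$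 and $\operatorname{sgn}(t)=0$ if $t\le 0$. Any such pair $(\mathbf{w},\theta)$ is called a realization of $f$. An LTF $f$ is Semi-Goldilocks if (i) (positivity) it has a realization $(\mathbf{w},\theta)$ with $w_i>0$ for all $i$, and (ii) (smallness) it has a realization $(\mathbf{w}',\theta')$ with $w'_i\le\theta'$ for all $i$. It is Goldilocks if in addition (iii) (ampleness) it has a realization $(\mathbf{w}'',\theta'')$ with $\sum_{i=1}^n w''_i>2\theta''$. The realizations in (i), (ii), (iii) are allowed to be different. $a(n)\sim b(n)$ means $a(n)/b(n)\to1$ as $n\to\infty$. *)

(* Defs.v *)
From HB Require Import structures.
From mathcomp Require Import all_boot all_order all_algebra finmap.
From mathcomp Require Import all_classical all_reals all_analysis.

Import Order.TTheory GRing.Theory Num.Theory.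
Import numFieldNormedType.Exports.

Local Open Scope classical_set_scope.
Local Open Scope ring_scope.

Section Chambers.
Variable R : realType.

(* The bound 2 - 2g is computed in R: over nat it would be truncated. *)
Definition admissible (g n : nat) : set 'rV[R]_n :=
  [set w | (forall j, 0 < w ord0 j <= 1) /\
           \sum_j w ord0 j > 2 - 2 * g%:R].

Definition wall (n : nat) (S : {set 'I_n}) : set 'rV[R]_n :=
  [set w | \sum_(j in S) w ord0 j = 1].

Definition walls (n : nat) : set 'rV[R]_n :=
  \bigcup_(S in [set S : {set 'I_n} | (0 < #|S|)%N]) wall n S.

Definition fine_chambers (g n : nat) : set (set 'rV[R]_n) :=
  let A := admissible g n `\` walls n in
  [set connected_component A w | w in A].

(* fset_set sends an infinite set to the empty finite set, so this number is
   meaningful only together with the finiteness of the set of chambers. *)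
Definition num_fine_chambers (g n : nat) : nat :=
  #|` fset_set (fine_chambers g n)|%fset.

End Chambers.

Definition bool_fun (n : nat) := {ffun {ffun 'I_n -> bool} -> bool}.

Definition sgn (t : rat) : bool := 0 < t.

Section Threshold.
Variable n : nat.
Implicit Types (f : bool_fun n) (w : 'rV[rat]_n) (theta : rat).

Definition realization f w theta : Prop :=
  forall x : {ffun 'I_n -> bool},
    f x = sgn (\sum_i w ord0 i * (x i)%:R - theta).

Definition is_ltf f : Prop := exists w theta, realization f w theta.

Definition positive f : Prop :=
  exists w theta, realization f w theta /\ forall i, 0 < w ord0 i.

Definition small f : Prop :=
  exists w theta, realization f w theta /\ forall i, w ord0 i <= theta.

Definition ample f : Prop :=
  exists w theta, realization f w theta /\ \sum_i w ord0 i > 2 * theta.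

Definition semi_goldilocks f : Prop := [/\ is_ltf f, positive f & small f].

Definition goldilocks f : Prop := semi_goldilocks f /\ ample f.

Definition num_semi_goldilocks : nat :=
  #|[pred f : bool_fun n | `[< semi_goldilocks f >]]|.

Definition num_goldilocks : nat :=
  #|[pred f : bool_fun n | `[< goldilocks f >]]|.

End Threshold.

Definition log2 {R : realType} (x : R) : R := ln x / ln 2.

(* a(n) ~ b(n); the sequences compared here are eventually nonzero, so the
   convention x / 0 = 0 plays no role in the limit. *)
Definition asymp_equiv {R : realType} (a b : nat -> R) : Prop :=
  (fun n => a n / b n) @ \oo --> (1 : R).

(* Main.v *)
Require Import Defs.
From HB Require Import structures.
From mathcomp Require Import all_boot all_order all_algebra finmap.
From mathcomp Require Import all_classical all_reals all_analysis.
From mathcomp Require Import complex zify ring lra.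

(* A chamber is determined by the sign pattern x |-> [w.x > 1] of any of its
   points, and a rational approximation makes this pattern a (Semi-)Goldilocks
   function.  Radon's theorem bounds the VC dimension of threshold functions by
   n+1, so Sauer-Shelah gives the upper bound on their number T.

   The lower bound uses strong shattering: if a set S of cube points is affinely
   independent and its affine hull contains no other cube point, then some
   hyperplane meets the cube exactly in S, and tilting it realizes all patterns
   on S with a fixed pattern off S.  A Kahn-Komlos-Szemeredi estimate shows that
   most r-sets have this property for r = n - O(1).  An affine dependence between
   random points, normalized to integers not all divisible by 3, is followed
   modulo the powers 3^e.  Dependences with small support modulo 3 are handled by
   a union bound; for the others, as long as the sign walk they define is
   concentrated modulo 3^e, it is compared in Halasz's manner with a much lazier
   walk, whose number of annihilators is bounded by Odlyzko's argument over F_3.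
   Flipping coordinates gives T <= 2^n P for the number P(n) of positive
   threshold functions.

   The duality f(x) |-> ~ f(~ x) exchanges ample and non-ample positive functions,
   except for the self-dual ones.  Self-dual and non-small positive functions
   number O(n) P(n-1), while P(n) >= 2^(n-2) P(n-1); hence both assertions. *)

Import Order.TTheory GRing.Theory Num.Theory.
Import numFieldNormedType.Exports.
Set Implicit Arguments.
Unset Strict Implicit.
Unset Printing Implicit Defensive.

(** * Shattering *)

(** A bound [o(1)] on the proportion of degenerate tuples would not do. The point that spoils an
    [r]-set may be any of the [2 ^ n] cube points, so degeneracy of [r.+1] random points must have
    probability below [2 ^ - n] by a constant factor. Two equal points already have probability
    [2 ^ - n]; hence the restriction to dependences with more than two coefficients prime to 3. A
    fixed modulus [q] is too weak: the union bound over [q ^ s] coefficient vectors, each with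
    probability at best about [1 / q] per row, leaves for [n = s + j] rows about [q ^ - j], so [q]
    must grow exponentially in [n]. Prime powers provide such moduli and keep one feature of the
    prime case: every nonzero frequency has a multiple of order 3, at which each coefficient prime
    to 3 contributes a fixed amount. The prime is not 2 because all signs agree modulo 2. The term
    [- n * log2 n] comes from the [r!] orderings of an [r]-set; the constant codimension [n - r],
    the [2 ^ n] flips and all other losses are absorbed in [O(n)]. *)

Section Shattering.
Variable X : finType.
Implicit Types (F : {set {set X}}) (S T A D E : {set X}).

Definition shattered F : {set {set X}} :=
  [set S : {set X} | [forall T : {set X}, (T \subset S) ==> [exists A in F, A :&: S == T]]].

Lemma shatteredP F S :
  reflect (forall T, T \subset S -> exists2 A, A \in F & A :&: S = T) (S \in shattered F).
Proof.
rewrite inE; apply: (iffP forallP) => H T.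
  by have /implyP/[apply]/exists_inP[A AF /eqP] := H T; exists A.
by apply/implyP => /H[A AF AS]; apply/exists_inP; exists A => //; apply/eqP.
Qed.

(** Pajor's inequality, by induction on a ground set [D] containing all members. For [x] in [D],
    split [F] into the members avoiding [x] and those containing it, with [x] removed. What either
    half shatters is shattered by [F]; what both shatter stays shattered after adding [x]. *)
Lemma card_le_shattered F : (#|F| <= #|shattered F|)%N.
Proof.
have [D FD] : exists D, forall A, A \in F -> A \subset D by exists [set: X] => A _; exact: finset.subsetT.
move: {2}#|D| (erefl #|D|) => m; elim: m D F FD => [|m IH] D F FD cD.
  have D0 : D = finset.set0 by apply/eqP; rewrite -cards_eq0 cD.
  have [->|[A0 A0F]] := set_0Vmem F; first by rewrite cards0.
  have F1 A : A \in F -> A = finset.set0 by move=> /FD; rewrite D0 finset.subset0 => /eqP.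
  apply: (@leq_trans #|[set (finset.set0 : {set X})]|).
    by apply/subset_leq_card/fintype.subsetP => A /F1 ->; rewrite finset.inE.
  apply/subset_leq_card/fintype.subsetP => S; rewrite finset.inE => /eqP ->.
  apply/shatteredP => T; rewrite finset.subset0 => /eqP ->.
  by exists A0 => //; rewrite finset.setI0.
have [x xD] : exists x, x \in D by apply/finset.set0Pn; rewrite -cards_eq0 cD.
have cD' : #|D :\ x| = m by move: cD; rewrite (cardsD1 x D) xD => -[].
pose F0 := [set A : {set X} in F | x \notin A]; pose F1 := [set A :\ x | A in F & x \in A].
have F0D A : A \in F0 -> A \subset D :\ x.
  by rewrite inE => /andP[/FD AD xA]; rewrite finset.subsetD1 AD.
have F1D A : A \in F1 -> A \subset D :\ x.
  by case/imsetP => B; rewrite inE => /andP[/FD BD _] ->; exact: finset.setSD.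
have c1 : #|F1| = #|[set A : {set X} in F | x \in A]|.
  rewrite card_in_imset; first by apply: eq_card => A; rewrite !inE.
  move=> A B; rewrite !inE => /andP[_ xA] /andP[_ xB] e.
  by rewrite -(finset.setD1K xA) e finset.setD1K.
have cF : #|F| = (#|F0| + #|F1|)%N.
  rewrite c1 -(cardsID [set A : {set X} | x \in A] F) addnC.
  by congr (_ + _)%N; apply: eq_card => A; rewrite !inE // andbC.
have xS (G : {set {set X}}) S : (forall A : {set X}, A \in G -> A \subset D :\ x) -> S \in shattered G -> x \notin S.
  move=> GD /shatteredP/(_ S (subxx _))[A AG AS]; apply/negP => xS.
  by have := GD _ AG; rewrite finset.subsetD1 => /andP[_]; rewrite -AS inE in xS; case/andP: xS => ->.
rewrite cF (leq_trans (leq_add (IH _ _ F0D cD') (IH _ _ F1D cD'))) //.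
(* The sets shattered by both halves are counted a second time as [x |: S], hence apart from all
   sets avoiding [x]. *)
rewrite -cardsUI.
have -> : #|shattered F0 :&: shattered F1| = #|[set x |: S | S in shattered F0 :&: shattered F1]|.
  rewrite card_in_imset // => S S'; rewrite !finset.in_setI => /andP[h _] /andP[h' _] e.
  by rewrite -(finset.setU1K (xS _ _ F0D h)) e (finset.setU1K (xS _ _ F0D h')).
set Z := [set x |: S | S in _]; have dZ : (shattered F0 :|: shattered F1) :&: Z = finset.set0.
  apply/finset.setP => S; rewrite finset.in_setI finset.in_setU finset.in_set0; apply/negP => /andP[/orP h /imsetP[S' _ SE]].
  have : x \notin S by case: h; [exact: xS|exact: xS].
  by rewrite SE !inE eqxx.
rewrite -[X in (X <= _)%N]subn0 -(cards0 {set X}) -dZ -cardsU.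
apply/subset_leq_card/fintype.subsetP => S; rewrite finset.in_setU => /orP[|/imsetP[S']].
  rewrite finset.in_setU => /orP[h|h]; have xnS := xS _ _ _ h; apply/shatteredP => T TS.
    by have /shatteredP/(_ T TS)[A] := h; rewrite inE => /andP[AF _]; exists A.
  have /shatteredP/(_ T TS)[A /imsetP[B + ->] <-] := h; rewrite inE => /andP[BF xB]; exists B => //.
  apply/finset.setP => z; rewrite !inE; case: eqVneq => // ->; by rewrite (negPf (xnS F1D)) andbF.
rewrite finset.in_setI => /andP[h0 h1] ->; have xnS := xS _ _ F0D h0.
apply/shatteredP => T TS.
have TS' : T :\ x \subset S' by rewrite finset.subDset.
have [xT|xT] := boolP (x \in T).
  have /shatteredP/(_ _ TS')[A /imsetP[B + ->] AE] := h1; rewrite inE => /andP[BF xB]; exists B => //.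
  apply/finset.setP => z; have /finset.setP/(_ z) := AE; rewrite !inE.
  by case: eqVneq => [->|] //=; rewrite xB xT.
have /shatteredP/(_ _ TS')[A + AE] := h0; rewrite inE => /andP[AF xA]; exists A => //.
apply/finset.setP => z; have /finset.setP/(_ z) := AE; rewrite !inE.
by case: eqVneq => [->|] //=; rewrite (negPf xA) (negPf xT).
Qed.

(** The trace [E :\: S] is the same for all [T]: [F] contains a full subcube with free coordinates
    [S]. This is the notion dual to shattering, and it bounds [#|F|] from below. *)
Definition strongly_shattered F : {set {set X}} :=
  [set S : {set X} | [exists E : {set X}, [forall T : {set X}, (T \subset S) ==> (T :|: (E :\: S) \in F)]]].

(* S is strongly shattered by F iff ~: S is not shattered by ~: F. *)
Lemma card_strongly_shattered_le F : (#|strongly_shattered F| <= #|F|)%N.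
Proof.
have H S : S \in strongly_shattered F -> ~: S \notin shattered (~: F).
  rewrite inE => /existsP[E /forallP ES]; apply/negP => /shatteredP H.
  have [] := H (E :\: S); first by rewrite finset.setDE finset.subsetIr.
  move=> A AF AE; have /implyP := ES (A :&: S).
  rewrite finset.subsetIr -AE -finset.setIUr finset.setUCr finset.setIT => /(_ isT).
  by move: AF; rewrite inE => /negbTE ->.
have sub : [set ~: S | S in strongly_shattered F] \subset ~: shattered (~: F).
  by apply/fintype.subsetP => _ /imsetP[S /H h ->]; rewrite finset.in_setC.
have := subset_leq_card sub; rewrite card_imset; last exact: can_inj (@finset.setCK X).
have := card_le_shattered (~: F); have := cardsC F; have := cardsC (shattered (~: F)).
move: #|_| #|_| #|_| #|_| #|_| #|_| => *; lia.
Qed.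

Lemma sauer_shelah F d : (forall S, S \in shattered F -> (#|S| <= d)%N) ->
  (#|F| <= \sum_(i < d.+1) 'C(#|X|, i))%N.
Proof.
move=> H; apply: leq_trans (card_le_shattered F) _.
apply: (@leq_trans #|\bigcup_(i < d.+1) [set S : {set X} | #|S| == i]|).
  apply/subset_leq_card/fintype.subsetP => S /H Sd; apply/finset.bigcupP.
  by exists (Ordinal (Sd : (#|S| < d.+1)%N)); rewrite ?inE.
elim/big_rec2: _ => [|i m Y _ IH]; first by rewrite cards0.
apply: leq_trans (leq_card_setU _ _) _; rewrite leq_add // -card_draws.
by apply/subset_leq_card/fintype.subsetP.
Qed.

End Shattering.

Local Open Scope ring_scope.

(** * Fourier analysis modulo q *)

Section Fourier.
Variable R : realType.
Implicit Types (x y t : R).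

Definition expi (t : R) : R[i] := (cos t +i* sin t)%C.

Lemma expiD x y : expi (x + y) = expi x * expi y.
Proof.
by apply/eqP; rewrite eq_complex /= cosD sinD eqxx /= addrC (mulrC (sin x)) eqxx.
Qed.

Lemma expi0 : expi 0 = 1.
Proof. by rewrite /expi cos0 sin0. Qed.

Lemma expi_sum (I : finType) (f : I -> R) : expi (\sum_i f i) = \prod_i expi (f i).
Proof. by apply: (big_morph expi expiD expi0). Qed.

Lemma expiMn t n : expi (t *+ n) = expi t ^+ n.
Proof. by elim: n => [|n IHn]; rewrite ?mulr0n ?expi0 // mulrS expiD IHn exprS. Qed.

Lemma Re_sum (I : finType) (P : pred I) (f : I -> R[i]) :
  complex.Re (\sum_(i | P i) f i) = \sum_(i | P i) complex.Re (f i).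
Proof. by apply: (big_morph (@complex.Re R)) => // - [? ?] [? ?]. Qed.

Lemma Im_sum (I : finType) (P : pred I) (f : I -> R[i]) :
  complex.Im (\sum_(i | P i) f i) = \sum_(i | P i) complex.Im (f i).
Proof. by apply: (big_morph (@complex.Im R)) => // - [? ?] [? ?]. Qed.

(** The complex exponential sum factorizes; since the sine sums vanish, every factor is real and so
    is the product. *)
Lemma sum_cos_prod (I U : finType) (phi : I -> U -> R) :
  (forall i, \sum_u sin (phi i u) = 0) ->
  \sum_(y : {ffun I -> U}) cos (\sum_i phi i (y i)) = \prod_i \sum_u cos (phi i u).
Proof.
move=> phi0.
have -> : \sum_(y : {ffun I -> U}) cos (\sum_i phi i (y i)) =
    complex.Re (\sum_(y : {ffun I -> U}) \prod_i expi (phi i (y i))).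
  by rewrite Re_sum; apply: eq_bigr => y _; rewrite -expi_sum.
rewrite -(bigA_distr_bigA (fun i u => expi (phi i u))) /=.
have E i : \sum_u expi (phi i u) = (\sum_u cos (phi i u))%:C%C.
  by apply/eqP; rewrite eq_complex Re_sum Im_sum /= phi0 !eqxx.
by under eq_bigr do rewrite E; rewrite -(rmorph_prod (real_complex R)).
Qed.

Lemma expi_2piz (m : int) : expi (2 * pi * m%:~R) = 1.
Proof.
have H (n : nat) : expi (2 * pi * n%:R) = 1.
  rewrite mulr_natr expiMn mulr_natl mulr2n expiD.
  have -> : expi pi = -1 by rewrite /expi cospi sinpi; apply/eqP; rewrite eq_complex /= oppr0 !eqxx.
  by rewrite mulrNN mulr1 expr1n.
case: m => n; first exact: H.
rewrite NegzE mulrNz; have := expiD (2 * pi * n.+1%:R) (2 * pi * - n.+1%:R).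
by rewrite H mul1r -mulrDr subrr mulr0 expi0 => <-.
Qed.

Lemma expi_neq1 t : 0 < t < 2 * pi -> expi t != 1.
Proof.
move=> /andP[t0 t2]; apply/eqP => /(congr1 (@complex.Re R)) /= ct.
have : 0 < sin (t / 2) by apply: sin_gt0_pi; lra.
suff -> : sin (t / 2) = 0 by rewrite ltxx.
have : cos (t / 2 + t / 2) = 1 by rewrite -splitr.
rewrite cosD -!expr2 cos2sin2 => h; apply/eqP; rewrite -sqrf_eq0; apply/eqP; lra.
Qed.

Lemma expi_periodic t (m : int) : expi (t + 2 * pi * m%:~R) = expi t.
Proof. by rewrite expiD expi_2piz mulr1. Qed.

Definition ang (q : nat) (m : int) : R := 2 * pi * (m%:~R / q%:R).

Lemma angD q m n : ang q (m + n) = ang q m + ang q n.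
Proof. by rewrite /ang -mulrDr -mulrDl -intrD. Qed.

Lemma ang_mod q m : (0 < q)%N -> expi (ang q (m %% q)%Z) = expi (ang q m).
Proof.
move=> q0; rewrite [in RHS](divz_eq m q) addrC [in RHS]angD.
have -> : ang q ((m %/ q)%Z * q) = 2 * pi * (m %/ q)%Z%:~R.
  by rewrite /ang intrM -pmulrn mulfK // pnatr_eq0 -lt0n.
by rewrite expi_periodic.
Qed.

Lemma cos_ang_mod q m : (0 < q)%N -> cos (ang q (m %% q)%Z) = cos (ang q m).
Proof. by move=> q0; have /(congr1 (@complex.Re R)) := ang_mod m q0. Qed.

Lemma sin_ang_mod q m : (0 < q)%N -> sin (ang q (m %% q)%Z) = sin (ang q m).
Proof. by move=> q0; have /(congr1 (@complex.Im R)) := ang_mod m q0. Qed.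

(** Orthogonality of the characters modulo [q], as the real part of a geometric sum. *)
Lemma sum_cos_ang q (m : int) : (0 < q)%N ->
  \sum_(xi < q) cos (ang q (xi%:Z * m)) = if (q %| m)%Z then q%:R else 0.
Proof.
move=> q0; have qR : (0 : R) < q%:R by rewrite ltr0n.
case: ifP => qm.
  under eq_bigr => xi _.
    rewrite -cos_ang_mod // (_ : (xi%:Z * m %% q)%Z = 0); last first.
      by apply/dvdz_mod0P; exact: dvdz_mull.
    rewrite /ang mul0r mulr0 cos0; over.
  by rewrite sumr_const card_ord.
have E1 : expi (ang q m) != 1.
  rewrite -ang_mod //; apply: expi_neq1.
  have h0 : 0 < (m %% q)%Z.
    have := modz_ge0 m (_ : (q%:Z != 0)); rewrite le_eqVlt => /(_ _)/orP.
    case; [lia| |by []].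
    by rewrite eq_sym => /eqP/dvdz_mod0P; rewrite qm.
  have h1 : (m %% q)%Z < q by apply: ltz_pmod; lia.
  rewrite /ang; apply/andP; split.
    apply: mulr_gt0; first by rewrite mulr_gt0 ?pi_gt0.
    by rewrite divr_gt0 // ltr0z.
  rewrite -[ltRHS]mulr1 ltr_pM2l ?mulr_gt0 ?pi_gt0 //.
  by rewrite ltr_pdivrMr // mul1r [ltRHS]pmulrn ltr_int.
have : (expi (ang q m) - 1) * (\sum_(xi < q) expi (ang q m) ^+ xi) = 0.
  rewrite -subrX1 -expiMn.
  have -> : ang q m *+ q = 2 * pi * m%:~R.
    rewrite /ang -[RHS]mulr1 -[LHS]mulr_natr; field; lra.
  by rewrite expi_2piz subrr.
move/eqP; rewrite mulf_eq0 subr_eq0 (negPf E1) /= => /eqP/(congr1 (@complex.Re R)).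
rewrite Re_sum /= => h; rewrite -[RHS]h; apply: eq_bigr => xi _.
rewrite -expiMn /=; congr cos; rewrite /ang intrM -pmulrn -[RHS]mulr_natr; ring.
Qed.

(** Fourier inversion for the event that the walk vanishes modulo [q]. The involution [tau] makes
    the steps symmetric, so that only cosines remain. *)
Lemma count_dvd_cos (I U : finType) (q : nat) (a : I -> int) (v : U -> int) (tau : U -> U) :
  (0 < q)%N -> involutive tau -> (forall u, v (tau u) = - v u) ->
  (q * #|[set y : {ffun I -> U} | (q %| \sum_i a i * v (y i))%Z]|)%:R =
  \sum_(xi < q) \prod_i \sum_u cos (ang q (xi%:Z * a i) * (v u)%:~R).
Proof.
move=> q0 tauK vtau.
have -> : (q * #|[set y : {ffun I -> U} | (q %| \sum_i a i * v (y i))%Z]|)%:R =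
   \sum_(y : {ffun I -> U}) \sum_(xi < q) cos (ang q (xi%:Z * \sum_i a i * v (y i))).
  under [RHS]eq_bigr do rewrite sum_cos_ang //.
  rewrite -big_mkcond /= sumr_const natrM mulr_natr; congr (_ *+ _).
  by rewrite cardsE.
rewrite exchange_big /=; apply: eq_bigr => xi _.
rewrite -(@sum_cos_prod I U (fun i u => ang q (xi%:Z * a i) * (v u)%:~R)); last first.
  move=> i; apply/eqP; rewrite -[_ == 0](mulrn_eq0 _ 2) mulr2n.
  rewrite {2}(reindex_inj (can_inj tauK)) /= -big_split /= big1 // => u _.
  by rewrite vtau intrN mulrN sinN subrr.
apply: eq_bigr => y _; congr cos; rewrite mulr_sumr /ang.
rewrite raddf_sum /= mulr_suml mulr_sumr; apply: eq_bigr => i _.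
by rewrite !intrM; ring.
Qed.

End Fourier.

(** * Doubling of sublevel sets in a finite abelian group *)

Section Growth.
Variables (R : realType) (G : finZmodType) (psi : G -> R) (c : R).
Hypothesis psi_ge0 : forall x, 0 <= psi x.
Hypothesis psi0 : psi 0 = 0.
Hypothesis psiN : forall x, psi (- x) = psi x.
Hypothesis psiD : forall x y, psi (x + y) <= 2 * psi x + 2 * psi y.
Hypothesis psi_mul_large : forall b, b != 0 -> exists m : nat, c <= psi (b *+ m).

Definition level (t : R) : {set G} := [set x | psi x <= t].

(* Were the difference set of [level t] closed under addition, it would contain
   all multiples of b, one of which has psi >= c; so two disjoint translates of
   [level t] fit in [level (64 * t)]. *)
Lemma level_double t b : b != 0 -> psi b <= t -> 4 * t < c ->
  (2 * #|level t| <= #|level (64 * t)|)%N.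
Proof.
move=> b0 bt tc; have t0 : 0 <= t := le_trans (psi_ge0 b) bt.
pose B : {set G} := [set a.1 - a.2 | a in finset.setX (level t) (level t)].
have BP z : reflect (exists a a', [/\ a \in level t, a' \in level t & z = a - a']) (z \in B).
  apply: (iffP imsetP) => [[[a a']]|[a [a' [? ? ->]]]].
    by rewrite inE /= => /andP[? ?] ->; exists a, a'.
  by exists (a, a') => //; rewrite inE; apply/andP.
have psiB z : z \in B -> psi z <= 4 * t.
  case/BP=> a [a' []]; rewrite !inE => at' a't ->.
  by apply: le_trans (psiD _ _) _; rewrite psiN; lra.
have [x [y [xB yB xyB]]] : exists x y, [/\ x \in B, y \in B & x + y \notin B].
  have [/exists_inP[x xB /exists_inP[y yB xyB]]|] :=
    boolP [exists x in B, [exists y in B, x + y \notin B]]; first by exists x, y.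
  rewrite negb_exists_in => /forall_inP H0.
  have {H0}H x y : x \in B -> y \in B -> x + y \in B.
    by move=> /H0; rewrite negb_exists_in => /forall_inP H yB; have := H _ yB; rewrite negbK.
  have l0 : 0 \in level t by rewrite inE psi0.
  have bB : b \in B by apply/BP; exists b, 0; rewrite inE subr0.
  have mB m : b *+ m \in B.
    elim: m => [|m IH]; last by rewrite mulrS H.
    by rewrite mulr0n; apply/BP; exists 0, 0; rewrite subr0.
  have [m cm] := psi_mul_large b0.
  by have := psiB _ (mB m); lra.
have psiz : psi (x + y) <= 16 * t.
  by apply: le_trans (psiD _ _) _; have := psiB _ xB; have := psiB _ yB; lra.
pose A' := [set a + (x + y) | a in level t].
have cA' : #|A'| = #|level t| by rewrite card_imset //; apply: addIr.
have disj : level t :&: A' = finset.set0.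
  apply/finset.setP => z; rewrite !inE; apply/negP => /andP[zt /imsetP[a at' zE]].
  by case/negP: xyB; apply/BP; exists z, a; split; rewrite ?at' ?[_ \in _]inE // zE addrAC subrr add0r.
have <- : #|level t :|: A'| = (2 * #|level t|)%N.
  by rewrite cardsU disj cards0 subn0 cA' mul2n addnn.
apply/subset_leq_card/fintype.subsetP => z; rewrite !inE => /orP[zt|/imsetP[a]].
  by apply: le_trans zt _; lra.
(* Here [2 * t + 2 * (16 * t) = 34 * t], which is within [64 * t]. *)
rewrite inE => at' ->; apply: le_trans (psiD _ _) _; lra.
Qed.

Lemma level_growth l t b : b != 0 -> psi b <= t -> 4 * (64 ^+ l * t) < c ->
  (2 ^ l * #|level t| <= #|level (64 ^+ l * t)|)%N.
Proof.
move=> b0 bt; have t0 : 0 <= t := le_trans (psi_ge0 b) bt.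
have E n : t <= 64 ^+ n * t by rewrite ler_peMl // exprn_ege1 //; lra.
elim: l => [|l IH] tc; first by rewrite expn0 expr0 mul1n mul1r.
have E1 := E l; have tc' : 4 * (64 ^+ l * t) < c.
  by apply: le_lt_trans tc; rewrite exprS -mulrA; lra.
rewrite expnS -mulnA exprS -mulrA.
apply: leq_trans (level_double b0 _ tc'); first by rewrite leq_mul2l IH.
exact: le_trans bt E1.
Qed.

(** Either [level t] has no nonzero element, which the summand 1 pays for, or it contains the [b]
    that [level_growth] asks for. *)
Lemma level_bound l t : 0 <= t -> 4 * (64 ^+ l * t) < c ->
  #|level t|%:R <= 1 + 2^-1 ^+ l * #|level (64 ^+ l * t)|%:R :> R.
Proof.
move=> t0 tc; have [/existsP[b /andP[b0 bt]]|] := boolP [exists b, (b != 0) && (psi b <= t)].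
  have := level_growth b0 bt tc; rewrite -(ler_nat R) natrM natrX exprVn => h.
  apply: ler_wpDl => //; rewrite ler_pdivlMl ?exprn_gt0 //.
rewrite negb_exists => /forallP H.
apply: ler_wpDr; first by rewrite mulr_ge0 // exprn_ge0 // invr_ge0.
rewrite lern1 -(cards1 (0 : G)); apply/subset_leq_card/fintype.subsetP => x; rewrite !inE => xt.
by have := H x; rewrite xt andbT negbK.
Qed.

End Growth.

(** * From level sets to exponential sums *)

Section Layer.
Variable R : realType.

Let z : R := expR (- 2^-1).

Lemma expz m : z ^+ m = expR (- (m%:R / 2)).
Proof. by rewrite /z -expRM_natl; congr expR; rewrite mulrN. Qed.

Lemma z_gt0 : 0 < z. Proof. exact: expR_gt0. Qed.

Lemma zS m : z ^+ m.+1 <= z ^+ m.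
Proof. by rewrite !expz ler_expR -natr1; lra. Qed.

(** Layer-cake decomposition at integer thresholds: if [k] is the least index with [y <= k.+1], the
    layers from [k] on telescope to [z ^+ k - z ^+ T], and [z ^+ k] is [expR (- (y / 2))] up to a
    rounding factor [expR 2^-1]. The companion bound [layer_upper] pays that factor. *)
Lemma layer_lower (y : R) (T : nat) : 0 <= y ->
  expR (- (y / 2)) <= \sum_(m < T) (z ^+ m - z ^+ m.+1) * (y <= m.+1%:R)%R%:R + z ^+ T.
Proof.
move=> y0; elim: T => [|T IH].
  by rewrite big_ord0 add0r expr0 -[leRHS]expR0 ler_expR; lra.
rewrite big_ord_recr /=; case: (lerP y T.+1%:R) => yT.
  by rewrite mulr1 -addrA subrK.
rewrite mulr0 addr0 big1 ?add0r ?expz ?ler_expR; first lra.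
move=> m _; rewrite leNgt; suff -> : (m.+1%:R : R) < y by rewrite mulr0.
by apply: le_lt_trans yT; rewrite ler_nat; have := ltn_ord m; lia.
Qed.

Lemma layer_upper (y : R) (T : nat) :
  \sum_(m < T) (z ^+ m - z ^+ m.+1) * (y <= m.+1%:R)%R%:R <= expR (2^-1 - y / 2).
Proof.
(* The stated bound alone does not pass through the induction: the term [- z ^+ T] of the
   telescoping sum is kept, except while no layer has been reached. *)
have H : \sum_(m < T) (z ^+ m - z ^+ m.+1) * (y <= m.+1%:R)%R%:R = 0 \/
  \sum_(m < T) (z ^+ m - z ^+ m.+1) * (y <= m.+1%:R)%R%:R <= expR (2^-1 - y / 2) - z ^+ T.
  elim: T => [|T IH]; first by left; rewrite big_ord0.
  rewrite big_ord_recr /=; case: (lerP y T.+1%:R) => yT; last first.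
    left; rewrite mulr0 addr0 big1 // => m _; rewrite leNgt.
    suff -> : (m.+1%:R : R) < y by rewrite mulr0.
    by apply: le_lt_trans yT; rewrite ler_nat; have := ltn_ord m; lia.
  right; rewrite mulr1; case: IH => [->|]; last by lra.
  rewrite add0r lerD2r expz ler_expR; rewrite -natr1 in yT; lra.
case: H => [->|h]; first exact: expR_ge0.
by apply: le_trans h _; rewrite gerBl exprn_ge0 // ltW // z_gt0.
Qed.

(** Summing the level-set inequality against the layer weights turns it into one between exponential
    sums: the dilation [E] of the levels becomes a division of the exponent, and the last term
    accounts for the levels beyond [T]. *)
Lemma sum_expR_level (G : finType) (psi : G -> R) (E d : R) (T : nat) :
  0 < E -> 0 <= d -> (forall x, 0 <= psi x) ->
  (forall m, (m < T)%N ->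
     #|[set x | psi x <= m.+1%:R]|%:R <= 1 + d * #|[set x | psi x <= E * m.+1%:R]|%:R) ->
  \sum_x expR (- (psi x / 2)) <=
    1 + d * (expR 2^-1 * \sum_x expR (- (psi x / (2 * E)))) + #|G|%:R * expR (- (T%:R / 2)).
Proof.
move=> E0 d0 psi_ge0 H.
have cardE t : #|[set x | psi x <= t]|%:R = \sum_x (psi x <= t)%R%:R :> R.
  by rewrite -sum1_card natr_sum big_mkcond; apply: eq_bigr => x _; rewrite inE; case: ifP.
apply: (@le_trans _ _ (\sum_x (\sum_(m < T) (z ^+ m - z ^+ m.+1) * (psi x <= m.+1%:R)%R%:R + z ^+ T))).
  by apply: ler_sum => x _; apply: layer_lower.
rewrite big_split /= sumr_const -expz -[_ *+ #|_|]mulr_natl lerD2r exchange_big /=.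
under eq_bigr do rewrite -mulr_sumr -cardE.
apply: (@le_trans _ _ (\sum_(m < T) (z ^+ m - z ^+ m.+1) *
   (1 + d * #|[set x | psi x <= E * m.+1%:R]|%:R))).
  by apply: ler_sum => m _; rewrite ler_wpM2l ?subr_ge0 ?zS // H.
have -> : \sum_(m < T) (z ^+ m - z ^+ m.+1) * (1 + d * #|[set x | psi x <= E * m.+1%:R]|%:R) =
    \sum_(m < T) (z ^+ m - z ^+ m.+1) +
    d * \sum_(m < T) (z ^+ m - z ^+ m.+1) * #|[set x | psi x <= E * m.+1%:R]|%:R.
  by rewrite mulr_sumr -big_split /=; apply: eq_bigr => m _; rewrite mulrDr mulr1 mulrCA.
apply: lerD.
  rewrite -(big_mkord xpredT (fun m => z ^+ m - z ^+ m.+1)) /=.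
  rewrite (telescope_sumr_eq (fun m => - z ^+ m)) //; last by move=> k _; rewrite opprK addrC.
  by rewrite expr0 opprK addrC gerBl exprn_ge0 // ltW // z_gt0.
rewrite ler_wpM2l //.
have -> : \sum_(m < T) (z ^+ m - z ^+ m.+1) * #|[set x | psi x <= E * m.+1%:R]|%:R =
    \sum_(m < T) \sum_x (z ^+ m - z ^+ m.+1) * (psi x <= E * m.+1%:R)%R%:R.
  by apply: eq_bigr => m _; rewrite cardE mulr_sumr.
rewrite exchange_big mulr_sumr /=; apply: ler_sum => x _.
apply: le_trans (_ : expR (2^-1 - (psi x / E) / 2) <= _); last first.
  rewrite -expRD ler_expR (_ : psi x / E / 2 = psi x / (2 * E)) //.
  by rewrite invfM mulrA mulrAC.
apply: le_trans (layer_upper _ T); apply: ler_sum => m _.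
by rewrite ler_pdivrMr // [E * _]mulrC lexx.
Qed.
End Layer.

(** * Comparison of the sign walk with the lazy walk *)

Section Compare.
Variable R : realType.

Lemma cos_ang3 (m : int) : ~~ (3 %| m)%Z -> cos (ang R 3 m) = - 2^-1.
Proof.
move=> m3; have := sum_cos_ang R m (isT : (0 < 3)%N); rewrite (negPf m3).
rewrite !big_ord_recl big_ord0 /= /bump /= mul0r mul1r.
rewrite (_ : ang R 3 0 = 0) ?cos0; last by rewrite /ang mul0r mulr0.
have -> : (1 + 1)%N%:Z * m = m + m by lia.
rewrite angD; set al := ang R 3 m; rewrite cosD.
have h3 : cos (al + al + al) = 1.
  have := expi_2piz R m; rewrite (_ : 2 * pi * m%:~R = al + al + al).
    by move/(congr1 (@complex.Re R)).
  by rewrite /al /ang; field.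
have := cos2sin2 al; rewrite (cosD (al + al)) cosD sinD in h3.
set c := cos al in h3 *; set s := sin al in h3 *; rewrite !expr2 => cs h.
have /eqP : c * (2 * c + 1) = 0 by lra.
rewrite mulf_eq0 => /orP[/eqP c0|/eqP]; last lra.
by exfalso; rewrite c0 !mul0r mulr0 in h3; lra.
Qed.

Lemma sin2_ang3 (m : int) : ~~ (3 %| m)%Z -> sin (ang R 3 m) ^+ 2 = 3 / 4.
Proof. by move=> /cos_ang3 h; rewrite sin2cos2 h; lra. Qed.

Section Psi.
Variables (I : finType) (e Q : nat) (a : I -> int).
Hypothesis (Qe : Q.+1 = (3 ^ e)%N).
Let q := Q.+1.

(** This controls the logarithm of the characteristic function of both walks at the frequency [xi],
    and it is the function to which [Growth] is applied. The successor form of the modulus gives the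
    ordinals their structure of cyclic group. *)
Definition psi (xi : 'I_Q.+1) : R := \sum_i sin (ang R q (xi%:Z * a i)) ^+ 2.

Lemma psi_ge0 xi : 0 <= psi xi.
Proof. by apply: sumr_ge0 => i _; exact: sqr_ge0. Qed.

Lemma sin_ang_eqmod (x y : int) : (x = y %[mod q])%Z -> sin (ang R q x) = sin (ang R q y).
Proof. by move=> xy; rewrite -sin_ang_mod // xy sin_ang_mod. Qed.

Lemma psi0 : psi 0 = 0.
Proof. by apply: big1 => i _; rewrite mul0r /ang mul0r mulr0 sin0 expr0n. Qed.

Lemma psiN xi : psi (- xi) = psi xi.
Proof.
apply: eq_bigr => i _; rewrite -[RHS]sqrrN -sinN; congr (_ ^+ 2).
have -> : - ang R q (xi%:Z * a i) = ang R q (- xi%:Z * a i).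
  by rewrite /ang -mulrN -mulNr -intrN mulNr.
apply: sin_ang_eqmod; apply/eqP; rewrite -modzMml -[in eqbRHS]modzMml; apply/eqP.
congr (((_ * _) %% _)%Z); rewrite /= -modz_nat modz_mod; apply/eqP.
by rewrite eqz_mod_dvd; apply/dvdzP; exists 1; have := ltn_ord xi; rewrite /q; lia.
Qed.

Lemma psiD x y : psi (x + y) <= 2 * psi x + 2 * psi y.
Proof.
rewrite /psi !mulr_sumr -big_split /=; apply: ler_sum => i _.
rewrite (@sin_ang_eqmod _ (x%:Z * a i + y%:Z * a i)); last first.
  by rewrite -mulrDl -[in RHS]modzMml -modzMml /= -modz_nat modz_mod PoszD.
rewrite angD sinD; set u := ang _ _ _; set v := ang _ _ _.
have := cos2sin2 u; have := cos2sin2 v; have := sqr_ge0 (sin u); have := sqr_ge0 (sin v).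
have := sqr_ge0 (sin u * cos v - cos u * sin v); have := sqr_ge0 (sin u * sin v).
rewrite !expr2; nra.
Qed.

(** Write [b = u * 3 ^ f] with [u] prime to 3. Multiplication by [3 ^ (e - f.+1)] leads to
    [u * 3 ^ e.-1], a frequency of order 3, where every coefficient prime to 3 contributes the
    squared sine of a third of a turn, [3 / 4]. *)
Lemma psi_mul_large b : b != 0 ->
  exists m : nat, (3 / 4) * #|[set i | ~~ (3 %| a i)%Z]|%:R <= psi (b *+ m).
Proof.
move=> b0; have b_gt0 : (0 < b)%N by rewrite lt0n.
have [u u3 bE] := pfactor_coprime (isT : prime 3) b_gt0.
set f := logn 3 b in bE; have fe : (f < e)%N.
  rewrite -(ltn_exp2l _ _ (isT : (1 < 3)%N)) -Qe; apply: leq_ltn_trans (ltn_ord b).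
  by rewrite [leqRHS]bE leq_pmull //; case: (u) u3.
exists (3 ^ (e - f.+1))%N; rewrite /psi.
have -> : 3 / 4 * #|[set i | ~~ (3 %| a i)%Z]|%:R = \sum_(i | ~~ (3 %| a i)%Z) (3 / 4) :> R.
  by rewrite sumr_const mulr_natr cardsE.
rewrite big_mkcond /=; apply: ler_sum => i _; case: ifP => ai; last exact: sqr_ge0.
suff -> : sin (ang R q ((b *+ 3 ^ (e - f.+1))%R%:Z * a i)) = sin (ang R 3 (u%:Z * a i)).
  by rewrite sin2_ang3 // Gauss_dvdzr.
rewrite (@sin_ang_eqmod _ ((u * 3 ^ e.-1)%N%:Z * a i)); last first.
  rewrite -[in RHS]modzMml -modzMml Zp_mulrn /= -modz_nat modz_mod [in LHS]bE.
  by rewrite -mulnA -expnD (_ : (f + (e - f.+1))%N = e.-1) //; lia.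
congr sin; rewrite /ang; congr (_ * _).
have q3 : q%:R = 3 * (3 ^ e.-1)%:R :> R.
  by rewrite /q Qe -natrM -expnS; congr (_ ^ _)%:R; lia.
have x0 : (3 ^ e.-1)%:R != 0 :> R by rewrite pnatr_eq0 expn_eq0.
rewrite q3 !intrM PoszM intrM -!pmulrn; field; exact: x0.
Qed.

(* For uniform u the values 2 and -2 have probability 1 / (2 (D + 1)) each. *)
Definition lazyv (D : nat) (u : bool * 'I_D.+1) : int :=
  if u.2 == ord0 then 2 * (-1) ^+ u.1 else 0.

Definition signv (b : bool) : int := (-1) ^+ b.

Definition countv (U : finType) (v : U -> int) (q : nat) :=
  #|[set y : {ffun I -> U} | (q %| \sum_i a i * v (y i))%Z]|.

(** Each Fourier factor satisfies [|cos t| <= (1 + cos t ^ 2) / 2 = 1 - sin t ^ 2 / 2 <= expR (-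
    (sin t ^ 2 / 2))]. *)
Lemma count_sign_le : q%:R * ((countv signv q)%:R / 2 ^+ #|I|) <= \sum_xi expR (- (psi xi / 2)) :> R.
Proof.
rewrite mulrA -natrM (@count_dvd_cos R I bool q a signv negb) //; first last.
- by case; rewrite /signv ?expr0 ?expr1 ?opprK.
- exact: negbK.
rewrite ler_pdivrMr ?exprn_gt0 // mulr_suml; apply: ler_sum => xi _.
have -> : 2 ^+ #|I| = \prod_(i : I) (2 : R) by rewrite prodr_const.
rewrite /psi mulr_suml -sumrN expR_sum -big_split /=.
apply: le_trans (ler_norm _) _; rewrite normr_prod; apply: ler_prod => i _; rewrite normr_ge0 /=.
set t := ang _ _ _; rewrite big_bool /signv /= expr0 expr1 mulr1 mulrN1 cosN.
have := expR_ge1Dx (- (sin t ^+ 2 / 2)); have := cos2sin2 t.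
have := sqr_ge0 (`|cos t| - 1); rewrite sqrrB real_normK ?num_real // mulr1.
rewrite -[cos t + cos t]mulr2n normrMn; lra.
Qed.

(** A lazy step has the factor [(D + cos (2 t)) / D.+1 = 1 - w] with [w = 2 / D.+1 * sin t ^ 2].
    Laziness keeps all factors positive, which allows a termwise lower bound; [D.+1 >= 4] ensures
    [w <= 1 / 2]. *)
Lemma count_lazy_ge (D : nat) : (4 <= D.+1)%N ->
  \sum_xi expR (- (4 / D.+1%:R * psi xi)) <= q%:R * ((countv (@lazyv D) q)%:R / (2 * D.+1)%:R ^+ #|I|) :> R.
Proof.
move=> D4; have D0 : (0 : R) < D.+1%:R by rewrite ltr0n.
have D4R : (4 : R) <= D.+1%:R by rewrite ler_nat.
rewrite mulrA -natrM.
rewrite (@count_dvd_cos R I _ q a (@lazyv D) (fun u => (~~ u.1, u.2))) //; first last.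
- move=> [b j]; rewrite /lazyv /=; case: ifP => _; last by rewrite oppr0.
  by case: b; rewrite /= ?expr0 ?expr1 ?mulrN ?opprK.
- by move=> [b j] /=; rewrite negbK.
rewrite ler_pdivlMr ?exprn_gt0 ?ltr0n // mulr_suml; apply: ler_sum => xi _.
have -> : (2 * D.+1)%:R ^+ #|I| = \prod_(i : I) (2 * D.+1%:R : R) by rewrite prodr_const natrM.
rewrite /psi mulr_sumr -sumrN expR_sum -big_split /=.
apply: ler_prod => i _; apply/andP; split; first by rewrite mulr_ge0 ?expR_ge0 ?mulr_ge0.
set t := ang _ _ _.
have -> : \sum_u cos (t * (@lazyv D u)%:~R) = 2 * D.+1%:R * (1 - 2 / D.+1%:R * sin t ^+ 2).
  have -> : \sum_(u : bool * 'I_D.+1) cos (t * (lazyv u)%:~R) =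
      \sum_b \sum_j cos (t * (@lazyv D (b, j))%:~R).
    by rewrite pair_big /=; apply: eq_bigr => -[].
  rewrite big_bool /=.
  have H b : \sum_(j < D.+1) cos (t * (@lazyv D (b, j))%:~R) = D%:R + cos (t + t).
    rewrite big_ord_recl /lazyv /= addrC; congr (_ + _).
      under eq_bigr do rewrite /= mulr0 cos0.
      by rewrite sumr_const card_ord.
    have t2 : t * (2 : int)%:~R = t + t by rewrite mulr_natr mulr2n.
    by case: b; rewrite /= ?expr1 ?expr0 ?mulrN1 ?mulr1 ?intrN ?mulrN ?cosN t2.
  rewrite !H cosD -!expr2 cos2sin2 -natr1; field; lra.
rewrite mulrC ler_pM2l ?mulr_gt0 //.
set w := 2 / D.+1%:R * sin t ^+ 2.
have -> : - (4 / D.+1%:R * sin t ^+ 2) = - (2 * w) by rewrite /w; field; lra.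
have w0 : 0 <= w by rewrite mulr_ge0 ?divr_ge0 ?sqr_ge0.
have w1 : w <= 2^-1.
  have s1 : sin t ^+ 2 <= 1 by have := cos2sin2 t; have := sqr_ge0 (cos t); lra.
  have d1 : 2 / D.+1%:R <= 2^-1 :> R by rewrite ler_pdivrMr //; lra.
  by apply: le_trans (ler_pM _ _ d1 s1) _; rewrite ?divr_ge0 ?sqr_ge0 //; lra.
(* For [0 <= w <= 1 / 2], [expR (2 w) >= 1 + 2 w >= 1 / (1 - w)]. *)
rewrite expRN -[leRHS]invrK lef_pV2 ?posrE ?expR_gt0 ?invr_gt0; [|lra|lra].
apply: le_trans (expR_ge1Dx _); rewrite -div1r ler_pdivrMr; nra.
Qed.

(** Halasz's comparison. The choice [D.+1 = 8 * 64 ^ l] makes the exponent [4 / D.+1] of the lazy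
    walk equal to the one produced by [sum_expR_level] with [E = 64 ^ l]. The two remaining error
    terms are at most 1 each; the sign side being at least 4, they take at most half of it. *)
Lemma count_sign_lazy (l T D : nat) : D.+1 = (8 * 64 ^ l)%N ->
  4 * (64 ^+ l * T%:R) < (3 / 4) * #|[set i | ~~ (3 %| a i)%Z]|%:R :> R ->
  q%:R <= expR (T%:R / 2) :> R ->
  4 <= q%:R * ((countv signv q)%:R / 2 ^+ #|I|) :> R ->
  (countv signv q)%:R / 2 ^+ #|I| <=
    4 * 2^-1 ^+ l * ((countv (@lazyv D) q)%:R / (2 * D.+1)%:R ^+ #|I|) :> R.
Proof.
move=> DE Tc qT r4.
have E0 : (0 : R) < 64 ^+ l by rewrite exprn_gt0.
have q0 : (0 : R) < q%:R by rewrite ltr0n.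
have d0 : (0 : R) <= 2^-1 ^+ l by rewrite exprn_ge0.
have := @sum_expR_level R _ psi (64 ^+ l) (2^-1 ^+ l) T E0 d0 psi_ge0.
have H m : (m < T)%N -> #|[set x | psi x <= m.+1%:R]|%:R <= 1 + 2^-1 ^+ l *
    #|[set x | psi x <= 64 ^+ l * m.+1%:R]|%:R :> R.
  move=> mT; apply: (level_bound psi_ge0 psi0 psiN psiD psi_mul_large) => //.
  apply: le_lt_trans Tc; rewrite ler_pM2l // ler_pM2l // ler_nat //.
move=> /(_ H) {H}; rewrite card_ord -/q.
have D1 : D.+1%:R = 8 * 64 ^+ l :> R by rewrite DE natrM natrX.
have D4 : (4 <= D.+1)%N.
  by rewrite DE (leq_trans (isT : (4 <= 8 * 1)%N)) // leq_mul2l expn_gt0.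
have := count_lazy_ge D4.
under eq_bigr => xi _.
  rewrite (_ : 4 / D.+1%:R * psi xi = psi xi / (2 * 64 ^+ l)); last first.
    by rewrite D1; field; rewrite gt_eqF.
  over.
have := count_sign_le; set S1 := \sum_xi _; set S2 := \sum_xi _.
have S20 : 0 <= S2 by apply: sumr_ge0 => x _; exact: expR_ge0.
set rX := _ / _ in r4 *; set rY := _ / _ => h1 h2.
have e1 : expR 2^-1 <= 2 :> R.
  have := expR_ge1Dx (- 2^-1 : R); rewrite expRN => h.
  have e0 : 0 < expR 2^-1 :> R := expR_gt0 _.
  have : 2^-1 <= (expR 2^-1)^-1 :> R by lra.
  by rewrite lef_pV2 ?posrE.
have t1 : q%:R * expR (- (T%:R / 2)) <= 1 :> R.
  by rewrite expRN ler_pdivrMr ?expR_gt0 // mul1r.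
have h3 : 2^-1 ^+ l * (expR 2^-1 * S2) <= 2^-1 ^+ l * (2 * (q%:R * rY)).
  by apply: ler_wpM2l => //; apply: ler_pM => //; exact: expR_ge0.
move=> h4; rewrite -(ler_pM2l q0); lra.
Qed.

End Psi.
End Compare.

(** * Random lazy vectors modulo powers of 3 *)

Section Odlyzko.
Variables (s : nat) (U : finType) (v : U -> int) (B : nat).
Hypothesis vB : forall c : 'F_3, (#|[set u | (v u)%:~R == c]| <= B)%N.

Definition row3 (y : {ffun 'I_s -> U}) : 'rV['F_3]_s := \row_i (v (y i))%:~R.

(** Independent columns of a row basis of [V], as many as its rank, form an invertible matrix, so
    the coordinates in these columns determine the coefficients of a vector of the row space. *)
Lemma column_basis (m : nat) (V : 'M['F_3]_(m, s)) :
  exists2 J : {set 'I_s}, #|J| = \rank V &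
    forall z z' : 'rV['F_3]_s, (z <= V)%MS -> (z' <= V)%MS ->
      (forall i, i \in J -> z 0 i = z' 0 i) -> z = z'.
Proof.
pose W := row_base V; pose f := maxrankfun W^T.
exists [set f i | i in 'I_(\rank W^T)].
  by rewrite card_imset ?card_ord ?mxrank_tr ?mxrank_gen ?eq_row_base //; exact: maxrankfun_inj.
move=> z z'; rewrite -(eq_row_base V) => /submxP[c ->]; rewrite -(eq_row_base V) => /submxP[c' ->] H.
have fr : row_free (colsub f W).
  rewrite /row_free -mxrank_tr.
  have -> : (colsub f W)^T = rowsub f W^T by apply/matrixP => i j; rewrite !mxE.
  by rewrite eq_maxrowsub mxrank_tr; have := row_base_free V; rewrite /row_free.
suff -> : c = c' by [].
apply: (row_free_inj fr); apply/rowP => j.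
have E d : (d *m colsub f W) 0 j = (d *m W) 0 (f j).
  by rewrite !mxE; apply: eq_bigr => k _; rewrite mxE.
rewrite !E; by apply: H; apply/imsetP; exists j.
Qed.

(* Odlyzko: coordinates outside a column basis of V are forced by the others. *)
Lemma card_row_in_submx (m : nat) (V : 'M['F_3]_(m, s)) :
  (#|[set y | (row3 y <= V)%MS]| <= #|U| ^ \rank V * B ^ (s - \rank V))%N.
Proof.
have [J cJ HJ] := column_basis V.
pose c (t : 'F_3) := #|[set u | (v u)%:~R == t]|.
pose Z := [set z : {ffun 'I_s -> 'F_3} | (\row_i z i <= V)%MS].
have E : #|[set y | (row3 y <= V)%MS]| = (\sum_(z in Z) \prod_i c (z i))%N.
  pose g (y : {ffun 'I_s -> U}) := [ffun i => (v (y i))%:~R : 'F_3].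
  rewrite -sum1_card (partition_big g (mem Z)) /=; last first.
    by move=> y; rewrite !inE; congr (_ <= _)%MS; apply/rowP => i; rewrite !mxE ffunE.
  apply: eq_bigr => z zZ.
  have -> : (\prod_i c (z i) = \prod_i \sum_(u | (v u)%:~R == z i) 1)%N.
    by apply: eq_bigr => i _; rewrite sum1_card /c cardsE.
  rewrite bigA_distr_big_dep /=.
  under [in RHS]eq_bigr do rewrite big1_eq.
  apply: eq_bigl => y; rewrite !inE; apply/andP/familyP => [[_ /eqP <-] i|H].
    by rewrite unfold_in ffunE.
  have gz : g y = z by apply/ffunP => i; rewrite ffunE; apply/eqP; exact: H.
  split; last exact/eqP.
  by move: zZ; rewrite -gz inE; congr (_ <= _)%MS; apply/rowP => i; rewrite !mxE ffunE.
rewrite {}E.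
(* Coordinates outside [J] are set to 0 rather than dropped, so that the sum over [Z] becomes part
   of the expansion of a product, in which [Q] admits only 0 outside [J]. *)
pose h (z : {ffun 'I_s -> 'F_3}) := [ffun i => if i \in J then z i else 0].
pose F i (t : 'F_3) := if i \in J then c t else 1%N.
apply: (@leq_trans (\sum_(z in Z) (\prod_i F i (h z i)) * B ^ (s - \rank V))%N).
  apply: leq_sum => z _; rewrite (bigID (mem J)) [in leqRHS](bigID (mem J)) /=.
  rewrite -mulnA leq_mul //.
    by apply: leq_prod => i iJ; rewrite /F ffunE iJ.
  rewrite [X in (_ <= X * _)%N]big1 ?mul1n; last by move=> i iJ; rewrite /F (negPf iJ).
  have -> : (s - \rank V)%N = #|~: J| by rewrite cardsCs finset.setCK card_ord cJ.
  rewrite -prod_nat_const [leqRHS](eq_bigl (fun i => i \notin J)); last by move=> i; rewrite inE.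
  by apply: leq_prod => i _; exact: vB.
rewrite -big_distrl leq_mul2r /=; apply/orP; right.
have hi : {in Z &, injective h}.
  move=> z z'; rewrite !inE => zV zV' hh; have : \row_i z i = \row_i z' i.
    by apply: HJ => // i iJ; rewrite !mxE; have /ffunP/(_ i) := hh; rewrite !ffunE iJ.
  by move/rowP => H; apply/ffunP => i; have := H i; rewrite !mxE.
rewrite -(big_imset (fun g : {ffun 'I_s -> 'F_3} => \prod_i F i (g i))%N hi) /=.
pose Q i : pred 'F_3 := fun t => (i \in J) || (t == 0).
have -> : (#|U| ^ \rank V = \prod_i \sum_(t | Q i t) F i t)%N.
  rewrite (bigID (mem J)) /= [X in (_ * X)%N]big1 ?muln1; last first.
    move=> i iJ; rewrite (eq_bigl (pred1 0)) ?big_pred1_eq ?/F ?(negPf iJ) //.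
    by move=> t; rewrite /Q (negPf iJ).
  rewrite (eq_bigr (fun=> #|U|)) ?prod_nat_const ?cJ // => i iJ.
  rewrite (eq_bigl xpredT) /F ?iJ //; last by move=> t; rewrite /Q iJ.
  rewrite -sum1_card (partition_big (fun u => (v u)%:~R : 'F_3) xpredT) //=.
  by apply: eq_bigr => t _; rewrite sum1_card /c cardsE.
rewrite bigA_distr_big_dep /= [leqRHS](bigID (mem (h @: Z))) /=.
apply: leq_trans (leq_addr _ _); rewrite leq_eqVlt; apply/orP; left; apply/eqP.
apply: eq_bigl => g; rewrite andbC; case: imsetP => //= -[z zZ ->].
by symmetry; apply/familyP => i; rewrite unfold_in /Q ffunE; case: ifP.
Qed.

End Odlyzko.

(** * Annihilators modulo powers of 3 *)

Section Solutions.
Variables (s : nat).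
Implicit Types (y : {ffun 'I_s -> int}).

Definition sols (e : nat) (Y : seq {ffun 'I_s -> int}) : {set {ffun 'I_s -> 'I_(3 ^ e)}} :=
  [set a : {ffun 'I_s -> 'I_(3 ^ e)} | all (fun y : {ffun 'I_s -> int} => ((3 ^ e)%N %| \sum_i (a i)%:Z * y i)%Z) Y].

Lemma dvdz_sum_mod (d : int) (I : finType) (x x' : I -> int) (w : I -> int) :
  (forall i, (d %| x i - x' i)%Z) ->
  (d %| \sum_i x i * w i)%Z = (d %| \sum_i x' i * w i)%Z.
Proof.
move=> H; have D : (\sum_i x i * w i - \sum_i x' i * w i) \in dvdz d.
  by rewrite -sumrB; apply: rpred_sum => i _; rewrite -mulrBl; exact: dvdz_mulr.
by rewrite -[in LHS](subrK (\sum_i x' i * w i) (\sum_i x i * w i)) rpredDl.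
Qed.

Lemma modz_ord_subproof (e : nat) (x : int) : (`|(x %% (3 ^ e)%N)%Z| < 3 ^ e)%N.
Proof.
have q0 : (0 < 3 ^ e)%N by rewrite expn_gt0.
have := ltz_pmod x (_ : 0 < (3 ^ e)%N%:Z); have := modz_ge0 x (_ : (3 ^ e)%N%:Z != 0); lia.
Qed.
Definition modz_ord e x := Ordinal (modz_ord_subproof e x).

Lemma modz_ordE e x : (modz_ord e x : nat)%:Z = (x %% (3 ^ e)%N)%Z.
Proof. by rewrite /= gez0_abs // modz_ge0 //; have := expn_gt0 3 e; lia. Qed.

Lemma modz_ord_dvd e x : ((3 ^ e)%N %| (modz_ord e x : nat)%:Z - x)%Z.
Proof. by rewrite modz_ordE -eqz_mod_dvd modz_mod. Qed.

Lemma modz_ord_inj e x x' : modz_ord e x = modz_ord e x' -> ((3 ^ e)%N %| x - x')%Z.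
Proof. by move/(congr1 (fun i : 'I_ _ => (i : nat)%:Z)); rewrite !modz_ordE => /eqP; rewrite eqz_mod_dvd. Qed.

Lemma eq_of_dvd_sub (x x' q : nat) (m : int) :
  (x < q)%N -> (x' < q)%N -> x%:Z - x'%:Z = m * q%:Z -> x = x'.
Proof. by case: m => [[|m]|m] l1 l2 h; nia. Qed.

(* Two solutions congruent modulo 3 differ by 3 times a solution modulo 3^e. *)
Lemma card_sols_succ e Y : (#|sols e.+1 Y| <= #|sols 1 Y| * #|sols e Y|)%N.
Proof.
pose r (a : {ffun 'I_s -> 'I_(3 ^ e.+1)}) : {ffun 'I_s -> 'I_(3 ^ 1)} := [ffun i => modz_ord 1 (a i)%:Z].
(* One solution is fixed in every residue class modulo 3; the default occurs only for classes
   without solutions. *)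
pose rep b : {ffun 'I_s -> 'I_(3 ^ e.+1)} := odflt [ffun=> modz_ord e.+1 0] [pick a in sols e.+1 Y | r a == b].
have repP a : a \in sols e.+1 Y -> rep (r a) \in sols e.+1 Y /\ r (rep (r a)) = r a.
  by move=> aY; rewrite /rep; case: pickP => [x /andP[? /eqP]|/(_ a)] //; rewrite aY eqxx.
have r3 (a : {ffun 'I_s -> 'I_(3 ^ e.+1)}) i : (3 %| (a i)%:Z - (rep (r a) i)%:Z)%Z || (a \notin sols e.+1 Y).
  case aY : (a \in _); rewrite ?orbT // orbF; have [_ /ffunP/(_ i)] := repP _ aY.
  by rewrite !ffunE => /esym/modz_ord_inj.
pose c (a : {ffun 'I_s -> 'I_(3 ^ e.+1)}) : {ffun 'I_s -> 'I_(3 ^ e)} :=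
  [ffun i => modz_ord e (((a i)%:Z - (rep (r a) i)%:Z) %/ 3)%Z].
rewrite -cardsX.
have inj : {in sols e.+1 Y &, injective (fun a => (r a, c a))}.
  move=> a a' aY aY' [ra ca]; apply/ffunP => i; apply/val_inj => /=.
  have := r3 a i; have := r3 a' i; rewrite aY aY' !orbF => d' d.
  have /ffunP/(_ i) := ca; rewrite !ffunE => /modz_ord_inj; rewrite -ra in d' *.
  case/dvdzP: d => k kE; case/dvdzP: d' => k' k'E; rewrite kE k'E !mulzK //.
  case/dvdzP => m mE; have : (a i : nat)%:Z - (a' i : nat)%:Z = m * (3 ^ e.+1)%N%:Z.
    have -> : (3 ^ e.+1)%N%:Z = 3 * (3 ^ e)%N%:Z by rewrite expnS PoszM.
    by rewrite mulrCA -mE mulrBr ![3 * _]mulrC -kE -k'E opprB addrA subrK.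
  exact: eq_of_dvd_sub (ltn_ord _) (ltn_ord _).
rewrite -(card_in_imset inj); apply/subset_leq_card/fintype.subsetP => _ /imsetP[a aY ->].
have rdvd i : (3 %| (a i)%:Z - (rep (r a) i)%:Z)%Z by have := r3 a i; rewrite aY orbF.
have aE i : (a i)%:Z - (rep (r a) i)%:Z = 3 * (((a i)%:Z - (rep (r a) i)%:Z) %/ 3)%Z.
  by rewrite mulrC divzK.
rewrite inE /= !inE; apply/andP; split; apply/allP => y yY.
  move: (aY); rewrite inE => /allP/(_ y yY) h; rewrite (@dvdz_sum_mod _ _ _ (fun i => (a i)%:Z)).
    by apply: dvdz_trans h; rewrite expnS PoszM dvdz_mulr.
  by move=> i; rewrite ffunE; exact: modz_ord_dvd.
have [+ _] := repP _ aY; rewrite inE => /allP/(_ y yY) h0.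
move: aY; rewrite inE => /allP/(_ y yY) h1.
rewrite (@dvdz_sum_mod _ _ _ (fun i => ((a i)%:Z - (rep (r a) i)%:Z) %/ 3)%Z); last first.
  by move=> i; rewrite ffunE; exact: modz_ord_dvd.
rewrite -(@dvdz_mul2l 3) // -PoszM -expnS mulr_sumr.
under eq_bigr do rewrite mulrA -aE mulrBl.
by rewrite sumrB rpredB.
Qed.

Lemma card_sols_pow e Y : (#|sols e Y| <= #|sols 1 Y| ^ e)%N.
Proof.
elim: e => [|e IH]; first by apply: (leq_trans (max_card _)); rewrite card_ffun !card_ord expn0 exp1n.
by apply: (leq_trans (card_sols_succ e Y)); rewrite (expnS #|sols 1 Y|) leq_mul2l IH orbT.
Qed.

Definition span3 (Y : seq {ffun 'I_s -> int}) : 'M['F_3]_s :=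
  foldr (fun (y : {ffun 'I_s -> int}) V => (V + (\row_i (y i)%:~R : 'rV_s))%MS) 0 Y.

Lemma card_submx3 (V : 'M['F_3]_s) : (#|[set b : 'rV['F_3]_s | (b <= V)%MS]| <= 3 ^ \rank V)%N.
Proof.
pose g (b : 'rV['F_3]_s) := b *m pinvmx (row_base V).
have inj : {in [set b | (b <= V)%MS] &, injective g}.
  have bV (b : 'rV_s) : (b <= V)%MS -> g b *m row_base V = b.
    by move=> h; rewrite /g mulmxKpV // eq_row_base.
  by move=> b b'; rewrite !inE => /bV {2}<- /bV {2}<- ->.
rewrite -(card_in_imset inj); apply: leq_trans (max_card _) _.
by rewrite card_mx card_Fp // mul1n.
Qed.

Lemma intr_F3_eq0 (m : int) : ((m%:~R : 'F_3) == 0) = (3 %| m)%Z.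
Proof. by rewrite (dvdz_pcharf (pchar_Fp (isT : prime 3))). Qed.

Lemma card_sols1 Y : (#|sols 1 Y| <= 3 ^ (s - \rank (span3 Y)))%N.
Proof.
pose K := kermx (span3 Y)^T.
have <- : \rank K = (s - \rank (span3 Y))%N by rewrite mxrank_ker mxrank_tr.
apply: leq_trans (card_submx3 K).
pose g (a : {ffun 'I_s -> 'I_(3 ^ 1)}) : 'rV['F_3]_s := \row_i (a i : nat)%:~R.
have inj : injective g.
  move=> a a' /rowP H; apply/ffunP => i; apply/val_inj => /=.
  have := H i; rewrite !mxE => /eqP; rewrite -subr_eq0 -intrB intr_F3_eq0 => /dvdzP[m].
  by apply: eq_of_dvd_sub; exact: ltn_ord.
rewrite -(card_imset _ inj); apply/subset_leq_card/fintype.subsetP => _ /imsetP[a aY ->].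
move: aY; rewrite !inE => aY; apply/sub_kermxP.
have H : ((span3 Y) *m (g a)^T = 0).
  elim: Y {K} aY => [|y Y IH] /=; first by rewrite mul0mx.
  case/andP => ya /IH {}IH; apply/eqP; rewrite -submx0.
  have := addsmxMr (span3 Y) (\row_i (y i)%:~R : 'rV['F_3]_s) (g a)^T.
  move=> ->; rewrite IH addsmx_sub sub0mx /= submx0; apply/eqP/matrixP => i j.
  rewrite !mxE; apply/eqP; rewrite -[eqbLHS](_ : (\sum_k (a k)%:Z * y k)%:~R = _) ?intr_F3_eq0 //.
  by rewrite raddf_sum /=; apply: eq_bigr => k _; rewrite !mxE intrM mulrC.
by apply: trmx_inj; rewrite trmx_mul trmxK trmx0.
Qed.

End Solutions.

(** * Moments of the number of annihilated vectors *)

Section Moments.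
Variables (F : realFieldType) (s e B : nat) (U : finType) (v : U -> int).
Hypothesis vB : forall c : 'F_3, (#|[set u | (v u)%:~R == c]| <= B)%N.
Hypothesis BU : (B <= #|U|)%N.
Hypothesis B0 : (0 < B)%N.

Definition solcount (a : {ffun 'I_s -> 'I_(3 ^ e)}) : nat :=
  #|[set y : {ffun 'I_s -> U} | ((3 ^ e)%N %| \sum_i (a i)%:Z * v (y i))%Z]|.

Let vy (y : {ffun 'I_s -> U}) : {ffun 'I_s -> int} := [ffun i => v (y i)].

Lemma sols_cons y Y a :
  (a \in sols e (vy y :: Y)) =
  (a \in sols e Y) && ((3 ^ e)%N %| \sum_i (a i)%:Z * v (y i))%Z.
Proof.
rewrite !inE /= andbC; congr (_ && (_ %| _)%Z).
by apply: eq_bigr => i _; rewrite ffunE.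
Qed.

(** Double counting: one factor [solcount a] is spent on choosing a vector [y] annihilated by [a],
    which then joins the constraints. *)
Lemma sum_solcount_succ k Y :
  (\sum_(a in sols e Y) solcount a ^ k.+1 =
   \sum_y \sum_(a in sols e (vy y :: Y)) solcount a ^ k)%N.
Proof.
under [RHS]eq_bigr do under eq_bigl do rewrite sols_cons.
rewrite (exchange_big_dep (mem (sols e Y))) /=; last by move=> y a _ /andP[].
apply: eq_bigr => a aY; rewrite expnS sum_nat_const; congr (_ * _)%N.
by rewrite /solcount; apply: eq_card => y; rewrite [LHS]inE unfold_in /= aY.
Qed.

Lemma rank_span3_cons y Y :
  \rank (span3 (vy y :: Y)) = (\rank (span3 Y) + ~~ (row3 v y <= span3 Y)%MS)%N.
Proof.
have E : (\row_i (vy y i)%:~R : 'rV['F_3]_s) = row3 v y.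
  by apply/rowP => i; rewrite !mxE ffunE.
rewrite /= E; have [yV|yV] := boolP (row3 v y <= span3 Y)%MS.
  by rewrite addn0 (addsmx_idPl yV).
apply/eqP; rewrite eqn_leq; apply/andP; split.
  by apply: leq_trans (mxrank_adds_leqif _ _) _; rewrite leq_add2l rank_leq_row.
rewrite addn1; apply: rank_ltmx; rewrite /ltmx addsmxSl /=.
by apply: contra yV => /(submx_trans (addsmxSr _ _)).
Qed.

(** The [k] vectors are chosen one after another. A vector outside the span modulo 3 raises the
    rank, which costs a factor [3 ^ e] in the bound on the number of [a]. A vector inside the span
    brings no such gain, but by Odlyzko's bound its probability is at most [(B / #|U|) ^ h], as the
    corank stays at least [h]. Each choice thus contributes at most [1 + x]. *)
Lemma sum_solcount_le (h k : nat) (x : F) Y :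
  (3 ^ e)%:R * (B%:R / #|U|%:R) ^+ h <= x ->
  (k + h <= s - \rank (span3 Y))%N ->
  (\sum_(a in sols e Y) solcount a ^ k)%:R <=
    (#|U| ^ s)%:R ^+ k * (3 ^ e)%:R ^+ (s - \rank (span3 Y) - k) * (1 + x) ^+ k :> F.
Proof.
move=> hx.
have U0 : (0 : F) < #|U|%:R by rewrite ltr0n (leq_trans B0).
have q0 : (0 : F) < (3 ^ e)%:R by rewrite ltr0n expn_gt0.
have b0 : 0 <= B%:R / #|U|%:R :> F by rewrite divr_ge0 // ltW.
have b1 : B%:R / #|U|%:R <= 1 :> F by rewrite ler_pdivrMr // mul1r ler_nat.
have x0 : 0 <= x by apply: le_trans hx; rewrite mulr_ge0 ?exprn_ge0 // ltW.
elim: k Y => [|k IH] Y kh.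
  rewrite expr0 mul1r mulr1 subn0 -natrX ler_nat.
  under eq_bigr do rewrite expn0.
  rewrite sum1_card (leq_trans (card_sols_pow e Y)) // -expnM mulnC expnM.
  by case: (posnP e) => [->|e0]; rewrite ?expn0 // leq_exp2r // card_sols1.
set d := (s - \rank (span3 Y))%N in kh *.
have ds : (d <= s)%N by rewrite leq_subr.
rewrite sum_solcount_succ natr_sum (bigID (fun y => row3 v y <= span3 Y)%MS) /=.
set C := (#|U| ^ s)%:R ^+ k * (3 ^ e)%:R ^+ (d - k.+1) * (1 + x) ^+ k.
have C0 : 0 <= C by rewrite !mulr_ge0 ?exprn_ge0 // ?ltW //; lra.
have in_le y : (row3 v y <= span3 Y)%MS ->
    (\sum_(a in sols e (vy y :: Y)) solcount a ^ k)%:R <= (3 ^ e)%:R * C.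
  move=> yV; have := IH (vy y :: Y); rewrite rank_span3_cons yV addn0 -/d.
  move=> /(_ _)/le_trans -> //; first lia.
  rewrite /C (_ : d - k = (d - k.+1).+1)%N ?exprS; last lia.
  by rewrite le_eqVlt; apply/orP; left; apply/eqP; ring.
have notin_le y : ~~ (row3 v y <= span3 Y)%MS ->
    (\sum_(a in sols e (vy y :: Y)) solcount a ^ k)%:R <= C.
  move=> yV; have := IH (vy y :: Y); rewrite rank_span3_cons yV subnDA -/d.
  move=> /(_ _)/le_trans -> //; first lia.
  by rewrite /C (_ : d - 1 - k = d - k.+1)%N //; lia.
have Us : (#|U| ^ s)%:R = #|{ffun 'I_s -> U}|%:R :> F by rewrite card_ffun card_ord.
apply: (@le_trans _ _ (\sum_(y | (row3 v y <= span3 Y)%MS) (3 ^ e)%:R * C +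
    \sum_(y | ~~ (row3 v y <= span3 Y)%MS) C)).
  by apply: lerD; apply: ler_sum.
apply: (@le_trans _ _ (x * (#|U| ^ s)%:R * C + (#|U| ^ s)%:R * C)); last first.
  by rewrite /C !exprS -subr_ge0 le_eqVlt; apply/orP; left; apply/eqP; ring.
apply: lerD; rewrite sumr_const -[_ *+ _]mulr_natl; last first.
  by rewrite ler_wpM2r // Us ler_nat max_card.
rewrite mulrA ler_wpM2r //.
have := card_row_in_submx vB (span3 Y); rewrite cardsE -(ler_nat F) natrM => hc.
apply: le_trans (ler_wpM2r (ltW q0) hc) _.
have -> : (#|U| ^ s)%:R = (#|U| ^ \rank (span3 Y))%:R * (#|U| ^ d)%:R :> F.
  by rewrite -natrM -expnD subnKC // rank_leq_col.
rewrite mulrCA -mulrA ler_wpM2l //.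
have : (3 ^ e)%:R * (B%:R / #|U|%:R) ^+ d <= x :> F.
  apply: le_trans hx; rewrite ler_pM2l // ler_wiXn2l // ; lia.
rewrite expr_div_n mulrA ler_pdivrMr ?exprn_gt0 // -!natrX mulrC //.
Qed.

End Moments.

Lemma leq_card_cover (T I : finType) (S : {set T}) (A : {set I}) (F : I -> {set T}) :
  (forall x, x \in S -> exists2 i, i \in A & x \in F i) ->
  (#|S| <= \sum_(i in A) #|F i|)%N.
Proof.
move=> H; apply: (@leq_trans #|\bigcup_(i in A) F i|).
  by apply/subset_leq_card/fintype.subsetP => x /H[i iA xi]; apply/bigcupP; exists i.
elim/big_rec2: _ => [|i n X _ IH]; first by rewrite cards0.
by apply: leq_trans (leq_card_setU _ _) _; rewrite leq_add2l.
Qed.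

Section SignMatrices.
Variable R : realType.

Definition supp3 (I : finType) (a : I -> int) : nat := #|[set i | ~~ (3 %| a i)%Z]|.

(** At each of the two nonzero frequencies modulo 3, every coefficient prime to 3 gives a factor of
    absolute value [1 / 2], whence [(1 + 2 / 8) / 3]. A support of two would give
    [(1 + 2 / 4) / 3 = 1 / 2], too large for a bound beating [2 ^ - n]. *)
Lemma count_sign3_le (I : finType) (a : I -> int) : (2 < supp3 a)%N ->
  (countv a signv 3)%:R / 2 ^+ #|I| <= 5 / 12 :> R.
Proof.
move=> a3; have e0 : (0 : R) < 2 ^+ #|I| by rewrite exprn_gt0.
have H : 3%:R * (countv a signv 3)%:R =
    2 ^+ #|I| * \sum_(xi < 3) \prod_i cos (ang R 3 (xi%:Z * a i)) :> R.
  rewrite -natrM (@count_dvd_cos R I bool 3 a signv negb) //; first last.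
  - by case; rewrite /signv ?expr0 ?expr1 ?opprK.
  - exact: negbK.
  have -> : 2 ^+ #|I| = \prod_(i : I) (2 : R) by rewrite prodr_const.
  rewrite mulr_sumr; apply: eq_bigr => xi _; rewrite -big_split /=.
  apply: eq_bigr => i _; rewrite big_bool /signv /= expr0 expr1 mulr1 mulrN1 cosN.
  by rewrite mulr_natl mulr2n.
have P (m : int) : ~~ (3 %| m)%Z ->
    `|\prod_i cos (ang R 3 (m * a i))| <= 8^-1.
  move=> m3; rewrite normr_prod (bigID (fun i => ~~ (3 %| a i)%Z)) /=.
  rewrite [X in _ * X]big1 ?mulr1; last first.
    move=> i; rewrite negbK => ai; have /= := sum_cos_ang R (m * a i) (isT : (0 < 3)%N).
    rewrite dvdz_mull // -cos_ang_mod // (_ : ((m * a i) %% 3%N)%Z = 0).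
      by rewrite /ang mul0r mulr0 cos0 normr1.
    by apply/dvdz_mod0P; exact: dvdz_mull.
  rewrite (eq_bigr (fun=> 2^-1)); last first.
    move=> i ai; rewrite cos_ang3 ?normrN ?ger0_norm ?invr_ge0 //.
    have co : coprimez 3 m.
      by rewrite /coprimez /gcdz /=; move: m3; rewrite dvdzE /= -prime_coprime.
    by rewrite Gauss_dvdzr.
  rewrite prodr_const (_ : 8^-1 = 2^-1 ^+ 3); last by field.
  apply: ler_wiXn2l; [by rewrite invr_ge0|by rewrite invf_le1 ?ler1n|].
  by move: a3; rewrite /supp3 cardsE.
move: H; rewrite !big_ord_recl big_ord0 /= /bump /=.
rewrite [X in X + _]big1; last by move=> i _; rewrite mul0r /ang mul0r mulr0 cos0.
have := P 1%N isT; have := P (1 + 1)%N isT.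
set u := \prod_i _; set w := \prod_i _ => hw hu.
have := ler_norm u; have := ler_norm w.
rewrite ler_pdivrMr // => h1 h2 H.
have : 3 * (countv a signv 3)%:R <= 2 ^+ #|I| * (5 / 4) :> R.
  by rewrite H ler_pM2l //; lra.
lra.
Qed.

End SignMatrices.

(** * Degenerate sign matrices *)

Section Levels.
Variable R : realType.

Definition intf (s q : nat) (a : {ffun 'I_s -> 'I_q}) (i : 'I_s) : int := (a i)%:Z.

(** Exponential weights: a coordinate prime to 3 gets the weight [w = y ^ - 64], so every counted
    vector has weight at least 1 after multiplication by [y ^ s], and the total is
    [(y * (1 + 2 w)) ^ s]. The constants are chosen so that [23 / 20 * (5 / 12) = 23 / 48] is below
    [1 / 2]. *)
Lemma card_small_supp3 (s : nat) :
  #|[set b : {ffun 'I_s -> 'I_3} | (64 * supp3 (intf b) <= s)%N]|%:R <= (23 / 20) ^+ s :> R.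
Proof.
pose y : R := 9 / 8; have y1 : 1 <= y by rewrite /y; lra.
have y64 : y ^+ 64 >= 100.
  have y8 : 2 <= y ^+ 8 by rewrite /y !exprS expr0; lra.
  rewrite (_ : 64 = 8 * 8)%N // exprM; apply: (@le_trans _ _ (2 ^+ 8)); first by rewrite !exprS; lra.
  by rewrite lerXn2r ?nnegrE //; lra.
have [w [w0 w1 wE]] : exists w : R, [/\ 0 < w, w <= 100^-1 & y ^+ 64 * w = 1].
  move: (y ^+ 64) y64 => p p100; have p0 : 0 < p by lra.
  exists p^-1; split; [by rewrite invr_gt0 | | by rewrite mulfV ?gt_eqF].
  by rewrite lef_pV2 ?posrE.
clear y64.
pose f (t : 'I_3) : R := if ~~ (3 %| t)%N then w else 1.
apply: (@le_trans _ _ (\sum_(b : {ffun 'I_s -> 'I_3}) y ^+ s * \prod_i f (b i))).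
  rewrite -sum1_card natr_sum big_mkcond /=; apply: ler_sum => b _; rewrite inE.
  have -> : \prod_i f (b i) = w ^+ supp3 (intf b).
    by rewrite -big_mkcond /= prodr_const /supp3 cardsE.
  case: ifP => [h|_]; last first.
    by apply: mulr_ge0; rewrite exprn_ge0 ?(ltW w0) ?(le_trans ler01 y1).
  have -> : y ^+ s = y ^+ (s - 64 * supp3 (intf b)) * y ^+ (64 * supp3 (intf b)).
    by rewrite -exprD subnK.
  rewrite -mulrA [X in _ * X](_ : _ = 1) ?mulr1 ?exprn_ege1 //.
  by rewrite exprM -exprMn wE expr1n.
rewrite -mulr_sumr -(bigA_distr_bigA (fun=> f)) /= prodr_const card_ord -exprMn.
rewrite !big_ord_recl big_ord0 /f /=.
have : y * (1 + (w + (w + 0))) <= 23 / 20 by rewrite /y; clear wE; lra.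
by move=> h; rewrite lerXn2r ?nnegrE ?mulr_ge0 //; rewrite /y; clear wE h; lra.
Qed.

Definition freq (s e : nat) (a : {ffun 'I_s -> 'I_(3 ^ e)}) : R :=
  (countv (intf a) signv (3 ^ e))%:R / 2 ^+ s.

Lemma freq_ge0 s e a : 0 <= @freq s e a.
Proof. by rewrite divr_ge0 // exprn_ge0. Qed.

Lemma card_lazyv_residue (D : nat) (c : 'F_3) : (0 < D)%N ->
  (#|[set u : bool * 'I_D.+1 | (lazyv u)%:~R == c]| <= 2 * D)%N.
Proof.
move=> D0.
pose Z := [set u : bool * 'I_D.+1 | u.2 != ord0].
have cZ : #|Z| = (2 * D)%N.
  have -> : Z = finset.setX finset.setT [set~ ord0] by apply/finset.setP => -[b j]; rewrite !inE.
  by rewrite cardsX cardsT card_bool cardsC1 card_ord.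
have [->|c0] := eqVneq c 0.
  rewrite -cZ; apply/subset_leq_card/fintype.subsetP => -[b j]; rewrite !inE /lazyv /=.
  by case: (j =P ord0) => // _; rewrite intr_F3_eq0; case: b.
apply: (@leq_trans 2); last lia.
apply: (@leq_trans #|[set ((b, ord0) : bool * 'I_D.+1) | b in [set: bool]]|).
  apply/subset_leq_card/fintype.subsetP => -[b j]; rewrite !inE /lazyv /=.
  case: (j =P ord0) => [-> _|_]; first by apply/imsetP; exists b.
  by rewrite eq_sym (negPf c0).
by apply: leq_trans (leq_imset_card _ _) _; rewrite cardsT card_bool.
Qed.

(** An equidistributed walk has [3 ^ e * freq = 1]. The lower bound 4 and the large support are what
    [count_sign_lazy] requires; the upper bound 12 keeps [freq] of the order of [1 / 3 ^ e]. *)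
Definition structured (s e : nat) : {set {ffun 'I_s -> 'I_(3 ^ e)}} :=
  [set a | [&& 4 <= (3 ^ e)%:R * freq a, (3 ^ e)%:R * freq a < 12 & (s < 64 * supp3 (intf a))%N]].

Lemma sum_structured (s k h e T D l n : nat) :
  4 * 2^-1 ^+ l <= 32^-1 :> R -> D.+1 = (8 * 64 ^ l)%N -> (0 < D)%N ->
  (16 * 64 ^ l * (32 * T) <= s)%N -> (0 < s)%N ->
  (3 ^ e)%:R <= expR (T%:R / 2) :> R ->
  (3 ^ e)%:R * (D%:R / D.+1%:R) ^+ h <= 1 :> R ->
  (k + h <= s)%N -> (s <= n)%N ->
  \sum_(a in structured s e) freq a ^+ n <= 12 ^+ (n - k) / 16 ^+ k.
Proof.
move=> l32 DE D0 Ts s0 eT eh kh sn.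
have q0 : (0 : R) < (3 ^ e)%:R by rewrite ltr0n expn_gt0.
have q1 : (1 : R) <= (3 ^ e)%:R by rewrite ler1n expn_gt0.
set q : R := (3 ^ e)%:R in eT eh q0 q1 *.
pose U := (bool * 'I_D.+1)%type.
have cU : #|{: U}| = (2 * D.+1)%N by rewrite card_prod card_bool card_ord.
pose pY (a : {ffun 'I_s -> 'I_(3 ^ e)}) : R := (countv (intf a) (@lazyv D) (3 ^ e))%:R / (2 * D.+1)%:R ^+ s.
have pY0 a : 0 <= pY a by rewrite divr_ge0 // exprn_ge0.
have Qe : (3 ^ e).-1.+1 = (3 ^ e)%N by rewrite prednK // expn_gt0.
have cmp a : a \in structured s e -> freq a <= 32^-1 * pY a.
  rewrite inE => /and3P[a4 _ sa].
  have := @count_sign_lazy R 'I_s e _ (intf a) Qe l T D DE.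
  rewrite Qe card_ord -/q => /(_ _ eT a4) H.
  apply: le_trans (H _) _; last by rewrite -/(pY a) ler_wpM2r.
  have : (16 * 64 ^ l * (32 * T) < 64 * supp3 (intf a))%N by apply: leq_ltn_trans sa.
  rewrite -(ltr_nat R) !natrM natrX /supp3; have : 0 <= 64 ^+ l * T%:R :> R by rewrite mulr_ge0 // exprn_ge0.
  by set z := 64%:R ^+ l; lra.
have kn : (k <= n)%N by lia.
apply: (@le_trans _ _ (\sum_(a : {ffun 'I_s -> 'I_(3 ^ e)}) (12 / q) ^+ (n - k) * (32^-1 ^+ k * pY a ^+ k))).
  rewrite big_mkcond /=; apply: ler_sum => a _; case: ifP => [aS|_]; last first.
    by rewrite !mulr_ge0 // ?exprn_ge0 // ?divr_ge0 // ltW.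
  rewrite -{1}(subnK kn) exprD -exprMn; apply: ler_pM; rewrite ?exprn_ge0 ?freq_ge0 //.
    rewrite lerXn2r ?nnegrE ?freq_ge0 ?divr_ge0 // ?(ltW q0) //.
    by move: aS; rewrite inE => /and3P[_ /ltW + _]; rewrite ler_pdivlMr // mulrC.
  by rewrite lerXn2r ?nnegrE ?freq_ge0 ?mulr_ge0 ?cmp.
rewrite -mulr_sumr -mulr_sumr.
have sumY : \sum_a pY a ^+ k <= q ^+ (s - k) * 2 ^+ k.
  have := @sum_solcount_le R s e (2 * D) U (@lazyv D) (fun c => card_lazyv_residue c D0) _ _ h k 1 [::].
  rewrite cU -/q => /(_ _ _ _ _).
  have -> : (2 * D)%:R / (2 * D.+1)%:R = D%:R / D.+1%:R :> R.
    by rewrite !natrM -mulf_div divff // mul1r.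
  rewrite mxrank0 subn0 => /(_ _ _ eh kh) H.
  have {H} := H _ _; rewrite !muln_gt0 D0 leq_mul2l leqnSn => /(_ isT isT).
  have -> : sols e [::] = [set: {ffun 'I_s -> 'I_(3 ^ e)}] by apply/setP => a; rewrite !inE.
  rewrite natr_sum => H.
  have -> : \sum_a pY a ^+ k = (\sum_(a in [set: {ffun 'I_s -> 'I_(3 ^ e)}])
      (solcount (@lazyv D) a ^ k)%:R) / ((2 * D.+1) ^ s)%:R ^+ k.
    rewrite mulr_suml; apply: eq_big => [a|a _]; first by rewrite inE.
    by rewrite /pY expr_div_n natrX natrX.
  rewrite ler_pdivrMr ?exprn_gt0 ?ltr0n ?expn_gt0 //.
  by apply: le_trans H _; rewrite le_eqVlt; apply/orP; left; apply/eqP; rewrite [1 + 1](_ : _ = 2) //; ring.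
apply: (@le_trans _ _ ((12 / q) ^+ (n - k) * (32^-1 ^+ k * (q ^+ (s - k) * 2 ^+ k)))).
  rewrite ler_wpM2l ?exprn_ge0 ?divr_ge0 ?(ltW q0) // ler_wpM2l ?exprn_ge0 //.
have -> : (12 / q) ^+ (n - k) * (32^-1 ^+ k * (q ^+ (s - k) * 2 ^+ k)) =
    (12 ^+ (n - k) / 16 ^+ k) * (q ^+ (s - k) / q ^+ (n - k)).
  have -> : 32^-1 ^+ k = 16^-1 ^+ k * 2^-1 ^+ k :> R by rewrite -exprMn; congr (_ ^+ _); field.
  rewrite expr_div_n !exprVn; field.
  by rewrite !expf_neq0 // gt_eqF.
rewrite ler_piMr ?divr_ge0 ?exprn_ge0 //.
rewrite ler_pdivrMr ?exprn_gt0 // mul1r ler_weXn2l //; lia.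
Qed.

(** There are [q ^ s] vectors with [q = 3 ^ e], each contributing at most [(4 / q) ^ n]. *)
Lemma sum_unstructured (s e n : nat) : (s <= n)%N ->
  \sum_(a : {ffun 'I_s -> 'I_(3 ^ e)} | (3 ^ e)%:R * freq a < 4) freq a ^+ n <=
     4 ^+ n / (3 ^ e)%:R ^+ (n - s) :> R.
Proof.
move=> sn; have q0 : (0 : R) < (3 ^ e)%:R by rewrite ltr0n expn_gt0.
apply: (@le_trans _ _ (\sum_(a : {ffun 'I_s -> 'I_(3 ^ e)}) (4 / (3 ^ e)%:R) ^+ n)).
  rewrite big_mkcond /=; apply: ler_sum => a _; case: ifP => [h|_]; last first.
    by rewrite exprn_ge0 // divr_ge0 // ltW.
  rewrite lerXn2r ?nnegrE ?freq_ge0 ?divr_ge0 ?(ltW q0) //.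
  by rewrite ler_pdivlMr // mulrC ltW.
rewrite sumr_const card_ffun !card_ord -[_ *+ _]mulr_natl natrX expr_div_n.
have -> : (3 ^ e)%:R ^+ n = (3 ^ e)%:R ^+ (n - s) * (3 ^ e)%:R ^+ s :> R.
  by rewrite -exprD subnK.
move: q0; set Q : R := (3 ^ e)%:R => q0; rewrite le_eqVlt; apply/orP; left; apply/eqP.
by field; rewrite !expf_neq0 // gt_eqF.
Qed.

End Levels.

Section Bad.
Variable R : realType.

Definition degenerate (s n : nat) : {set {ffun 'I_n -> {ffun 'I_s -> bool}}} :=
  [set M : {ffun 'I_n -> {ffun 'I_s -> bool}} | `[< exists a : 'I_s -> int, (2 < supp3 a)%N /\
                 forall c, \sum_i a i * signv (M c i) = 0 >]].

Definition orth (s n e : nat) (a : {ffun 'I_s -> 'I_(3 ^ e)}) :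
    {set {ffun 'I_n -> {ffun 'I_s -> bool}}} :=
  [set M : {ffun 'I_n -> {ffun 'I_s -> bool}} | [forall c, ((3 ^ e)%N %| \sum_i intf a i * signv (M c i))%Z]].

Lemma card_orth s n e a : #|@orth s n e a|%:R = freq R a ^+ n * (2 ^+ s) ^+ n.
Proof.
have -> : #|orth n a| = (countv (intf a) signv (3 ^ e) ^ n)%N.
  rewrite -[in RHS](card_ord n) -card_ffun_on; apply: eq_card => M.
  rewrite inE; apply/forallP/ffun_onP => H c; have := H c; rewrite ?inE //.
rewrite /freq expr_div_n divfK ?natrX // !expf_neq0 //.
Qed.

Lemma card_orth_cover s n e (A : {set {ffun 'I_s -> 'I_(3 ^ e)}})
    (S : {set {ffun 'I_n -> {ffun 'I_s -> bool}}}) :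
  (forall M, M \in S -> exists2 a, a \in A & M \in orth n a) ->
  #|S|%:R <= (\sum_(a in A) freq R a ^+ n) * (2 ^+ s) ^+ n.
Proof.
move=> /leq_card_cover; rewrite -(ler_nat R) natr_sum => h; apply: le_trans h _.
by rewrite mulr_suml; apply: ler_sum => a _; rewrite card_orth.
Qed.

Definition redu (s e : nat) (a : 'I_s -> int) : {ffun 'I_s -> 'I_(3 ^ e)} :=
  [ffun i => modz_ord e (a i)].

Lemma redu_dvd s e (a : 'I_s -> int) i : ((3 ^ e)%N %| intf (redu e a) i - a i)%Z.
Proof. by rewrite /intf ffunE; exact: modz_ord_dvd. Qed.

Lemma dvd_redu s e (a w : 'I_s -> int) :
  ((3 ^ e)%N %| \sum_i intf (redu e a) i * w i)%Z = ((3 ^ e)%N %| \sum_i a i * w i)%Z.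
Proof. by apply: dvdz_sum_mod; exact: redu_dvd. Qed.

Lemma supp3_redu s e (a : 'I_s -> int) : supp3 (intf (redu e.+1 a)) = supp3 a.
Proof.
apply: eq_card => i; rewrite !inE; congr (~~ _).
have d3 : (3 %| intf (redu e.+1 a) i - a i)%Z.
  by apply: dvdz_trans (redu_dvd e.+1 a i); rewrite expnS PoszM dvdz_mulr.
by rewrite -[in LHS](subrK (a i) (intf (redu e.+1 a) i)) rpredDl.
Qed.

Lemma freq_redu0 s (a : 'I_s -> int) : freq R (redu 0 a) = 1.
Proof.
have E : countv (intf (redu 0 a)) signv (3 ^ 0) = (2 ^ s)%N.
  rewrite -[in RHS](card_ord s) -[in RHS]card_bool -card_ffun; apply: eq_card => y.
  by rewrite !inE; exact: dvd1n.
by rewrite /freq E natrX divff // expf_neq0.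
Qed.

Lemma freq_redu_succ s e (a : 'I_s -> int) : freq R (redu e.+1 a) <= freq R (redu e a).
Proof.
rewrite ler_wpM2r ?invr_ge0 ?exprn_ge0 // ler_nat; apply/subset_leq_card/fintype.subsetP => y.
rewrite !inE !dvd_redu; apply: dvdz_trans.
by rewrite expnS PoszM dvdz_mull.
Qed.

Lemma mem_orth_redu s n e (a : 'I_s -> int) (M : {ffun 'I_n -> {ffun 'I_s -> bool}}) :
  (forall c, \sum_i a i * signv (M c i) = 0) -> M \in orth n (redu e a).
Proof. by move=> H; rewrite inE; apply/forallP => c; rewrite dvd_redu H dvdz0. Qed.

(* The frequency does not increase along the tower 3^e, so at the first e where
   3^e * freq reaches 4 it is still below 12. *)
Lemma degenerate_cases s n L M : (0 < L)%N -> M \in degenerate s n ->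
  [\/ exists2 a, a \in [set b : {ffun 'I_s -> 'I_(3 ^ 1)} |
          (64 * supp3 (intf b) <= s)%N && (2 < supp3 (intf b))%N] & M \in orth n a,
      exists2 e : 'I_L, true & exists2 a, a \in structured R s e.+1 & M \in orth n a |
      exists2 a, a \in [set a : {ffun 'I_s -> 'I_(3 ^ L)} | (3 ^ L)%:R * freq R a < 4]
        & M \in orth n a].
Proof.
move=> L0; rewrite inE => /asboolP[a [a3 aM]].
have [sa|sa] := leqP (64 * supp3 a) s.
  by constructor 1; exists (redu 1 a); rewrite ?mem_orth_redu // inE supp3_redu sa.
pose f e := (3 ^ e)%:R * freq R (redu e a).
have [/existsP[e0 fe0]|] := boolP [exists e : 'I_L, 4 <= f e.+1]; last first.
  rewrite negb_exists => /forallP H; constructor 3; exists (redu L a); rewrite ?mem_orth_redu //.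
  rewrite inE ltNge; have := H (Ordinal (_ : L.-1 < L)%N); rewrite /= /f.
  by case: L L0 {H} => // L _; exact.
constructor 2; pose P m := 4 <= f m.
have exP : exists m, P m by exists e0.+1.
case: (ex_minnP exP) => m Pm mmin.
have m0 : (0 < m)%N.
  rewrite lt0n; apply/eqP => m0; move: Pm; rewrite m0 /P /f freq_redu0 expn0; lra.
case: m m0 Pm mmin => // m _ Pm mmin.
have mL : (m < L)%N by have := mmin _ fe0; have := ltn_ord e0; lia.
exists (Ordinal mL) => //=; exists (redu m.+1 a); rewrite ?mem_orth_redu // inE.
rewrite supp3_redu sa andbT; apply/andP; split; first exact: Pm.
have : f m < 4 by rewrite ltNge; apply/negP => /mmin; rewrite ltnn.
have := freq_redu_succ m a; rewrite /f => h1 h2.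
have -> : (3 ^ m.+1)%:R = 3 * (3 ^ m)%:R :> R by rewrite -natrM -expnS.
have : (3 ^ m)%:R * freq R (redu m.+1 a) <= (3 ^ m)%:R * freq R (redu m a).
  by rewrite ler_wpM2l.
lra.
Qed.

(** A union bound over [degenerate_cases]: the summands stand for small support modulo 3, for
    concentration at one of the [L] levels of the tower, and for no concentration up to level
    [L]. *)
Lemma card_degenerate_le (s n L T h k D l : nat) : (0 < L)%N -> (0 < s)%N ->
  4 * 2^-1 ^+ l <= 32^-1 :> R -> D.+1 = (8 * 64 ^ l)%N -> (0 < D)%N ->
  (16 * 64 ^ l * (32 * T) <= s)%N ->
  (3 ^ L)%:R <= expR (T%:R / 2) :> R ->
  (3 ^ L)%:R * (D%:R / D.+1%:R) ^+ h <= 1 :> R ->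
  (k + h <= s)%N -> (s <= n)%N ->
  #|degenerate s n|%:R <= ((23 / 20) ^+ s * (5 / 12) ^+ n + L%:R * (12 ^+ (n - k) / 16 ^+ k) +
    4 ^+ n / (3 ^ L)%:R ^+ (n - s)) * (2 ^+ s) ^+ n :> R.
Proof.
move=> L0 s0 l32 DE D0 Ts LT Lh kh sn.
pose A1 := [set b : {ffun 'I_s -> 'I_(3 ^ 1)} |
          (64 * supp3 (intf b) <= s)%N && (2 < supp3 (intf b))%N].
pose A3 := [set a : {ffun 'I_s -> 'I_(3 ^ L)} | (3 ^ L)%:R * freq R a < 4].
pose S1 := [set M in degenerate s n | [exists a in A1, M \in orth n a]].
pose S2 (e : 'I_L) := [set M in degenerate s n | [exists a in structured R s e.+1, M \in orth n a]].
pose S3 := [set M in degenerate s n | [exists a in A3, M \in orth n a]].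
have sub : degenerate s n \subset S1 :|: \bigcup_e S2 e :|: S3.
  apply/fintype.subsetP => M Md; rewrite !finset.in_setU -orbA; apply/or3P.
  case: (degenerate_cases L0 Md) => [[a aA Ma]|[e _ [a aA Ma]]|[a aA Ma]].
  - by constructor 1; rewrite inE Md; apply/existsP; exists a; rewrite aA.
  - constructor 2; apply/finset.bigcupP; exists e => //; rewrite inE Md.
    by apply/existsP; exists a; rewrite aA.
  - by constructor 3; rewrite inE Md; apply/existsP; exists a; rewrite aA.
have pX : (0 : R) < (2 ^+ s) ^+ n by rewrite !exprn_gt0.
have b1 : #|S1|%:R <= ((23 / 20) ^+ s * (5 / 12) ^+ n) * (2 ^+ s) ^+ n :> R.
  apply: (@le_trans _ _ ((\sum_(a in A1) freq R a ^+ n) * (2 ^+ s) ^+ n)).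
    apply: card_orth_cover => M; rewrite inE => /andP[_ /existsP[a /andP[aA Ma]]]; by exists a.
  rewrite ler_pM2r //; apply: (@le_trans _ _ (\sum_(a in A1) (5 / 12) ^+ n)).
    apply: ler_sum => a; rewrite inE => /andP[_ a3].
    rewrite lerXn2r ?nnegrE ?freq_ge0 ?divr_ge0 //.
    by have := count_sign3_le R a3; rewrite card_ord.
  rewrite sumr_const -[_ *+ _]mulr_natl ler_wpM2r ?exprn_ge0 ?divr_ge0 //.
  apply: le_trans (card_small_supp3 R s); rewrite ler_nat.
  by apply/subset_leq_card/fintype.subsetP => b; rewrite !inE => /andP[].
have b2 e : #|S2 e|%:R <= (12 ^+ (n - k) / 16 ^+ k) * (2 ^+ s) ^+ n :> R.
  apply: (@le_trans _ _ ((\sum_(a in structured R s e.+1) freq R a ^+ n) * (2 ^+ s) ^+ n)).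
    apply: card_orth_cover => M; rewrite inE => /andP[_ /existsP[a /andP[aA Ma]]]; by exists a.
  have eL : (3 ^ e.+1)%:R <= (3 ^ L)%:R :> R by rewrite ler_nat leq_exp2l.
  rewrite ler_pM2r //; apply: (sum_structured l32 DE D0 Ts s0 _ _ kh sn).
    exact: le_trans eL LT.
  by apply: le_trans Lh; rewrite ler_wpM2r // exprn_ge0 // divr_ge0.
have b3 : #|S3|%:R <= (4 ^+ n / (3 ^ L)%:R ^+ (n - s)) * (2 ^+ s) ^+ n :> R.
  apply: (@le_trans _ _ ((\sum_(a in A3) freq R a ^+ n) * (2 ^+ s) ^+ n)).
    apply: card_orth_cover => M; rewrite inE => /andP[_ /existsP[a /andP[aA Ma]]]; by exists a.
  rewrite ler_pM2r //; apply: le_trans (sum_unstructured R L sn).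
  by under eq_bigl do rewrite inE.
have c2 : #|\bigcup_e S2 e|%:R <= L%:R * (12 ^+ (n - k) / 16 ^+ k) * (2 ^+ s) ^+ n :> R.
  apply: (@le_trans _ _ (\sum_(e < L) #|S2 e|%:R)).
    rewrite -natr_sum ler_nat; elim/big_rec2: _ => [|i m X _ IH]; first by rewrite cards0.
    by apply: leq_trans (leq_card_setU _ _) _; rewrite leq_add2l.
  apply: (@le_trans _ _ (\sum_(e < L) (12 ^+ (n - k) / 16 ^+ k) * (2 ^+ s) ^+ n)).
    by apply: ler_sum.
  by rewrite sumr_const card_ord -[_ *+ _]mulr_natl mulrA.
have := lerD (lerD b1 c2) b3; rewrite -[in leRHS]mulrDl -[in leRHS]mulrDl; apply: le_trans.
rewrite -!natrD ler_nat; apply: leq_trans (subset_leq_card sub) _.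
apply: leq_trans (leq_card_setU _ _) _; rewrite leq_add2r; exact: leq_card_setU.
Qed.

End Bad.

(** * Choice of the parameters *)

Lemma bernoulli_ge (R : realDomainType) (x : R) n : 0 <= x -> 1 + n%:R * x <= (1 + x) ^+ n.
Proof.
move=> x0; elim: n => [|n IH]; first by rewrite mul0r addr0 expr0.
rewrite exprS; apply: (@le_trans _ _ ((1 + x) * (1 + n%:R * x))).
  by have : 0 <= n%:R * x * x; [rewrite !mulr_ge0|rewrite -natr1; lra].
by rewrite ler_wpM2l //; lra.
Qed.

Lemma pow_small (R : realType) (x e : R) : 0 < x < 1 -> 0 < e ->
  exists N, forall n, (N <= n)%N -> x ^+ n <= e.
Proof.
move=> /andP[x0 x1] e0; pose y := x^-1 - 1.
have y0 : 0 < y by rewrite subr_gt0 invf_gt1.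
exists (Num.trunc (e^-1 / y)).+1 => n Nn.
have h : e^-1 <= (x^-1) ^+ n.
  apply: le_trans (_ : 1 + n%:R * y <= _); last first.
    by apply: le_trans (bernoulli_ge _ (ltW y0)) _; rewrite /y addrC subrK.
  apply: ler_wpDl => //; rewrite -ler_pdivrMr //.
  apply: le_trans (ltW (truncnS_gt _)) _; by rewrite ler_nat.
by rewrite -[leLHS]invrK -exprVn invf_ple ?posrE ?exprn_gt0 ?invr_gt0.
Qed.

(** All of [l], [D], [W] and [j] are absolute constants, while [L], [T] and [h] are proportional to
    [n]. The modulus [3 ^ L] has to be large enough to defeat [4 ^ n] with only [j] spare rows, yet
    small enough for the comparison with the lazy walk and for Odlyzko's bound. *)
Lemma card_degenerate (R : realType) :
  exists2 j : nat, (0 < j)%N & exists N : nat, forall s, (N <= s)%N ->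
    (8 * 2 ^ (s + j) * #|degenerate s (s + j)| <= (2 ^ s) ^ (s + j))%N.
Proof.
have [l hl] : exists l : nat, 4 * 2^-1 ^+ l <= 32^-1 :> R.
  by exists 7; rewrite !exprS expr0; lra.
have [D D0 DE] : exists2 D, (0 < D)%N & D.+1 = (8 * 64 ^ l)%N.
  have e0 : (0 < 64 ^ l)%N by rewrite expn_gt0.
  by exists (8 * 64 ^ l).-1; lia.
(* [W] is large against [D.+1], so that [L = n %/ W] yields [h <= n / 256] and [4 * L <= T]. With
   [j = 4 * W], [L * j] is close to [4 * n], above the [3 * n + 5] needed in [i3]. *)
have [W WE] : exists W, W = (512 * D.+1)%N by eexists.
pose j := (4 * W)%N.
have [N1 hN1] : exists N, forall n, (N <= n)%N -> (23 / 24 : R) ^+ n <= 32^-1.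
  by apply: pow_small; [apply/andP; split; lra|rewrite invr_gt0].
have W0 : (0 < W)%N by rewrite WE muln_gt0.
exists j; first by rewrite /j; lia.
exists (N1 + 16 * j + 5)%N => s Ns.
have [n nE] : exists n, n = (s + j)%N by eexists.
(* [T] is the largest integer with [64 * D.+1 * T <= s], the condition of [sum_structured]. *)
rewrite -nE; pose L := (n %/ W)%N; pose T := (s %/ (64 * D.+1))%N.
(* Since [(D / D.+1) ^ D.+1 <= 1 / 2], every [2 * D.+1] factors outweigh one factor 3 of [3 ^ L]. *)
pose h := (2 * (D.+1 * L))%N; pose k := (s - h)%N.
have s0 : (0 < s)%N by lia.
have LW : (L * W <= n)%N by exact: leq_trunc_div.
have LW' : (n < L.+1 * W)%N by exact: ltn_ceil.
have L0 : (0 < L)%N by rewrite divn_gt0 //; lia.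
have LE : (L * W = 512 * (D.+1 * L))%N by rewrite WE; lia.
have n5 : (5 <= n)%N by lia.
have ns : (n - s)%N = j by rewrite nE addKn.
have Lj : (3 * n + 5 <= L * j)%N by rewrite /j mulnCA; lia.
have Ts : (16 * 64 ^ l * (32 * T) <= s)%N.
  have := leq_trunc_div s (64 * D.+1); rewrite -/T DE; lia.
have LT : (4 * L <= T)%N by rewrite leq_divRL //; lia.
have kh : (k + h <= s)%N by rewrite /k /h; lia.
have D1 : (0 : R) < D.+1%:R by rewrite ltr0n.
have LT3 : (3 ^ L)%:R <= expR (T%:R / 2) :> R.
  apply: (@le_trans _ _ (expR (2 *+ L))); last first.
    rewrite ler_expR -mulr_natr; have : 4 * L%:R <= T%:R :> R by rewrite -natrM ler_nat.
    lra.
  rewrite -[2 *+ L]mulr_natl expRM_natl natrX lerXn2r ?nnegrE ?expR_ge0 //.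
  by apply: le_trans (expR_ge1Dx 2); lra.
have Lh : (3 ^ L)%:R * (D%:R / D.+1%:R) ^+ h <= 1 :> R.
  have bD : (D%:R / D.+1%:R) ^+ D.+1 <= 2^-1 :> R.
    have Dp : (0 : R) < D%:R by rewrite ltr0n.
    have := @bernoulli_ge R (D%:R^-1) D.+1; rewrite invr_ge0 ler0n => /(_ isT).
    have -> : 1 + D%:R^-1 = (D%:R / D.+1%:R)^-1 :> R.
      by rewrite invf_div -natr1 mulrDl mulfV ?mul1r // gt_eqF.
    rewrite exprVn => b1.
    have b2 : 2 <= 1 + D.+1%:R * D%:R^-1 :> R.
      have : 1 <= D.+1%:R * D%:R^-1 :> R by rewrite ler_pdivlMr // mul1r ler_nat.
      by lra.
    rewrite -[leLHS]invrK lef_pV2 ?posrE ?(le_trans b2 b1) // invr_gt0 exprn_gt0 //.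
    by rewrite divr_gt0.
  have -> : (3 ^ L)%:R * (D%:R / D.+1%:R) ^+ h = (3 * ((D%:R / D.+1%:R) ^+ D.+1) ^+ 2) ^+ L :> R.
    have hE : h = (D.+1 * 2 * L)%N by rewrite /h; lia.
    by rewrite hE !exprM natrX -exprMn.
  have b0 : 0 <= (D%:R / D.+1%:R) ^+ D.+1 :> R by rewrite exprn_ge0 // divr_ge0.
  apply: exprn_ile1; first by rewrite mulr_ge0 // exprn_ge0.
  by move: bD b0; set b := _ ^+ D.+1 => bD b0; rewrite expr2; nra.
have sn : (s <= n)%N by rewrite nE; lia.
have := @card_degenerate_le R s n L T h k D l L0 s0 hl DE D0 Ts LT3 Lh kh sn.
set X := (2 ^+ s) ^+ n; set d := #|_|; set c := (_ + _ + _) => H.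
have X0 : 0 < X by rewrite !exprn_gt0.
suff hc : c <= (8 * 2 ^+ n)^-1.
  rewrite -(ler_nat R) !natrM !natrX -ler_pdivlMl ?mulr_gt0 ?exprn_gt0 //.
  by apply: le_trans H _; rewrite mulrC [leRHS]mulrC ler_wpM2l // ltW.
have two n' : (0 : R) < 2 ^+ n' by rewrite exprn_gt0.
have i1 : (23 / 20) ^+ s * (5 / 12) ^+ n <= 32^-1 * 2^-1 ^+ n :> R.
  apply: (@le_trans _ _ ((23 / 20) ^+ n * (5 / 12) ^+ n)).
    rewrite ler_wpM2r ?exprn_ge0 ?divr_ge0 // ler_weXn2l //; lra.
  rewrite -exprMn (_ : 23 / 20 * (5 / 12) = (23 / 24) * 2^-1); last by field.
  by rewrite exprMn ler_wpM2r ?exprn_ge0 ?hN1 // nE; lia.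
(* With [g = n - k <= n / 8] the quotient is at most [2 ^ (8 * g - 4 * n)], hence at most
   [2 ^ (- 2 * n)] after the factor [L <= 2 ^ n]. *)
have i2 : L%:R * (12 ^+ (n - k) / 16 ^+ k) <= 32^-1 * 2^-1 ^+ n :> R.
  pose g := (n - k)%N; have kn : (k <= n)%N by rewrite (leq_trans (leq_subr _ _)).
  have kE : k = (n - g)%N by rewrite subKn.
  have gn : (8 * g <= n)%N.
    have : (256 * h <= n)%N by apply: leq_trans LW; rewrite LE /h; clear; lia.
    by move: Ns kh; rewrite /g /k nE; clear; lia.
  apply: (@le_trans _ _ (2 ^+ n * (2 ^+ n / 2 ^+ (4 * n)))).
    apply: ler_pM; [by []|by rewrite divr_ge0 ?exprn_ge0| |].
      by rewrite -natrX ler_nat ltnW // (leq_trans _ (ltn_expl n _)) // ltnS; apply: leq_trans LW; rewrite leq_pmulr.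
    rewrite ler_pdivrMr ?exprn_gt0 // mulrAC ler_pdivlMr ?exprn_gt0 //.
    apply: (@le_trans _ _ (16 ^+ g * 2 ^+ (4 * n))).
      by rewrite ler_wpM2r ?exprn_ge0 // lerXn2r ?nnegrE //; lra.
    have E m : 16 ^+ m = 2 ^+ (4 * m) :> R by rewrite exprM; congr (_ ^+ _); rewrite !exprS; lra.
    rewrite !E -!exprD ler_weXn2l //; first lra.
    by rewrite kE; clear -gn; lia.
  have -> : 2 ^+ n * (2 ^+ n / 2 ^+ (4 * n)) = 2^-1 ^+ n * 2^-1 ^+ n :> R.
    rewrite [(4 * n)%N](_ : _ = n + n + (n + n))%N; last by clear; lia.
    rewrite !exprD !exprVn; move: (two n); set x := 2 ^+ n => /lt0r_neq0 x0.
    by rewrite !invfM; field.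
  rewrite ler_wpM2r ?exprn_ge0 // -[leRHS](_ : 2^-1 ^+ 5 = _); last by rewrite !exprS; lra.
  by apply: ler_wiXn2l; [lra|lra|].
have i3 : 4 ^+ n / (3 ^ L)%:R ^+ (n - s) <= 32^-1 * 2^-1 ^+ n :> R.
  rewrite ns natrX -exprM ler_pdivrMr ?exprn_gt0 // -[32^-1](_ : 2^-1 ^+ 5 = _); last by rewrite !exprS; lra.
  rewrite -exprD exprVn ler_pdivlMl ?exprn_gt0 //.
  rewrite (_ : 4 = 2 ^+ 2 :> R) -?exprM -?exprD; last by rewrite !exprS; lra.
  apply: (@le_trans _ _ (2 ^+ (L * j))); first by rewrite ler_weXn2l //; [lra|clear -Lj; lia].
  by rewrite lerXn2r ?nnegrE //; lra.
(* Three terms of at most [2 ^ - n / 32] stay below [2 ^ - n / 8]. *)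
rewrite invfM -exprVn /c; have := exprn_ge0 n (_ : (0 : R) <= 2^-1).
by rewrite invr_ge0 ler0n => /(_ isT); lra.
Qed.

(** * Affine dependence and threshold functions *)

Section Small.
Variable F : realFieldType.

(** A minimum over a finite type, in the form used by all perturbation arguments: one step size
    serves all cube points at once. *)
Lemma exists_common_small (I : finType) (P : I -> F -> Prop) :
  (forall i, exists2 e, 0 < e & forall d, 0 < d <= e -> P i d) ->
  exists2 e, 0 < e & forall i d, 0 < d <= e -> P i d.
Proof.
move=> H; have /cid2 [g g0 gP] : exists2 g : I -> F, forall i, 0 < g i &
    forall i d, 0 < d <= g i -> P i d.
  have {}H i : {e | 0 < e & forall d, 0 < d <= e -> P i d} by apply: cid2.
  by exists (fun i => s2val (H i)) => i; case: (H i).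
exists (\big[Num.min/1]_i g i).
  by elim/big_rec: _ => // i x _ x0; rewrite lt_min g0.
move=> i d /andP[d0 d1]; apply: gP; rewrite d0 (le_trans d1) //.
exact: bigmin_le_cond.
Qed.

Lemma exists_small_pos (a b : F) : 0 < a ->
  exists2 e, 0 < e & forall d, 0 < d <= e -> 0 < a + d * b.
Proof.
move=> a0; have b1 : 0 < `|b| + 1 by rewrite ltr_wpDl.
exists (a / (`|b| + 1)); first by rewrite divr_gt0.
move=> d /andP[d0]; rewrite ler_pdivlMr // => h.
have h2 : d * `|b| < a by apply: lt_le_trans h; rewrite ltr_pM2l // ltrDl.
have : - (d * `|b|) <= d * b by rewrite -mulrN ler_pM2l // lerNl -normrN ler_norm.
lra.
Qed.

End Small.

Section Cube.
Variable n : nat.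
Notation cube := {ffun 'I_n -> bool}.
Implicit Types (f : bool_fun n) (w : 'rV[rat]_n) (theta : rat) (x : cube) (S : {set cube}).

Definition lin w theta x : rat := \sum_i w ord0 i * (x i)%:R - theta.

Lemma linD w w' theta theta' (d : rat) x :
  lin (w + d *: w') (theta + d * theta') x = lin w theta x + d * lin w' theta' x.
Proof.
rewrite /lin mulrBr addrACA -opprD; congr (_ - _).
rewrite mulr_sumr -big_split /=; apply: eq_bigr => i _; rewrite !mxE mulrDl mulrA //.
Qed.

Definition affdep S : Prop := exists c : cube -> rat,
  [/\ exists2 x, x \in S & c x != 0, \sum_(x in S) c x = 0 &
      forall i, \sum_(x in S) c x * (x i)%:R = 0].

Lemma affdep_lin S (c : cube -> rat) w theta :
  \sum_(x in S) c x = 0 -> (forall i, \sum_(x in S) c x * (x i)%:R = 0) ->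
  \sum_(x in S) c x * lin w theta x = 0.
Proof.
move=> c0 ci; under eq_bigr do rewrite /lin mulrBr mulr_sumr.
rewrite sumrB -mulr_suml c0 mul0r subr0 exchange_big /= big1 // => i _.
under eq_bigr do rewrite mulrCA.
by rewrite -mulr_sumr ci mulr0.
Qed.

(* Rows are the homogenized points [(x, -1)]. *)
Definition lifts S : 'M[rat]_(#|S|, n + 1) :=
  \matrix_(k < #|S|, j < n + 1) match fintype.split j with inl i => (enum_val k i)%:R | inr _ => -1 end.

Lemma mul_lifts S (c : 'rV[rat]_#|S|) (c' : cube -> rat) :
  (forall k, c' (enum_val k) = c 0 k) ->
  (c *m lifts S = 0) <->
  (\sum_(x in S) c' x = 0 /\ forall i, \sum_(x in S) c' x * (x i)%:R = 0).
Proof.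
move=> cc; have E (g : cube -> rat) : \sum_(x in S) c' x * g x = \sum_k c 0 k * g (enum_val k).
  by rewrite big_enum_val /=; apply: eq_bigr => k _; rewrite cc.
split=> [/rowP H|[H0 Hi]].
  split=> [|i].
    have := H (rshift n ord0); rewrite !mxE => /eqP.
    under eq_bigr do rewrite mxE (unsplitK (inr _)) mulrN1.
    rewrite sumrN oppr_eq0 => /eqP h; rewrite -[RHS]h [LHS]big_enum_val /=.
    by apply: eq_bigr => k _; rewrite cc.
  have h := H (lshift 1 i); rewrite !mxE in h; rewrite E -[RHS]h.
  by apply: eq_bigr => k _; rewrite mxE (unsplitK (inl _)).
apply/rowP => j; rewrite !mxE; under eq_bigr do rewrite mxE.
case: (fintype.split j) => [i|_]; first by rewrite -[RHS](Hi i) E.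
under eq_bigr do rewrite mulrN1.
rewrite sumrN; apply/eqP; rewrite oppr_eq0; apply/eqP; rewrite -[RHS]H0 [RHS]big_enum_val /=.
by apply: eq_bigr => k _; rewrite cc.
Qed.

Lemma affdepPn S : affdep S <-> ~~ row_free (lifts S).
Proof.
split=> [[c [[x xS cx] c0 ci]]|].
  pose d : 'rV[rat]_#|S| := \row_k c (enum_val k).
  apply/negP => fr; have dl : d *m lifts S = 0.
    by apply/(@mul_lifts _ _ c) => // k; rewrite mxE.
  have : d = 0 by apply: (row_free_inj fr); rewrite dl mul0mx.
  move/rowP/(_ (enum_rank_in xS x)); rewrite !mxE enum_rankK_in // => /eqP.
  by rewrite (negPf cx).
rewrite -kermx_eq0 => /rowV0Pn[d /sub_kermxP dl d0].
pose c (x : cube) : rat := \sum_(k | enum_val k == x) d 0 k.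
have cE k : c (enum_val k) = d 0 k.
  by rewrite /c (big_pred1 k) // => k'; rewrite (inj_eq enum_val_inj).
have [c0 ci] := (@mul_lifts S d c cE).1 dl.
exists c; split=> //; move/rV0Pn: d0 => [k dk].
by exists (enum_val k); rewrite ?enum_valP ?cE.
Qed.

Lemma affdep_card S : (n.+1 < #|S|)%N -> affdep S.
Proof.
move=> Sn; apply/affdepPn; rewrite /row_free; apply/eqP => h.
by have := rank_leq_col (lifts S); rewrite h; lia.
Qed.

(** Affine independence makes the lifted points the rows of a matrix with a right inverse, so an
    affine form may take prescribed values on them. *)
Lemma interpolate S (g : cube -> rat) : ~ affdep S ->
  exists w theta, forall x, x \in S -> lin w theta x = g x.
Proof.
move=> nd; have fr : row_free (lifts S).
  by apply/negPn/negP => h; apply: nd; apply/affdepPn.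
pose v := pinvmx (lifts S) *m (\col_k g (enum_val k)).
have vE : lifts S *m v = \col_k g (enum_val k) by rewrite /v mulmxA mulmxVp // mul1mx.
exists (\row_i v (lshift 1 i) 0), (v (rshift n ord0) 0) => x xS.
have /colP/(_ (enum_rank_in xS x)) := vE; rewrite !mxE enum_rankK_in // => <-.
rewrite big_split_ord big_ord1 /lin /=; congr (_ + _).
  apply: eq_bigr => i _; rewrite !mxE (unsplitK (inl _)) enum_rankK_in // mulrC //.
by rewrite !mxE (unsplitK (inr _)) mulN1r.
Qed.

Definition ltf_sets : {set {set cube}} :=
  [set [set x | f x] | f : bool_fun n in [pred f | `[< is_ltf n f >]]].

Lemma card_ltf_sets : #|ltf_sets| = #|[pred f : bool_fun n | `[< is_ltf n f >]]|.
Proof.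
rewrite card_imset // => f f' /finset.setP e; apply/ffunP => x.
by have := e x; rewrite !inE.
Qed.

Lemma mem_ltf_sets S w theta : (forall x, (x \in S) = (0 < lin w theta x)) -> S \in ltf_sets.
Proof.
move=> H; apply/imsetP; exists [ffun x => x \in S].
  by rewrite unfold_in; apply/asboolP; exists w; exists theta; move=> x; rewrite ffunE H /sgn.
by apply/finset.setP => x; rewrite !inE ffunE.
Qed.

Lemma ltf_setsP S : S \in ltf_sets -> exists w theta, forall x, (x \in S) = (0 < lin w theta x).
Proof.
case/imsetP => f; rewrite unfold_in => /asboolP[w [theta H]] ->; exists w, theta => x.
by rewrite inE H.
Qed.

(* Radon: the sign pattern of an affine dependence is not realizable. *)
Lemma shattered_affindep S : S \in shattered ltf_sets -> ~ affdep S.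
Proof.
move=> sh; wlog : / exists c : cube -> rat, [/\ exists2 x, x \in S & 0 < c x, \sum_(x in S) c x = 0 &
      forall i, \sum_(x in S) c x * (x i)%:R = 0].
  move=> W [c [[x xS cx] c0 ci]].
  have [cp|cn] := ltP 0 (c x); first by apply: W; last exists c; first exists c; split=> //; exists x.
  apply: W; last by exists c; split=> //; exists x.
  exists (fun x => - c x); split.
  - by exists x => //; rewrite oppr_gt0 lt_neqAle cx.
  - by rewrite sumrN c0 oppr0.
  - by move=> i; under eq_bigr do rewrite mulNr; rewrite sumrN ci oppr0.
move=> [c [[x xS cx] c0 ci]] _.
have /shatteredP/(_ [set x in S | 0 < c x])[] := sh.
  by apply/fintype.subsetP => y; rewrite inE => /andP[].
move=> A /ltf_setsP[w [theta H]] /finset.setP AE.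
have := affdep_lin w theta c0 ci; apply/eqP; rewrite gt_eqF //.
rewrite (bigD1 x) //=; apply: ltr_wpDr.
  apply: sumr_ge0 => y /andP[yS _]; have := AE y; rewrite !inE yS andbT H /=.
  have [cy|cy] := ltP 0 (c y) => h; first by rewrite mulr_ge0 // ltW.
  by rewrite mulr_le0 // leNgt h.
by rewrite mulr_gt0 //; have := AE x; rewrite !inE xS andbT H cx.
Qed.

Lemma card_ltf_le : (#|[pred f : bool_fun n | `[< is_ltf n f >]]| <= \sum_(i < n.+2) 'C(2 ^ n, i))%N.
Proof.
rewrite -card_ltf_sets; have -> : (2 ^ n = #|{: cube}|)%N by rewrite card_ffun card_bool card_ord.
apply: sauer_shelah => S sh; rewrite leqNgt; apply/negP => /affdep_card.
exact: shattered_affindep.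
Qed.

Definition isolated (S : {set cube}) : Prop := ~ affdep S /\ forall y, y \notin S -> ~ affdep (y |: S).

(** The points outside [S] are treated one by one. If the current form vanishes at [y], a small
    multiple of a form that is 0 on [S] and 1 at [y] is added, small enough to preserve all nonzero
    values obtained before. *)
Lemma isolated_lin S : isolated S -> exists w theta,
  forall x, (lin w theta x == 0) = (x \in S).
Proof.
move=> [_ iso].
have [w [theta [H0 H1]]] : exists w theta, (forall x, x \in S -> lin w theta x = 0) /\
    forall y, y \in enum (~: S) -> lin w theta y != 0.
  have : forall y, y \in enum (~: S) -> y \notin S by move=> y; rewrite mem_enum inE.
  elim: (enum (~: S)) => [|y s IH] sS.
    exists 0, 0; split=> // x _; rewrite /lin big1 ?subrr // => i _; by rewrite mxE mul0r.
  have [w [theta [H0 H1]]] : exists w theta, (forall x, x \in S -> lin w theta x = 0) /\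
      forall y, y \in s -> lin w theta y != 0.
    by apply: IH => z zs; apply: sS; rewrite inE zs orbT.
  have yS : y \notin S by apply: sS; rewrite inE eqxx.
  have [w' [theta' H']] := interpolate (fun x => (x == y)%:R) (iso _ yS).
  have [e e0 eP] : exists2 e : rat, 0 < e & forall x d, 0 < d <= e ->
      lin w theta x != 0 -> lin w theta x + d * lin w' theta' x != 0.
    apply: exists_common_small => x.
    have [h|h] := eqVneq (lin w theta x) 0; first by exists 1.
    have [hp|hn] := ltP 0 (lin w theta x).
      have [e e0 eP] := exists_small_pos (lin w' theta' x) hp.
      by exists e => // d /eP; rewrite lt0r => /andP[].
    have hn' : 0 < - lin w theta x by rewrite oppr_gt0 lt_neqAle h.
    have [e e0 eP] := exists_small_pos (- lin w' theta' x) hn'.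
    exists e => // d /eP; rewrite mulrN -opprD oppr_gt0 lt_neqAle => /andP[] //.
  have ee : 0 < e <= e by rewrite e0 /=.
  have [hy|hy] := eqVneq (lin w theta y) 0; last first.
    exists w, theta; split=> // z; rewrite inE => /orP[/eqP -> //|]; exact: H1.
  exists (w + e *: w'), (theta + e * theta'); split=> [x xS|z].
    rewrite linD H0 // H' ?add0r ?inE ?xS ?orbT //.
    case: eqVneq xS => [->|_ _]; first by rewrite (negPf yS).
    by rewrite mulr0.
  rewrite inE linD => /orP[/eqP ->|/H1]; last by apply: eP.
  by rewrite hy add0r H' ?inE ?eqxx // mulr1 gt_eqF.
exists w, theta => x; have [xS|xS] := boolP (x \in S); first by rewrite H0 ?eqxx.
by apply/negbTE/H1; rewrite mem_enum inE.
Qed.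

Lemma isolated_strongly_shattered S : isolated S -> S \in strongly_shattered ltf_sets.
Proof.
move=> iso; have [w [theta H]] := isolated_lin iso.
rewrite inE; apply/existsP; exists [set x | 0 < lin w theta x].
apply/forallP => T; apply/implyP => /fintype.subsetP TS.
have [w' [theta' H']] := interpolate (fun x => if x \in T then 1 else -1) (iso.1).
have [e e0 eP] : exists2 e : rat, 0 < e & forall x d, 0 < d <= e -> x \notin S ->
      (0 < lin w theta x + d * lin w' theta' x) = (0 < lin w theta x).
  apply: exists_common_small => x.
  have [xS|xS] := boolP (x \in S); first by exists 1.
  have h : lin w theta x != 0 by rewrite H.
  have [hp|hn] := ltP 0 (lin w theta x).
    by have [e e0 eP] := exists_small_pos (lin w' theta' x) hp; exists e => // d /eP ->.
  have hn' : 0 < - lin w theta x by rewrite oppr_gt0 lt_neqAle h.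
  have [e e0 eP] := exists_small_pos (- lin w' theta' x) hn'.
  exists e => // d /eP; rewrite mulrN -opprD oppr_gt0 => h' _.
  by apply/negbTE; rewrite -leNgt ltW.
apply: (@mem_ltf_sets _ (w + e *: w') (theta + e * theta')) => x.
rewrite linD !inE; have [xS|xS] := boolP (x \in S).
  have /eqP -> : lin w theta x == 0 by rewrite H.
  rewrite ltxx andbF orbF add0r pmulr_rgt0 // H' //.
  by case: ifP => // _; rewrite ltrN10.
rewrite eP ?e0 //= orb_idl // => /TS; by rewrite (negPf xS).
Qed.

Lemma card_isolated_le :
  (#|[set S : {set cube} | `[< isolated S >]]| <= #|[pred f : bool_fun n | `[< is_ltf n f >]]|)%N.
Proof.
rewrite -card_ltf_sets; apply: leq_trans (card_strongly_shattered_le _).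
apply/subset_leq_card/fintype.subsetP => S; rewrite inE => /asboolP.
exact: isolated_strongly_shattered.
Qed.

End Cube.

(** Clear denominators, then divide by 3 as long as all entries allow it; the sum of the absolute
    values decreases. *)
Lemma primitive3 (I : finType) (b : I -> rat) : (exists i, b i != 0) ->
  exists (a : I -> int) (q : rat), (forall i, (a i)%:~R = q * b i) /\ exists i, ~~ (3 %| a i)%Z.
Proof.
move=> bn.
have [a [q [q0 ab]]] : exists (a : I -> int) (q : rat), q != 0 /\ forall i, (a i)%:~R = q * b i.
  exists (fun i => numq (b i) * \prod_(k | k != i) denq (b k)), (\prod_k denq (b k))%:~R.
  split; first by rewrite intr_eq0; apply/prodf_neq0 => i _; exact: denq_neq0.
  move=> i; rewrite [in RHS](bigD1 i) //= !intrM -[X in _ = _ * X]divq_num_den.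
  have d0 : (denq (b i))%:~R != 0 :> rat by rewrite intr_eq0 denq_neq0.
  by move: d0; set d : rat := (denq _)%:~R; set P : rat := (\prod_(_ | _) _)%:~R => d0; field.
have an : exists i, a i != 0.
  have [i bi] := bn; exists i; rewrite -(intr_eq0 rat) ab mulf_neq0 //.
have [m] := ubnP (\sum_i `|a i|%N); elim: m => // m IH in a q q0 ab an *; rewrite ltnS => am.
have [/existsP[i ai]|] := boolP [exists i, ~~ (3 %| a i)%Z]; first by exists a, q; split=> //; exists i.
rewrite negb_exists => /forallP H; have a3 i : a i = (a i %/ 3)%Z * 3.
  by rewrite divzK //; have := H i; rewrite negbK.
apply: (IH (fun i => (a i %/ 3)%Z) (q / 3)).
- by rewrite mulf_neq0.
- by move=> i; rewrite mulrAC -ab {2}(a3 i) intrM mulfK.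
- by have [i ai] := an; exists i; apply: contra ai => /eqP h; rewrite (a3 i) h mul0r.
apply: leq_trans am; have [i ai] := an; rewrite (bigD1 i) //= [ltnRHS](bigD1 i) //=.
rewrite -addSn leq_add //; last first.
  by apply: leq_sum => k _; rewrite {2}(a3 k); lia.
by move: ai; rewrite {1 3}(a3 i); lia.
Qed.

(** * Isolated sets and degenerate matrices *)

Section Count.
Variables (n s : nat).
Notation cube := {ffun 'I_n -> bool}.

Definition columns (t : {ffun 'I_s -> cube}) : {ffun 'I_n -> {ffun 'I_s -> bool}} :=
  [ffun c => [ffun i => t i c]].

Lemma columns_inj : injective columns.
Proof.
move=> t t' /ffunP H; apply/ffunP => i; apply/ffunP => c.
by have /ffunP/(_ i) := H c; rewrite !ffunE.
Qed.

(* Since the coefficients sum to zero and the points are distinct, the support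
   modulo 3 has more than two elements. *)
Lemma affdep_degenerate (t : {ffun 'I_s -> cube}) :
  injective t -> affdep [set t i | i in 'I_s] -> columns t \in degenerate s n.
Proof.
move=> tinj [c [[x xS cx] c0 ci]].
have sumt (g : cube -> rat) : \sum_(x in [set t i | i in 'I_s]) g x = \sum_i g (t i).
  by rewrite big_imset //= => i j _ _; exact: tinj.
have [|a [q [aq [i0 ai0]]]] := @primitive3 'I_s (fun i => c (t i)).
  by case/imsetP: xS => i _ xE; exists i; rewrite -xE.
have a0 : \sum_i a i = 0.
  apply/eqP; rewrite -(intr_eq0 rat) raddf_sum /=; under eq_bigr do rewrite aq.
  by rewrite -mulr_sumr -(sumt c) c0 mulr0.
have ac k : \sum_i a i * (t i k : nat)%:Z = 0.
  apply/eqP; rewrite -(intr_eq0 rat) raddf_sum /=.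
  under eq_bigr do rewrite intrM aq -mulrA -pmulrn.
  by rewrite -mulr_sumr -(sumt (fun x => c x * (x k)%:R)) ci mulr0.
rewrite inE; apply/asboolP; exists a; split; last first.
  (* Passage from bits to signs by [(-1) ^ b = 1 - 2 b]. *)
  move=> k; transitivity (\sum_i (a i - 2 * (a i * (t i k : nat)%:Z))).
    apply: eq_bigr => i _; rewrite !ffunE /signv; case: (t i k); rewrite ?expr1 ?expr0; lia.
  by rewrite sumrB -mulr_sumr ac a0.
have sub3 (w : 'I_s -> int) : (3 %| \sum_i a i * w i)%Z ->
    (3 %| \sum_(i | ~~ (3 %| a i)%Z) a i * w i)%Z.
  rewrite (bigID (fun i => ~~ (3 %| a i)%Z)) /= rpredDr //.
  by apply: rpred_sum => i; rewrite negbK => h; rewrite dvdz_mulr.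
rewrite ltnNge; apply/negP => le2.
have h1 : (3 %| \sum_(i | ~~ (3 %| a i)%Z) a i)%Z.
  by under eq_bigr do rewrite -[a _]mulr1; apply: sub3; under eq_bigr do rewrite mulr1; rewrite a0.
have hk k : (3 %| \sum_(i | ~~ (3 %| a i)%Z) a i * (t i k : nat)%:Z)%Z by apply: sub3; rewrite ac.
have [i1 /andP[ai1 i10]|none] := pickP (fun i => ~~ (3 %| a i)%Z && (i != i0)); last first.
  move: h1; rewrite (big_pred1 i0) ?(negPf ai0) // => i; have := none i.
  by case: (eqVneq i i0) => [-> _|ne /=]; [rewrite ai0 /= eqxx|rewrite andbT (negbTE ne)].
have E : (fun i => ~~ (3 %| a i)%Z) =1 [pred i | (i == i0) || (i == i1)].
  have : [set i | ~~ (3 %| a i)%Z] = [set i0; i1].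
    apply/esym/eqP; rewrite eqEcard cards2 (eq_sym i0) i10 le2 andbT.
    by apply/fintype.subsetP => i; rewrite !inE => /orP[] /eqP ->.
  by move/finset.setP => h i; have := h i; rewrite !inE.
have sum2 (w : 'I_s -> int) : \sum_(i | ~~ (3 %| a i)%Z) w i = w i0 + w i1.
  rewrite (eq_bigl _ _ E) (bigD1 i0) /= ?eqxx //; congr (_ + _).
  by rewrite (big_pred1 i1) // => i /=; case: (eqVneq i i1) => [->|]; rewrite ?i10 ?orbT //= orbF andbN.
(* At a coordinate where the two points differ, the relation modulo 3 retains a single coefficient,
   which is not a multiple of 3. *)
have ti : t i0 = t i1.
  apply/ffunP => k; have := hk k; move: h1; rewrite !sum2.
  move: ai0; case: (t i0 k); case: (t i1 k) => //= ; rewrite ?mulr1 ?mulr0 ?addr0 ?add0r.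
    by move=> /negbTE ->.
  by move: ai1 => /negbTE ->.
by move: i10; rewrite (tinj _ _ ti) eqxx.
Qed.

End Count.

(** An isolated set of size [r] is the image of [r!] injective tuples. A tuple with another image
    extends by a new point to a dependent tuple of length [r.+1], that is, to a degenerate matrix;
    if the image is itself dependent, any new point serves, and [r < 2 ^ n] provides one. *)
Lemma ffact_isolated (n r : nat) : (r < 2 ^ n)%N ->
  ((2 ^ n) ^_ r <= r`! * #|[set S : {set {ffun 'I_n -> bool}} | `[< isolated S >]]|
     + #|degenerate r.+1 n|)%N.
Proof.
move=> rn; pose cube := {ffun 'I_n -> bool}.
have cc : #|{: cube}| = (2 ^ n)%N by rewrite card_ffun card_bool card_ord.
have -> : ((2 ^ n) ^_ r = #|[set u : {ffun 'I_r -> cube} | injectiveb u]|)%N.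
  by rewrite card_inj_ffuns card_ord cc.
pose im m (u : {ffun 'I_m -> cube}) := [set u i | i in 'I_m].
pose Ug := [set u : {ffun 'I_r -> cube} | injectiveb u && `[< isolated (im _ u) >]].
pose Ub := [set u : {ffun 'I_r -> cube} | injectiveb u && ~~ `[< isolated (im _ u) >]].
have -> : [set u : {ffun 'I_r -> cube} | injectiveb u] = Ug :|: Ub.
  by apply/finset.setP => u; rewrite !inE -andb_orr orbN andbT.
apply: leq_trans (leq_card_setU _ _) _; apply: leq_add.
  pose A := [set S : {set cube} | `[< isolated S >] && (#|S| == r)].
  have := @leq_card_cover _ _ Ug A (fun S => [set f in ffun_on (mem S) | injectiveb f]).
  move=> /(_ _)/leq_trans; apply.
    move=> u; rewrite inE => /andP[ui iu]; exists (im _ u); rewrite inE ?iu ?ui ?andbT /=.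
      by rewrite card_imset ?card_ord //; apply/injectiveP.
    by apply/ffun_onP => i; apply/imsetP; exists i.
  apply: (@leq_trans (\sum_(S in A) r`!)).
    apply: leq_sum => S; rewrite inE => /andP[_ /eqP cS].
    by rewrite card_inj_ffuns_on card_ord cS ffactnn.
  rewrite sum_nat_const mulnC leq_mul2l; apply/orP; right.
  by apply/subset_leq_card/fintype.subsetP => S; rewrite [_ \in A]finset.inE => /andP[iS _]; rewrite finset.inE.
have ex u : u \in Ub -> exists y, y \notin im _ u /\ affdep (y |: im _ u).
  rewrite inE => /andP[/injectiveP ui /asboolP niso]; apply: contrapT => H; apply: niso; split.
    move=> [c [[x xS cx] c0 ci]]; have [y yS] : exists y, y \notin im _ u.
      apply/existsP; rewrite -negb_forall; apply/negP => /forallP all.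
      have : (#|{: cube}| <= #|im _ u|)%N.
        by apply/subset_leq_card/fintype.subsetP => x' _; exact: all.
      by rewrite cc card_imset // card_ord leqNgt rn.
    apply: H; exists y; split=> //; exists (fun z => if z \in im _ u then c z else 0); split.
    - by exists x; rewrite ?xS // !inE xS orbT.
    - rewrite big_setU1 //= (negPf yS) add0r -[RHS]c0.
      by apply: eq_bigr => z ->.
    - move=> i; rewrite big_setU1 //= (negPf yS) mul0r add0r -[RHS](ci i).
      by apply: eq_bigr => z ->.
  by move=> y yS dep; apply: H; exists y.
pose y0 (u : {ffun 'I_r -> cube}) : cube := xget [ffun=> false] [set y | y \notin im _ u /\ affdep (y |: im _ u)]%classic.
have y0P u : u \in Ub -> y0 u \notin im _ u /\ affdep (y0 u |: im _ u).
  by move=> /ex h; exact: (xgetPex _ h).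
pose ext (u : {ffun 'I_r -> cube}) : {ffun 'I_r.+1 -> cube} :=
  [ffun i => if unlift ord0 i is Some j then u j else y0 u].
have ext_inj : injective ext.
  move=> u u' /ffunP H; apply/ffunP => j; have := H (lift ord0 j).
  by rewrite !ffunE liftK.
have ext_im u : [set ext u i | i in 'I_r.+1] = y0 u |: im _ u.
  apply/finset.setP => z; rewrite !inE; apply/imsetP/orP => [[i _ ->]|].
    rewrite ffunE; case: unliftP => [j _|_]; last by left.
    by right; apply/imsetP; exists j.
  move=> [/eqP ->|/imsetP[j _ ->]]; first by exists ord0; rewrite // ffunE unlift_none.
  by exists (lift ord0 j); rewrite // ffunE liftK.
rewrite -(card_imset _ (inj_comp (@columns_inj n r.+1) ext_inj)).
apply/subset_leq_card/fintype.subsetP => _ /imsetP[u uB ->] /=.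
have [yu dep] := y0P _ uB; have /injectiveP ui : injectiveb u by move: uB; rewrite inE => /andP[].
apply: affdep_degenerate; last by rewrite ext_im.
move=> i j; rewrite !ffunE; case: unliftP => [i' ->|->]; case: unliftP => [j' ->|->] //.
- by move/ui ->.
- by move=> h; case/imsetP: yu; exists i'.
- by move=> h; case/imsetP: yu; exists j'.
Qed.

(** The induction carries the collision bound [1 - k ^ 2 / N] for [k] random choices among [N]; at
    [k = r] it leaves at least one half. *)
Lemma expn_le_ffact (N r : nat) : (2 * (r * r) <= N)%N -> (N ^ r <= 2 * N ^_ r)%N.
Proof.
move=> rN; have H k : (k <= r)%N -> (N ^ k * (N - k * k) <= N * N ^_ k)%N.
  elim: k => [|k IH] kr; first by rewrite expn0 ffactn0 mul1n muln1 subn0.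
  rewrite ffactnSr mulnA expnSr; apply: leq_trans (leq_mul (IH (ltnW kr)) (leqnn _)).
  rewrite -!mulnA leq_mul2l; apply/orP; right.
  have k2 : (k.+1 * k.+1 <= N)%N by nia.
  nia.
have [->|N0] := posnP N; first by case: (r) => [|k] //; rewrite exp0n.
rewrite -(leq_pmul2l N0) mulnCA; apply: leq_trans (leq_mul (leqnn 2) (H r (leqnn r))).
rewrite mulnA [(2 * _)%N]mulnC -mulnA mulnC leq_mul2l; apply/orP; right; lia.
Qed.

Definition num_ltf (n : nat) : nat := #|[pred f : bool_fun n | `[< is_ltf n f >]]|.

(** Here [n ^ n] bounds [r!], and [2 ^ (C * n)] makes up for the [j.+1] points missing from an
    [n]-tuple, each worth a factor [2 ^ n], and for constants. *)
Lemma ltf_lower (R : realType) : exists C N : nat, forall n, (N <= n)%N ->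
  (2 ^ (n * n) <= 2 ^ (C * n) * n ^ n * num_ltf n)%N.
Proof.
have [j j0 [N HN]] := card_degenerate R.
exists (j + 3)%N, (N + j + 7)%N => n Nn.
pose r := (n - j.+1)%N; have nE : (r.+1 + j = n)%N by rewrite /r; lia.
have : (8 * 2 ^ n * #|degenerate r.+1 n| <= (2 ^ r.+1) ^ n)%N.
  by move: (HN r.+1); rewrite nE; apply; lia.
(* The factor [2 ^ n] gained in [card_degenerate] is exactly the number of choices of the extending
   point. *)
have -> : ((2 ^ r.+1) ^ n = 2 ^ n * (2 ^ n) ^ r)%N by rewrite -expnS -!expnM mulnC.
set d := #|_| => hd.
have n0 : (0 < 2 ^ n)%N by rewrite expn_gt0.
have {}hd : (8 * d <= (2 ^ n) ^ r)%N by rewrite -(leq_pmul2l n0) mulnCA mulnA.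
have n2 m : (7 <= m)%N -> (2 * (m * m) <= 2 ^ m)%N.
  elim: m => // m IH; rewrite leq_eqVlt => /orP[/eqP <- //|]; rewrite ltnS => h.
  by rewrite expnS; have := IH h; nia.
have rN : (2 * (r * r) <= 2 ^ n)%N.
  apply: leq_trans (n2 n _); last lia.
  by rewrite leq_mul2l leq_mul //= /r leq_subr.
have rn : (r < 2 ^ n)%N by apply: leq_ltn_trans (ltn_expl n _); rewrite // /r leq_subr.
have := ffact_isolated rn; rewrite -/d => h1.
have h2 := expn_le_ffact rN; have h3 := card_isolated_le n; rewrite -/(num_ltf n) in h3.
have h4 : (r`! * #|[set S : {set {ffun 'I_n -> bool}} | `[< isolated S >]]| <= n ^ n * num_ltf n)%N.
  apply: leq_mul => //; apply: leq_trans (_ : r ^ r <= _)%N.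
    rewrite fact_prod; apply: (@leq_trans (\prod_(1 <= i < r.+1) r)).
      by rewrite !big_seq; apply: leq_prod => i; rewrite mem_index_iota; lia.
    by rewrite prod_nat_const_nat subn1.
  have [->|r0] := posnP r; first by rewrite expn0 expn_gt0; lia.
  apply: (@leq_trans (n ^ r)); first by rewrite leq_exp2r // /r leq_subr.
  by rewrite leq_pexp2l // /r; lia.
have h5 : ((2 ^ n) ^ r <= 4 * (n ^ n * num_ltf n))%N by lia.
have -> : (2 ^ (n * n) = 2 ^ (n * j.+1) * (2 ^ n) ^ r)%N.
  by rewrite -expnM -expnD; congr (2 ^ _)%N; rewrite -nE; lia.
apply: (@leq_trans (2 ^ (n * j.+1) * (4 * (n ^ n * num_ltf n)))); first by rewrite leq_mul2l h5 orbT.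
rewrite mulnA [leqRHS](_ : _ = 2 ^ ((j + 3) * n) * (n ^ n * num_ltf n))%N; last by rewrite mulnA.
rewrite leq_mul2r; apply/orP; right.
rewrite (_ : 4 = 2 ^ 2)%N // -expnD leq_pexp2l //; lia.
Qed.

(** * Positive threshold functions and duality *)

Section Strict.
Variable n : nat.
Notation cube := {ffun 'I_n -> bool}.
Implicit Types (f : bool_fun n) (w u : 'rV[rat]_n) (theta : rat) (x y : cube).

(** A [realization] may vanish at zeros of [f]. Strictness on both sides is an open condition, so it
    survives perturbation, and it is symmetric under [dual]. *)
Definition srealize f w theta : Prop :=
  forall x, 0 < (if f x then lin w theta x else - lin w theta x).

Lemma srealize_realization f w theta : srealize f w theta -> realization n f w theta.
Proof.
move=> H x; have := H x; rewrite -/(lin w theta x) /sgn; case: (f x) => [->//|].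
by rewrite oppr_gt0 => /ltW; rewrite leNgt => /negbTE ->.
Qed.

Lemma srealize_fun f f' w theta : srealize f w theta -> srealize f' w theta -> f = f'.
Proof.
by move=> /srealize_realization H /srealize_realization H'; apply/ffunP => x; rewrite H H'.
Qed.

Lemma srealize_perturb f w theta u (t : rat) : srealize f w theta ->
  exists2 e, 0 < e & forall d, 0 < d <= e -> srealize f (w + d *: u) (theta + d * t).
Proof.
move=> H; have [e e0 eP] : exists2 e : rat, 0 < e & forall x d, 0 < d <= e ->
    0 < (if f x then lin (w + d *: u) (theta + d * t) x else - lin (w + d *: u) (theta + d * t) x).
  apply: exists_common_small => x; have := H x; case: (f x) => h.
    have [e e0 eP] := exists_small_pos (lin u t x) h.
    by exists e => // d /eP; rewrite linD.
  have [e e0 eP] := exists_small_pos (- lin u t x) h.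
  by exists e => // d /eP; rewrite linD mulrN -opprD.
by exists e => // d de x; apply: eP.
Qed.

Lemma realization_strict f w theta : realization n f w theta ->
  exists2 e, 0 < e & forall d, 0 < d <= e -> srealize f w (theta + d).
Proof.
move=> H; have [e e0 eP] : exists2 e : rat, 0 < e & forall x d, 0 < d <= e ->
    0 < (if f x then lin w (theta + d) x else - lin w (theta + d) x).
  apply: exists_common_small => x.
  have E d : lin w (theta + d) x = lin w theta x - d by rewrite /lin opprD addrA.
  have := H x; rewrite -/(lin w theta x) /sgn; case: (f x) => /esym h.
    by exists (lin w theta x / 2); rewrite ?divr_gt0 // => d; rewrite E; lra.
  exists 1 => // d /andP[d0 _]; rewrite E; move/negbT: h; rewrite -leNgt; lra.
by exists e => // d de x; apply: eP.
Qed.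

Lemma positive_strict f : positive n f ->
  exists w theta, srealize f w theta /\ forall i, 0 < w ord0 i.
Proof.
move=> [w [theta [H w0]]]; have [e e0 eP] := realization_strict H.
by exists w, (theta + e); split=> //; apply: eP; rewrite e0 /=.
Qed.

Lemma positive_srealize f w theta : srealize f w theta -> (forall i, 0 < w ord0 i) -> positive n f.
Proof. by move=> /srealize_realization H w0; exists w, theta. Qed.

Lemma positive_mono f x y : positive n f -> (forall i, x i -> y i) -> f x -> f y.
Proof.
move=> [w [theta [H w0]]] xy; rewrite !H /sgn => /lt_le_trans; apply.
rewrite lerD2r; apply: ler_sum => i _; rewrite ler_wpM2l ?(ltW (w0 i)) //.
by have := xy i; case: (x i) => [->|].
Qed.

Definition flip (s x : cube) : cube := [ffun i => x i (+) s i].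
Definition unit_cube (i : 'I_n) : cube := [ffun j => j == i].
Definition neg_cube x : cube := [ffun i => ~~ x i].
Definition dual f : bool_fun n := [ffun x => ~~ f (neg_cube x)].

Lemma neg_cubeK : involutive neg_cube.
Proof. by move=> x; apply/ffunP => i; rewrite !ffunE negbK. Qed.

Lemma dualK : involutive dual.
Proof. by move=> f; apply/ffunP => x; rewrite !ffunE neg_cubeK negbK. Qed.

Lemma lin_unit w theta i : lin w theta (unit_cube i) = w ord0 i - theta.
Proof.
rewrite /lin (bigD1 i) //= ffunE eqxx mulr1 big1 ?addr0 // => j ji.
by rewrite ffunE (negPf ji) mulr0.
Qed.

Lemma lin_neg w theta x :
  lin w (\sum_i w ord0 i - theta) x = - lin w theta (neg_cube x).
Proof.
have -> : \sum_i w ord0 i = \sum_i w ord0 i * (x i)%:R + \sum_i w ord0 i * (neg_cube x i)%:R.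
  rewrite -big_split /=; apply: eq_bigr => i _.
  by rewrite ffunE -mulrDr; case: (x i); rewrite /= ?addr0 ?add0r mulr1.
by rewrite /lin; ring.
Qed.

(** Complementing the point replaces [w.x] by the total weight minus [w.x]. The weights are kept and
    the sign of the total weight minus [2 * theta] is reversed, which is why duality exchanges
    ampleness with its failure. *)
Lemma srealize_dual f w theta : srealize f w theta ->
  srealize (dual f) w (\sum_i w ord0 i - theta).
Proof.
move=> H x; have := H (neg_cube x); rewrite ffunE lin_neg.
by case: (f _); rewrite ?opprK.
Qed.

Lemma positive_dual f : positive n f -> positive n (dual f).
Proof.
by move=> /positive_strict[w [theta [/srealize_dual H w0]]]; exact: positive_srealize H w0.
Qed.

Lemma positive_constant_true_at f i x : positive n f -> f (unit_cube i) -> x i -> f x.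
Proof.
by move=> fp fi xi; apply: (positive_mono fp _ fi) => j; rewrite ffunE => /eqP ->.
Qed.

(** At a unit vector the form takes the value [w i - theta], so in every realization smallness is
    read off from [f]; in particular the positive realization is also small. *)
Lemma small_unit f : positive n f -> small n f <-> forall i, f (unit_cube i) = false.
Proof.
move=> fp; split=> [[w [theta [H ws]]] i|H].
  by rewrite H -/(lin w theta _) lin_unit /sgn subr_gt0 ltNge ws.
have [w [theta [Hr w0]]] := fp; exists w, theta; split=> // i.
by have := H i; rewrite Hr -/(lin w theta _) lin_unit /sgn subr_gt0 leNgt => ->.
Qed.

Lemma srealize_sum_lt f w theta : srealize f w theta -> 2 * theta < \sum_i w ord0 i -> ample n f.
Proof. by move=> /srealize_realization H h; exists w, theta. Qed.

(** One realization serves for positivity and ampleness. Replacing negative weights by 0 only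
    increases the total; it does not change [f], because deleting the coordinates of negative weight
    from [x] cannot lower the form, nor raise [f] by monotonicity. Then the threshold is made strict
    and all weights are slightly increased. *)
Lemma ample_strict f : positive n f -> ample n f ->
  exists w theta, [/\ srealize f w theta, forall i, 0 < w ord0 i & 2 * theta < \sum_i w ord0 i].
Proof.
move=> fp [w [theta [H wl]]].
pose w1 : 'rV[rat]_n := \row_i Num.max (w ord0 i) 0.
have H1 : realization n f w1 theta.
  move=> x; pose x' : cube := [ffun i => x i && (0 <= w ord0 i)].
  have E : lin w theta x' = lin w1 theta x.
    rewrite /lin; congr (_ - _); apply: eq_bigr => i _; rewrite ffunE mxE.
    by case: (leP 0 (w ord0 i)) => h; rewrite ?andbT ?andbF ?mulr0 ?mul0r //.
  have fx' : f x' -> f x by apply: positive_mono => // i; rewrite ffunE => /andP[].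
  have fx : f x -> f x'.
    rewrite !H /sgn => /lt_le_trans; apply; rewrite lerD2r; apply: ler_sum => i _.
    rewrite ffunE; case: (leP 0 (w ord0 i)) => h; rewrite ?andbT ?andbF ?mulr0 //.
    by rewrite mulr_le0_ge0 // ltW.
  rewrite -/(lin w1 theta x) -E -[RHS](H x'); apply/idP/idP; [exact: fx|exact: fx'].
have w1l : 2 * theta < \sum_i w1 ord0 i.
  by apply: lt_le_trans wl _; apply: ler_sum => i _; rewrite mxE le_max lexx.
have [e e0 eP] := realization_strict H1.
(* The slack is spent twice as fast as the threshold moves, so a quarter of it uses up only half. *)
pose d := Num.min e ((\sum_i w1 ord0 i - 2 * theta) / 4).
have d0 : 0 < d by rewrite lt_min e0 divr_gt0 // subr_gt0.
have dP : srealize f w1 (theta + d) by apply: eP; rewrite d0 ge_min lexx.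
have dl : 2 * (theta + d) < \sum_i w1 ord0 i.
  have : d <= (\sum_i w1 ord0 i - 2 * theta) / 4 by rewrite ge_min lexx orbT.
  lra.
have [e' e'0 e'P] := srealize_perturb (const_mx 1) 0 dP.
exists (w1 + e' *: const_mx 1), (theta + d); split.
- by have := e'P e'; rewrite e'0 lexx mulr0 addr0 => /(_ isT).
- by move=> i; rewrite !mxE mulr1; apply: ltr_wpDl => //; rewrite le_max lexx orbT.
apply: lt_le_trans dl _; apply: ler_sum => i _; rewrite !mxE mulr1 lerDl ltW //.
Qed.

(** When the total weight does not exceed [2 * theta], raising the threshold slightly removes the
    case of equality, and the dual realization is ample. *)
Lemma ample_or_dual f : positive n f -> ample n f \/ ample n (dual f).
Proof.
move=> /positive_strict[w [theta [H _]]].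
have [h|h] := ltP (2 * theta) (\sum_i w ord0 i); first by left; exact: srealize_sum_lt H h.
right; have [e e0 eP] := srealize_perturb 0 1 H.
have := eP e; rewrite e0 lexx scaler0 addr0 mulr1 => /(_ isT)/srealize_dual H'.
apply: srealize_sum_lt H' _; lra.
Qed.

Lemma srealize_combine f w theta w' theta' (a b : rat) : 0 < a -> 0 < b ->
  srealize f w theta -> srealize f w' theta' ->
  srealize f (a *: w + b *: w') (a * theta + b * theta').
Proof.
move=> a0 b0 H H' x.
have -> : lin (a *: w + b *: w') (a * theta + b * theta') x = a * lin w theta x + b * lin w' theta' x.
  rewrite linD; congr (_ + _); rewrite /lin mulrBr mulr_sumr; congr (_ - _).
  by apply: eq_bigr => i _; rewrite !mxE mulrA.
have := H x; have := H' x; case: (f x) => h' h; first by rewrite addr_gt0 // mulr_gt0.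
by rewrite [- (_ + _)]opprD -!mulrN addr_gt0 // mulr_gt0.
Qed.

(** [f] then has two strict realizations for which the total weight minus twice the threshold has
    opposite signs. The positive combination that balances them has total exactly twice its
    threshold, so it coincides with its own dual realization. *)
Lemma ample_selfdual f : positive n f -> ample n f -> ample n (dual f) -> dual f = f.
Proof.
move=> fp fa da; have [w [theta [H _ wl]]] := ample_strict fp fa.
have [w' [theta' [H' _ wl']]] := ample_strict (positive_dual fp) da.
have := srealize_dual H'; rewrite dualK => H2.
set W := \sum_i w ord0 i in wl; set W' := \sum_i w' ord0 i in wl' H2.
have a0 : 0 < W - 2 * theta by rewrite subr_gt0.
have b0 : 0 < W' - 2 * theta' by rewrite subr_gt0.
have Hc := srealize_combine b0 a0 H H2.
have Hd := srealize_dual Hc.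
have E : \sum_i ((W' - 2 * theta') *: w + (W - 2 * theta) *: w') ord0 i =
    (W' - 2 * theta') * W + (W - 2 * theta) * W'.
  by rewrite !mulr_sumr -big_split /=; apply: eq_bigr => i _; rewrite !mxE.
apply: srealize_fun Hc; rewrite E in Hd.
suff <- : (W' - 2 * theta') * W + (W - 2 * theta) * W' -
   ((W' - 2 * theta') * theta + (W - 2 * theta) * (W' - theta')) =
   (W' - 2 * theta') * theta + (W - 2 * theta) * (W' - theta') by [].
ring.
Qed.

End Strict.

Definition pos_ltf (n : nat) : {set bool_fun n} := [set f | `[< positive n f >]].
Definition small_ltf (n : nat) : {set bool_fun n} :=
  [set f in pos_ltf n | [forall i, ~~ f (unit_cube i)]].
Definition ample_ltf (n : nat) : {set bool_fun n} := [set f in pos_ltf n | `[< ample n f >]].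

Lemma semi_goldilocksP n (f : bool_fun n) : reflect (semi_goldilocks n f) (f \in small_ltf n).
Proof.
rewrite !finset.inE; apply: (iffP andP) => [[/asboolP fp /forallP H]|[_ fp fs]].
  have [w [theta [Hr _]]] := fp.
  split=> //; first by exists w, theta.
  by apply/(small_unit fp) => i; apply/negbTE.
split; first exact/asboolP.
by apply/forallP => i; have /(small_unit fp)/(_ i) := fs => ->.
Qed.

Lemma num_semi_goldilocksE n : num_semi_goldilocks n = #|small_ltf n|.
Proof.
apply: eq_card => f; rewrite unfold_in; apply/asboolP/idP => [/semi_goldilocksP //|].
by move/semi_goldilocksP.
Qed.

Lemma num_goldilocksE n : num_goldilocks n = #|small_ltf n :&: ample_ltf n|.
Proof.
apply: eq_card => f; rewrite unfold_in finset.in_setI [_ \in ample_ltf n]finset.inE.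
apply/asboolP/idP => [[h fa]|/andP[/semi_goldilocksP h /andP[_ /asboolP fa]]]; last by split.
apply/andP; split; first exact/semi_goldilocksP.
by apply/andP; split; [case: h => _ + _; rewrite finset.inE => ?; exact/asboolP|exact/asboolP].
Qed.

(** * Reduction to positive functions *)

Section Flip.
Variable n : nat.

Lemma card_pos_flip (s : {ffun 'I_n -> bool}) :
  #|[set f : bool_fun n | [ffun x => f (flip s x)] \in pos_ltf n]| = #|pos_ltf n|.
Proof.
pose h (f : bool_fun n) : bool_fun n := [ffun x => f (flip s x)].
have flipK : involutive (flip s).
  by move=> x; apply/ffunP => i; rewrite !ffunE -addbA addbb addbF.
have hK : involutive h by move=> f; apply/ffunP => x; rewrite !ffunE flipK.
rewrite -(card_imset _ (inv_inj hK)); apply: eq_card => f.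
apply/imsetP/idP => [[g]|fp]; first by rewrite finset.inE => gp ->.
by exists (h f); rewrite ?hK // finset.inE -/(h (h f)) hK.
Qed.

Lemma lin_flip (w : 'rV[rat]_n) theta s x :
  lin w theta (flip s x) = lin (\row_i (w ord0 i * (-1) ^+ s i))
     (theta - \sum_i w ord0 i * (s i)%:R) x.
Proof.
rewrite /lin opprB addrA -big_split /=; congr (_ - _).
apply: eq_bigr => i _; rewrite ffunE mxE; case: (x i); case: (s i) => /=; rewrite ?expr0 ?expr1; lra.
Qed.

(** A strict realization can be perturbed until no weight is zero; flipping the coordinates of
    negative weight then gives a positive function. *)
Lemma num_ltf_le_pos : (num_ltf n <= 2 ^ n * #|pos_ltf n|)%N.
Proof.
have cc : #|{: {ffun 'I_n -> bool}}| = (2 ^ n)%N by rewrite card_ffun card_bool card_ord.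
have := @leq_card_cover _ _ [set f : bool_fun n | `[< is_ltf n f >]] [set: {ffun 'I_n -> bool}]
   (fun s => [set f : bool_fun n | [ffun x => f (flip s x)] \in pos_ltf n]).
rewrite cardsE -/(num_ltf n) => /(_ _)/leq_trans; apply; last first.
  rewrite (eq_bigr (fun=> #|pos_ltf n|)) => [|s _]; last exact: card_pos_flip.
  by rewrite sum_nat_const cardsT cc.
move=> f; rewrite finset.inE => /asboolP[w [theta H]].
have [e e0 eP] := realization_strict H.
have H1 : srealize f w (theta + e) by apply: eP; rewrite e0 /=.
have [e1 e10 e1P] := srealize_perturb (const_mx 1) 0 H1.
have [e2 e20 e2P] : exists2 e2 : rat, 0 < e2 & forall i d, 0 < d <= e2 -> w ord0 i + d != 0.
  apply: exists_common_small => i; have [h|h] := leP 0 (w ord0 i).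
    by exists 1 => // d /andP[d0 _]; rewrite gt_eqF // ltr_wpDl.
  by exists (- w ord0 i / 2); [lra|move=> d /andP[d0 d1]; rewrite lt_eqF //; lra].
pose d := Num.min e1 e2; have d0 : 0 < d by rewrite lt_min e10.
have H2 : srealize f (w + d *: const_mx 1) (theta + e).
  by have := e1P d; rewrite d0 ge_min lexx mulr0 addr0 => /(_ isT).
set w' := w + _ in H2; have w'0 i : w' ord0 i != 0.
  by rewrite !mxE mulr1 e2P // d0 ge_min lexx orbT.
exists [ffun i => w' ord0 i < 0]; rewrite !finset.inE //; apply/asboolP.
set s := [ffun i => w' ord0 i < 0].
apply: (@positive_srealize _ _ (\row_i (w' ord0 i * (-1) ^+ s i)) (theta + e - \sum_i w' ord0 i * (s i)%:R)).
  by move=> x; rewrite ffunE -lin_flip.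
move=> i; rewrite mxE ffunE; case: (ltP (w' ord0 i) 0) => h; rewrite ?expr0 ?expr1 ?mulr1 ?mulrN1 ?oppr_gt0 //.
by rewrite lt_neqAle eq_sym w'0.
Qed.

End Flip.

(** * Restriction to a coordinate hyperplane *)

Section Restrict.
Variable n : nat.
Implicit Types (f : bool_fun n.+1) (i : 'I_n.+1).

Definition ext i (b : bool) (x : {ffun 'I_n -> bool}) : {ffun 'I_n.+1 -> bool} :=
  [ffun k => oapp x b (unlift i k)].

Definition res i b f : bool_fun n := [ffun x => f (ext i b x)].

Lemma ext_at i b x : ext i b x i = b.
Proof. by rewrite ffunE unlift_none. Qed.

Lemma ext_lift i b x j : ext i b x (lift i j) = x j.
Proof. by rewrite ffunE liftK. Qed.

Lemma ext_surj i (z : {ffun 'I_n.+1 -> bool}) : exists x, z = ext i (z i) x.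
Proof.
exists [ffun j => z (lift i j)]; apply/ffunP => k; rewrite ffunE.
by case: unliftP => [j ->|->] //=; rewrite ffunE.
Qed.

Lemma lin_ext i b x (w : 'rV[rat]_n.+1) theta :
  lin w theta (ext i b x) = lin (\row_j w ord0 (lift i j)) (theta - w ord0 i * b%:R) x.
Proof.
rewrite /lin (bigD1_ord i) //= ext_at.
under eq_bigr do rewrite ext_lift.
under [in RHS]eq_bigr do rewrite mxE.
ring.
Qed.

Lemma positive_res i b f : positive n.+1 f -> positive n (res i b f).
Proof.
move=> /positive_strict[w [theta [H w0]]].
apply: (@positive_srealize _ _ (\row_j w ord0 (lift i j)) (theta - w ord0 i * b%:R)).
  by move=> x; rewrite ffunE -lin_ext.
by move=> j; rewrite mxE.
Qed.

(** By monotonicity such an [f] is true wherever coordinate [i] is set, so its restriction to the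
    other half of the cube determines it. *)
Lemma card_pos_unit i : (#|[set f in pos_ltf n.+1 | f (unit_cube i)]| <= #|pos_ltf n|)%N.
Proof.
have inj : {in [set f in pos_ltf n.+1 | f (unit_cube i)] &, injective (res i false)}.
  move=> f f'; rewrite !finset.inE => /andP[/asboolP fp fi] /andP[/asboolP fp' fi'] /ffunP H.
  apply/ffunP => z; case zi : (z i).
    by rewrite !(positive_constant_true_at _ _ zi).
  by have [x] := ext_surj i z; rewrite zi => ->; have := H x; rewrite !ffunE.
rewrite -(card_in_imset inj); apply/subset_leq_card/fintype.subsetP => _ /imsetP[f + ->].
by rewrite !finset.inE => /andP[/asboolP fp _]; apply/asboolP/positive_res.
Qed.

Lemma card_pos_not_small : (#|pos_ltf n.+1 :\: small_ltf n.+1| <= n.+1 * #|pos_ltf n|)%N.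
Proof.
have := @leq_card_cover _ _ (pos_ltf n.+1 :\: small_ltf n.+1) [set: 'I_n.+1]
  (fun i => [set f in pos_ltf n.+1 | f (unit_cube i)]).
move=> /(_ _)/leq_trans; apply; last first.
  apply: (@leq_trans (\sum_(i in [set: 'I_n.+1]) #|pos_ltf n|)).
    by apply: leq_sum => i _; exact: card_pos_unit.
  by rewrite sum_nat_const cardsT card_ord.
move=> f; rewrite finset.in_setD [_ \in small_ltf _]finset.inE => /andP[+ fp].
rewrite fp negb_forall => /existsP[k]; rewrite negbK => fk.
exists k; first by rewrite finset.inE.
by rewrite finset.inE; apply/andP; split; [exact: fp|exact: fk].
Qed.

(** Complementation exchanges the two halves of the cube, so one half determines a self-dual
    function. *)
Lemma card_pos_selfdual : (#|[set f in pos_ltf n.+1 | dual f == f]| <= #|pos_ltf n|)%N.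
Proof.
have inj : {in [set f in pos_ltf n.+1 | dual f == f] &, injective (res ord0 false)}.
  move=> f f'; rewrite !finset.inE => /andP[_ /eqP fd] /andP[_ /eqP fd'] /ffunP H.
  have H0 (z : {ffun 'I_n.+1 -> bool}) : z ord0 = false -> f z = f' z.
    by move=> zi; have [x] := ext_surj ord0 z; rewrite zi => ->; have := H x; rewrite !ffunE.
  apply/ffunP => z; case zi : (z ord0); last exact: H0.
  by rewrite -fd -fd' !ffunE H0 // ffunE zi.
rewrite -(card_in_imset inj); apply/subset_leq_card/fintype.subsetP => _ /imsetP[f + ->].
by rewrite !finset.inE => /andP[/asboolP fp _]; apply/asboolP/positive_res.
Qed.

End Restrict.

Section Ample.
Variable n : nat.

Lemma dual_pos (f : bool_fun n) : (dual f \in pos_ltf n) = (f \in pos_ltf n).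
Proof.
by rewrite !finset.inE; apply/asboolP/asboolP => /positive_dual //; rewrite dualK.
Qed.

(** Inclusion and exclusion for the ample functions and their duals, whose common members are
    self-dual. *)
Lemma card_ample_le : (2 * #|ample_ltf n| <= #|pos_ltf n| + #|[set f in pos_ltf n | dual f == f]|)%N.
Proof.
pose C := [set dual f | f in ample_ltf n].
have cC : #|C| = #|ample_ltf n| by rewrite card_imset //; exact: inv_inj (@dualK n).
rewrite mul2n -addnn -{2}cC -(cardsUI (ample_ltf n) C); apply: leq_add; apply/subset_leq_card/fintype.subsetP => f.
  rewrite finset.in_setU => /orP[|/imsetP[g + ->]]; rewrite finset.inE => /andP[] //.
  by rewrite dual_pos.
rewrite finset.in_setI => /andP[+ /imsetP[g + fE]].
rewrite !finset.inE => /andP[/asboolP fp /asboolP fa] /andP[_ /asboolP ga].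
rewrite (asboolT fp) /=; apply/eqP/(ample_selfdual fp fa).
by rewrite fE dualK.
Qed.

Lemma card_pos_le_ample : (#|pos_ltf n| <= 2 * #|ample_ltf n|)%N.
Proof.
pose C := [set dual f | f in ample_ltf n].
have cC : #|C| = #|ample_ltf n| by rewrite card_imset //; exact: inv_inj (@dualK n).
rewrite mul2n -addnn -{2}cC; apply: leq_trans (leq_card_setU _ _).
apply/subset_leq_card/fintype.subsetP => f fP; rewrite finset.in_setU.
have fp : positive n f by move: fP; rewrite finset.inE => /asboolP.
have [fa|fa] := ample_or_dual fp.
  by apply/orP; left; rewrite finset.inE fP; exact/asboolP.
apply/orP; right; apply/imsetP; exists (dual f); rewrite ?dualK //.
by rewrite finset.inE dual_pos fP; exact/asboolP.
Qed.

End Ample.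

(** The coefficient [n.+2] is [n.+1] for the positive functions that are not small plus 1 for the
    self-dual ones. *)
Lemma card_small_ample_bounds n :
  [/\ (#|small_ltf n.+1| <= #|pos_ltf n.+1|)%N,
      (#|pos_ltf n.+1| <= #|small_ltf n.+1| + n.+1 * #|pos_ltf n|)%N,
      (2 * #|small_ltf n.+1 :&: ample_ltf n.+1| <= #|small_ltf n.+1| + n.+2 * #|pos_ltf n|)%N &
      (#|small_ltf n.+1| <= 2 * #|small_ltf n.+1 :&: ample_ltf n.+1| + 2 * n.+1 * #|pos_ltf n|)%N].
Proof.
set P := pos_ltf n.+1; set S := small_ltf n.+1; set A := ample_ltf n.+1; set p := #|pos_ltf n|.
have SP : S \subset P by apply/fintype.subsetP => f; rewrite finset.inE => /andP[].
have AP : A \subset P by apply/fintype.subsetP => f; rewrite finset.inE => /andP[].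
have h1 : (#|S| <= #|P|)%N := subset_leq_card SP.
have h2 : (#|P| <= #|S| + n.+1 * p)%N.
  rewrite -(cardsID S P) (finset.setIidPr SP) leq_add2l; exact: card_pos_not_small.
have h3 := card_ample_le n.+1; have h4 := card_pos_le_ample n.+1; have h5 := card_pos_selfdual n.
have h6 : (#|S :&: A| <= #|A|)%N by rewrite subset_leq_card // finset.subsetIr.
have h7 : (#|A| <= #|S :&: A| + n.+1 * p)%N.
  rewrite -(cardsID S A) finset.setIC leq_add2l.
  by apply: leq_trans (card_pos_not_small n); rewrite subset_leq_card // finset.setSD.
rewrite -/P -/A -/p in h3 h4 h5; split=> //; nia.
Qed.

Lemma binary_inj (n : nat) (x y : nat -> bool) :
  (\sum_(i < n) 2 ^ i * x i = \sum_(i < n) 2 ^ i * y i)%N -> forall i, (i < n)%N -> x i = y i.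
Proof.
elim: n x y => // n IH x y; rewrite !big_ord_recl /= !expn0 !mul1n.
have E (z : nat -> bool) : (\sum_(i < n) 2 ^ bump 0 i * z (bump 0 i) =
    2 * \sum_(i < n) 2 ^ i * z i.+1)%N.
  by rewrite big_distrr /=; apply: eq_bigr => i _; rewrite /bump /= add1n expnS mulnA.
rewrite !E => h; have h0 : x 0%N = y 0%N by move: h; case: (x 0%N); case: (y 0%N); lia.
case=> [//|i] /=; rewrite ltnS; apply: (IH (fun i => x i.+1) (fun i => y i.+1)).
by move: h; rewrite h0; lia.
Qed.

Section Extend.
Variable n : nat.
Notation cube := {ffun 'I_n -> bool}.

(** By uniqueness of binary digits these weights separate all cube points: a direction in which
    every tie can be broken. *)
Definition binary_row : 'rV[rat]_n := \row_i (2 ^ i)%:R.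

Lemma lin_binary_inj (x y : cube) : lin binary_row 0 x = lin binary_row 0 y -> x = y.
Proof.
pose z (u : cube) (k : nat) : bool := if insub k is Some i then u i else false.
have zE u (i : 'I_n) : z u i = u i by rewrite /z valK.
have E u : lin binary_row 0 u = (\sum_(i < n) 2 ^ i * z u i)%N%:R.
  rewrite /lin subr0 natr_sum; apply: eq_bigr => i _; by rewrite mxE zE natrM.
rewrite !E => /eqP; rewrite eqr_nat => /eqP/binary_inj h.
by apply/ffunP => i; rewrite -!zE h.
Qed.

(** Along [binary_row] the difference of the values at two distinct points is [a + d * b] with [b]
    nonzero, hence nonzero for all small [d > 0], even when [a = 0]. *)
Lemma positive_generic (f : bool_fun n) : positive n f -> exists wt : 'rV[rat]_n * rat,
  [/\ srealize f wt.1 wt.2, forall i, 0 < wt.1 ord0 i &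
      forall x y, lin wt.1 wt.2 x = lin wt.1 wt.2 y -> x = y].
Proof.
move=> /positive_strict[w [t [H w0]]].
have [e e0 eP] := srealize_perturb binary_row 0 H.
have [e1 e10 e1P] : exists2 e1 : rat, 0 < e1 & forall (p : cube * cube) d, 0 < d <= e1 -> p.1 != p.2 ->
    lin (w + d *: binary_row) (t + d * 0) p.1 != lin (w + d *: binary_row) (t + d * 0) p.2.
  apply: exists_common_small => -[x y] /=.
  set a := lin w t x - lin w t y; set b := lin binary_row 0 x - lin binary_row 0 y.
  have E d : lin (w + d *: binary_row) (t + d * 0) x - lin (w + d *: binary_row) (t + d * 0) y = a + d * b.
    by rewrite !linD /a /b; ring.
  have [a0|a0] := eqVneq a 0.
    exists 1 => // d /andP[d0 _] xy; rewrite -subr_eq0 E a0 add0r.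
    apply: mulf_neq0; first by rewrite gt_eqF.
    rewrite /b subr_eq0; by apply: contra xy => /eqP/lin_binary_inj ->.
  have [ap|an] := ltP 0 a.
    have [e' e'0 e'P] := exists_small_pos b ap.
    by exists e' => // d /e'P h _; rewrite -subr_eq0 E gt_eqF.
  have an' : 0 < - a by rewrite oppr_gt0 lt_neqAle a0.
  have [e' e'0 e'P] := exists_small_pos (- b) an'.
  by exists e' => // d /e'P; rewrite mulrN -opprD oppr_gt0 => h _; rewrite -subr_eq0 E lt_eqF.
pose d := Num.min e e1; have d0 : 0 < d by rewrite lt_min e0.
exists (w + d *: binary_row, t + d * 0); split=> /=.
- by apply: eP; rewrite d0 ge_min lexx.
- by move=> i; rewrite !mxE addr_gt0 ?mulr_gt0 // ltr0n expn_gt0.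
move=> x y /eqP h; apply/eqP; apply: contraLR h => xy; apply: (e1P (x, y)) => //.
by rewrite d0 ge_min lexx orbT.
Qed.

(** The involution that dualizes [f] and complements [x] exchanges zeros and ones, so zeros are
    exactly half of all pairs. *)
Lemma card_pos_pairs :
  (2 * #|[set p : bool_fun n * cube | (p.1 \in pos_ltf n) && ~~ p.1 p.2]| = #|pos_ltf n| * 2 ^ n)%N.
Proof.
set A := [set p | _]; pose h (p : bool_fun n * cube) := (dual p.1, neg_cube p.2).
have hK : involutive h by move=> [f x]; rewrite /h /= dualK neg_cubeK.
have <- : #|finset.setX (pos_ltf n) [set: cube]| = (#|pos_ltf n| * 2 ^ n)%N.
  by rewrite cardsX cardsT card_ffun card_bool card_ord.
have -> : finset.setX (pos_ltf n) [set: cube] = A :|: h @: A.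
  apply/finset.setP => -[f x]; rewrite !finset.in_setU !finset.inE /= andbT.
  have [fx|fx] := boolP (f x); rewrite ?andbF ?andbT /=; last first.
    rewrite -[X in X || _]/(`[< positive n f >]); apply/idP/orP => [->|[//|]]; first by left.
    move/imsetP => [[g y]]; rewrite finset.inE => /andP[/= gp _] [-> _].
    by have := dual_pos g; rewrite !finset.inE in gp * => ->.
  apply/idP/imsetP => [fp|[[g y]]].
    exists (dual f, neg_cube x); last by rewrite /h /= dualK neg_cubeK.
    rewrite finset.inE /= dual_pos finset.inE fp /=.
    by rewrite ffunE neg_cubeK fx.
  rewrite finset.inE => /andP[/= gp _] [-> _].
  by have := dual_pos g; rewrite !finset.inE in gp * => ->.
have -> : #|A :|: h @: A| = (#|A| + #|h @: A|)%N.
  have := cardsUI A (h @: A); suff -> : A :&: h @: A = finset.set0 by rewrite cards0 addn0 => <-.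
  apply/finset.setP => -[f x]; rewrite finset.in_setI finset.in_set0; apply/negP => /andP[].
  rewrite finset.inE => /andP[_ /= fx] /imsetP[[g y]]; rewrite finset.inE => /andP[_ /= gy] [fE xE].
  by move: fx; rewrite fE xE ffunE neg_cubeK gy.
by rewrite card_imset ?mul2n ?addnn //; exact: inv_inj hK.
Qed.

(* Each zero y of f extends f to the function with section [w.x > w.y] at 1. *)
Lemma pos_growth : (2 ^ n * #|pos_ltf n| <= 2 * #|pos_ltf n.+1|)%N.
Proof.
rewrite mulnC -card_pos_pairs leq_mul2l /=.
set A := [set p | _].
pose wt (f : bool_fun n) : 'rV[rat]_n * rat := xget (0, 0) [set wt : 'rV[rat]_n * rat |
  [/\ srealize f wt.1 wt.2, forall i, 0 < wt.1 ord0 i &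
      forall x y, lin wt.1 wt.2 x = lin wt.1 wt.2 y -> x = y]]%classic.
have wtP f : f \in pos_ltf n -> [/\ srealize f (wt f).1 (wt f).2, forall i, 0 < (wt f).1 ord0 i &
      forall x y, lin (wt f).1 (wt f).2 x = lin (wt f).1 (wt f).2 y -> x = y].
  rewrite finset.inE => /asboolP/positive_generic h; exact: (xgetPex _ h).
(* The new weight is positive because the strict realization is negative at the zero [p.2]; the
   section at 0 is [p.1] itself. *)
pose wx (p : bool_fun n * cube) : 'rV[rat]_n.+1 :=
  \row_k oapp ((wt p.1).1 ord0) (- lin (wt p.1).1 (wt p.1).2 p.2) (unlift ord0 k).
pose F (p : bool_fun n * cube) : bool_fun n.+1 := [ffun z => 0 < lin (wx p) (wt p.1).2 z].
have Fext p b x : F p (ext ord0 b x) = (0 < lin (wt p.1).1 (wt p.1).2 x -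
    lin (wt p.1).1 (wt p.1).2 p.2 * b%:R).
  rewrite ffunE lin_ext; congr (0 < _).
  have -> : \row_j (wx p) ord0 (lift ord0 j) = (wt p.1).1.
    by apply/rowP => j; rewrite !mxE liftK.
  rewrite [wx p ord0 ord0]mxE unlift_none /= /lin; ring.
have inj : {in A &, injective F}.
  move=> [f y] [g z]; rewrite !finset.inE => /andP[/= fp fy] /andP[/= gp gz] E.
  have fp' : f \in pos_ltf n by rewrite finset.inE.
  have gp' : g \in pos_ltf n by rewrite finset.inE.
  have [Hf wf inf] := wtP _ fp'; have [Hg wg ing] := wtP _ gp'.
  have fg : f = g.
    apply/ffunP => x; have /ffunP/(_ (ext ord0 false x)) := E; rewrite !Fext /= !mulr0 !subr0.
    by rewrite (srealize_realization Hf) (srealize_realization Hg).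
  move: E Hg wg ing gz {gp gp'}; rewrite -fg => E _ _ _ gz; congr pair; apply: inf.
  (* The common section at 1 is false at both [y] and [z], so neither value exceeds the other. *)
  apply/eqP; rewrite eq_le -[_ <= _]negbK -ltNge -[X in _ && X]negbK -ltNge.
  have /ffunP/(_ (ext ord0 true z)) := E; rewrite !Fext /= !mulr1 subrr ltxx subr_gt0 => ->.
  have /ffunP/(_ (ext ord0 true y)) := E; rewrite !Fext /= !mulr1 subrr ltxx subr_gt0 => <-.
  by [].
rewrite -(card_in_imset inj); apply/subset_leq_card/fintype.subsetP => _ /imsetP[[f y] + ->].
rewrite !finset.inE => /andP[/= fp fy]; have fp' : f \in pos_ltf n by rewrite finset.inE.
have [Hf wf inf] := wtP _ fp'; apply/asboolP; exists (wx (f, y)), (wt f).2; split.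
  by move=> z; rewrite ffunE /sgn /lin.
move=> k; rewrite mxE; case: unliftP => [j _|_] /=; first exact: wf.
by have := Hf y; rewrite (negPf fy).
Qed.

End Extend.

(** * Chambers *)

Lemma card_fset_set_image (T : finType) (U : choiceType) (F : T -> U) (A : {set T}) :
  {in A &, injective F} -> #|` fset_set (F @` [set` A])%classic |%fset = #|A|.
Proof.
move=> inj; have fA : finite_set [set` A]%classic by exact: finite_finset.
have mA x : (x \in fset_set [set` A]%classic) = (x \in A).
  by rewrite in_fset_set //; apply/idP/idP; rewrite inE.
rewrite fset_set_image // card_in_imfset /=; last first.
  by move=> x y; rewrite !mA; exact: inj.
rewrite cardE; apply: perm_size; apply: uniq_perm; rewrite ?enum_uniq ?fset_uniq //.
by move=> x; rewrite mA mem_enum.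
Qed.

Section Chambers.
Variables (R : realType) (n : nat).
Notation cube := {ffun 'I_n -> bool}.
Implicit Types (w v u : 'rV[R]_n) (x : cube) (S : {set 'I_n}).

Definition weight w x : R := \sum_i w ord0 i * (x i)%:R.

Definition pattern w : bool_fun n := [ffun x => 1 < weight w x].

Lemma weight_set w S : weight w [ffun i => i \in S] = \sum_(i in S) w ord0 i.
Proof.
rewrite [RHS]big_mkcond /weight; apply: eq_bigr => i _; rewrite ffunE.
by case: ifP; rewrite ?mulr1 ?mulr0.
Qed.

Lemma not_wallsP w : ~ walls R n w <-> forall x, weight w x != 1.
Proof.
split=> [H x|H [S _ /= SE]]; last first.
  by have := H [ffun i => i \in S]; rewrite weight_set SE eqxx.
apply/eqP => xE; apply: H; exists [set i | x i].
  rewrite /= lt0n; apply/negP; rewrite cards_eq0 => /eqP x0; move/eqP: xE; rewrite /weight big1.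
    by rewrite eq_sym oner_eq0.
  by move=> i _; have := finset.in_set0 i; rewrite -x0 finset.inE => ->; rewrite mulr0.
rewrite /wall /= -weight_set -xE; congr weight; apply/ffunP => i; by rewrite ffunE finset.inE.
Qed.

Lemma continuous_weight x : continuous (weight^~ x).
Proof.
rewrite /weight; elim: (index_enum _) => [|i s IH].
  have -> : (fun w => \sum_(i <- [::]) w ord0 i * (x i)%:R) = fun=> 0.
    by apply/funext => w; rewrite big_nil.
  exact: cst_continuous.
have -> : (fun w => \sum_(i0 <- (i :: s)) w ord0 i0 * (x i0)%:R) =
   (fun w => w ord0 i * (x i)%:R + \sum_(i0 <- s) w ord0 i0 * (x i0)%:R).
  by apply/funext => w; rewrite big_cons.
move=> w.
have c : ((fun v : 'rV[R]_n => v ord0 i) @ w --> w ord0 i)%classic by exact: coord_continuous.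
exact: (cvgD (cvgMr_tmp c) (IH w)).
Qed.

Lemma weight_seg w v (t : R) x :
  weight (w + t *: (v - w)) x = weight w x + t * (weight v x - weight w x).
Proof.
rewrite /weight mulrBr !mulr_sumr -sumrB -big_split /=; apply: eq_bigr => i _.
rewrite !mxE; ring.
Qed.

Variable g : nat.
Let A : set 'rV[R]_n := (admissible R g n `\` walls R n)%classic.

(** On a connected set avoiding the walls, no continuous [weight] can pass from one side of 1 to the
    other. Conversely, the admissible points with a given pattern off the walls form a convex set,
    so segments connect them. *)
Lemma chamberE w : A w ->
  connected_component A w = [set v | A v /\ pattern v = pattern w]%classic.
Proof.
move=> Aw; apply/seteqP; split=> v /=.
  move=> Cv; have Av := connected_component_sub Cv; split=> //.
  have Cw := connected_component_refl Aw.
  have Ccon := @component_connected _ A w.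
  apply/ffunP => x; rewrite !ffunE; apply/idP/idP => h; apply: contraT => h'; exfalso.
    have itv : is_interval (weight^~ x @` connected_component A w)%classic.
      apply/connected_intervalP; apply: connected_continuous_connected Ccon _.
      exact/continuous_subspaceT/continuous_weight.
    have [] := itv (weight w x) (weight v x) _ _ 1.
    - by exists w.
    - by exists v.
    - by rewrite leNgt h' ltW.
    move=> u Cu u1; have [_ /not_wallsP/(_ x)] := connected_component_sub Cu.
    by rewrite u1 eqxx.
  have itv : is_interval (weight^~ x @` connected_component A w)%classic.
    apply/connected_intervalP; apply: connected_continuous_connected Ccon _.
    exact/continuous_subspaceT/continuous_weight.
  have [] := itv (weight v x) (weight w x) _ _ 1.
  - by exists v.
  - by exists w.
  - by rewrite leNgt h' ltW.
  move=> u Cu u1; have [_ /not_wallsP/(_ x)] := connected_component_sub Cu.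
  by rewrite u1 eqxx.
move=> [Av pvw].
pose seg (t : R) := w + t *: (v - w).
have segc : continuous seg.
  move=> t; have c : ((fun s : R => s) @ t --> t)%classic by exact: cvg_id.
  exact: (cvgD (cvg_cst w) (cvgZr_tmp c)).
apply: (@connected_component_max _ A (seg @` `[0, 1])%classic w).
- by exists 0; rewrite /= ?in_itv /= ?lexx ?ler01 // /seg scale0r addr0.
- move=> _ [t /= + <-]; rewrite in_itv /= => /andP[t0 t1].
  have conv (a b c : R) : a < b -> a < c -> a < b + t * (c - b).
    move=> ab ac; have [tz|tz] := eqVneq t 0; first by rewrite tz mul0r addr0.
    have tp : 0 < t by rewrite lt0r tz.
    have : 0 < t * (c - a) by rewrite mulr_gt0 // subr_gt0.
    have : 0 <= (1 - t) * (b - a) by rewrite mulr_ge0 // subr_ge0 // ltW.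
    lra.
  have conv' (a b c : R) : b < a -> c < a -> b + t * (c - b) < a.
    move=> ba ca; have := conv (- a) (- b) (- c); rewrite !ltrN2 => /(_ ba ca); lra.
  case: Aw pvw => -[w01 wsum] /not_wallsP wW pvw; case: Av => -[v01 vsum] /not_wallsP vW.
  split; last first.
    apply/not_wallsP => x; rewrite weight_seg.
    have /ffunP/(_ x) := pvw; rewrite !ffunE; case: (ltgtP 1 (weight w x)) (wW x) => // hw _.
      by move=> hv; rewrite gt_eqF // conv.
    move=> /negbT; rewrite -leNgt le_eqVlt (negPf (vW x)) /= => hv.
    by rewrite lt_eqF // conv'.
  split=> [j|].
    rewrite !mxE; have /andP[wj wj1] := w01 j; have /andP[vj vj1] := v01 j.
    by rewrite conv //=; have : 0 <= (1 - t) * (1 - w ord0 j) + t * (1 - v ord0 j);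
      [rewrite addr_ge0 // mulr_ge0 // subr_ge0|lra].
  have -> : \sum_j (w + t *: (v - w)) ord0 j = \sum_j w ord0 j + t * (\sum_j v ord0 j - \sum_j w ord0 j).
    rewrite mulrBr !mulr_sumr -sumrB -big_split /=; apply: eq_bigr => i _.
    rewrite !mxE; ring.
  exact: conv.
- apply: connected_continuous_connected; last exact: continuous_subspaceT.
  exact: segment_connected.
- by exists 1; rewrite /= ?in_itv /= ?lexx ?ler01 // /seg scale1r addrC subrK.
Qed.

Definition patterns : {set bool_fun n} :=
  [set f | `[< exists w, A w /\ pattern w = f >]].

Let chamber (f : bool_fun n) : set 'rV[R]_n := [set v | A v /\ pattern v = f]%classic.

Lemma fine_chambersE : fine_chambers R g n = (chamber @` [set` patterns])%classic.
Proof.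
apply/seteqP; split=> C.
  move=> [w Aw <-]; exists (pattern w); last by rewrite chamberE.
  by rewrite /= finset.inE; apply/asboolP; exists w.
by move=> [f]; rewrite /= finset.inE => /asboolP[w [Aw wf]] <-; exists w => //; rewrite chamberE // wf.
Qed.

Lemma finite_fine_chambers : finite_set (fine_chambers R g n).
Proof. by rewrite fine_chambersE; apply: finite_image; exact: finite_finset. Qed.

Lemma num_fine_chambersE : num_fine_chambers R g n = #|patterns|.
Proof.
rewrite /num_fine_chambers fine_chambersE card_fset_set_image //.
move=> f f'; rewrite finset.inE => /asboolP[w [Aw wf]] _ E.
have : chamber f w by [].
by rewrite E => -[_ <-].
Qed.

End Chambers.

(** * Sign patterns as Goldilocks functions *)

Section Patterns.
Variables (R : realType) (n : nat).
Notation cube := {ffun 'I_n -> bool}.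
Implicit Types (w : 'rV[R]_n) (v : 'rV[rat]_n) (x : cube) (f : bool_fun n).

Definition realrow v : 'rV[R]_n := \row_i ratr (v ord0 i).

Lemma weight_realrow v x : weight (realrow v) x = ratr (lin v 0 x).
Proof.
rewrite /lin subr0 raddf_sum /=; apply: eq_bigr => i _.
by rewrite mxE rmorphM /= ratr_nat.
Qed.

Lemma weight_unit w i : weight w (unit_cube i) = w ord0 i.
Proof.
rewrite /weight (bigD1 i) //= ffunE eqxx mulr1 big1 ?addr0 // => j ji.
by rewrite ffunE (negPf ji) mulr0.
Qed.

Lemma sum_realrow v : \sum_i (realrow v) ord0 i = ratr (\sum_i v ord0 i).
Proof. by rewrite raddf_sum; apply: eq_bigr => i _; rewrite mxE. Qed.

(** Off the walls there is room on both sides of 1. Approximating from above preserves the lower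
    bounds on the weights and on their sum; smallness is read off from the pattern at the unit
    vectors. *)
Lemma rational_realization w f : (forall x, weight w x != 1) -> pattern w = f ->
  exists v, realization n f v 1 /\ forall i, w ord0 i < ratr (v ord0 i).
Proof.
move=> wW wf.
have [e e0 eP] : exists2 e : R, 0 < e & forall x d, 0 < d <= e ->
    0 < (if f x then weight w x - 1 else 1 - weight w x) - d * n%:R.
  apply: exists_common_small => x.
  have h : 0 < (if f x then weight w x - 1 else 1 - weight w x).
    rewrite -wf ffunE; case: (ltP 1 (weight w x)) => h; first by rewrite subr_gt0.
    by rewrite subr_gt0 lt_neqAle wW.
  have [e e0 eP] := exists_small_pos (- n%:R) h.
  by exists e => // d /eP; rewrite mulrN.
have vex i : exists q : rat, w ord0 i < ratr q < w ord0 i + e.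
  have := @rat_in_itvoo R (w ord0 i) (w ord0 i + e).
  by rewrite ltrDl => /(_ e0)[q]; rewrite in_itv /= => h; exists q.
pose v : 'rV[rat]_n := \row_i projT1 (cid (vex i)).
have vP i : w ord0 i < ratr (v ord0 i) < w ord0 i + e by rewrite mxE; case: cid.
exists v; split; last by move=> i; have /andP[] := vP i.
have lo x : weight w x <= weight (realrow v) x.
  by apply: ler_sum => i _; rewrite mxE ler_wpM2r //; have /andP[/ltW] := vP i.
have hi x : weight (realrow v) x <= weight w x + e * n%:R.
  have -> : e * n%:R = \sum_(i < n) e by rewrite sumr_const card_ord mulr_natr.
  rewrite /weight -big_split /=; apply: ler_sum => i _; rewrite mxE.
  have /andP[_ /ltW h] := vP i; case: (x i); rewrite ?mulr1 ?mulr0 ?add0r //.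
  exact: ltW.
move=> x; have := eP x e; rewrite e0 lexx => /(_ isT) h.
have -> : sgn (\sum_i v ord0 i * (x i)%:R - 1) = (1 < weight (realrow v) x).
  rewrite weight_realrow /sgn subr_gt0 -(ltr_rat R) rmorph1; congr (1 < ratr _).
  by rewrite /lin subr0.
have := lo x; have := hi x; have en : 0 <= e * n%:R by rewrite mulr_ge0 // ltW.
case: (f x) h => h h1 h2; apply/esym; [|apply/negbTE; rewrite -leNgt]; lra.
Qed.

Lemma pattern_small g w : admissible R g n w -> (forall x, weight w x != 1) ->
  pattern w \in small_ltf n.
Proof.
move=> [w01 wsum] wW; have [v [vf vw]] := rational_realization wW (erefl _).
have v0 i : 0 < v ord0 i.
  rewrite -(ltr_rat R) rmorph0; apply: lt_trans (vw i); by have /andP[] := w01 i.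
rewrite !finset.inE; apply/andP; split; first by apply/asboolP; exists v, 1.
apply/forallP => i; rewrite ffunE weight_unit -leNgt; by have /andP[] := w01 i.
Qed.

Lemma pattern_ample w : admissible R 0 n w -> (forall x, weight w x != 1) ->
  pattern w \in ample_ltf n.
Proof.
move=> wA wW; have := pattern_small wA wW; rewrite finset.inE => /andP[wp _].
case: wA => w01 wsum.
rewrite finset.inE wp; apply/asboolP.
have [v [vf vw]] := rational_realization wW (erefl _); exists v, 1; split=> //.
rewrite -(ltr_rat R) -sum_realrow mulr1 ratr_nat.
rewrite mulr0 subr0 in wsum; apply: lt_le_trans wsum _.
by apply: ler_sum => i _; rewrite mxE ltW.
Qed.

Lemma normalized_pattern f v theta : srealize f v theta -> 0 < theta ->
  let w := realrow (theta^-1 *: v) in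
  (forall x, weight w x != 1) /\ pattern w = f.
Proof.
move=> H t0 w.
have E x : weight w x - 1 = ratr (theta^-1 * lin v theta x).
  rewrite weight_realrow -(rmorph1 (ratr : rat -> R)) -rmorphB; congr ratr.
  rewrite /lin subr0 mulrBr mulVf ?gt_eqF // mulr_sumr; congr (_ - _).
  by apply: eq_bigr => i _; rewrite mxE mulrA.
have ti : 0 < theta^-1 by rewrite invr_gt0.
split=> [x|]; last first.
  apply/ffunP => x; rewrite ffunE -subr_gt0 E ltr0q pmulr_rgt0 //.
  by have := H x; case: (f x) => // h; apply/negbTE; rewrite -leNgt ltW // -oppr_gt0.
rewrite -subr_eq0 E fmorph_eq0; apply: mulf_neq0; first by rewrite gt_eqF.
have := H x; case: (f x) => h; first by rewrite gt_eqF.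
by rewrite lt_eqF // -oppr_gt0.
Qed.

(** At the unit vectors a strict realization of a small function gives [v i < theta]. Since some
    coordinate exists, [theta] is positive, and division by it brings the threshold to 1. *)
Lemma admissible_normalized g f v theta : (0 < n)%N -> srealize f v theta ->
  (forall i, 0 < v ord0 i) -> (forall i, f (unit_cube i) = false) ->
  (2 - 2 * g%:R) * theta < \sum_i v ord0 i -> (0 < theta) /\
  admissible R g n (realrow (theta^-1 *: v)).
Proof.
move=> n0 H v0 fs vs.
have vt i : v ord0 i < theta by have := H (unit_cube i); rewrite fs lin_unit opprB subr_gt0.
have t0 : 0 < theta by apply: lt_trans (v0 (Ordinal n0)) (vt _).
have ti : 0 < theta^-1 by rewrite invr_gt0.
split=> //; split=> [i|].
  rewrite !mxE ltr0q mulr_gt0 //= -(rmorph1 (ratr : rat -> R)) ler_rat.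
  by rewrite mulrC ler_pdivrMr // mul1r ltW.
rewrite sum_realrow; under eq_bigr do rewrite mxE.
rewrite -mulr_sumr.
have -> : 2 - 2 * g%:R = ratr (2 - 2 * g%:R) :> R.
  by rewrite rmorphB rmorphM /= !ratr_nat.
by rewrite ltr_rat [ltRHS]mulrC ltr_pdivlMr.
Qed.

(** For [g > 0] the bound [2 - 2 g] is at most 0, so positive weights satisfy the sum condition
    automatically. *)
Lemma patterns_pos g : (0 < g)%N -> (0 < n)%N -> patterns R n g = small_ltf n.
Proof.
move=> g0 n0; apply/finset.setP => f; apply/idP/idP.
  rewrite finset.inE => /asboolP[w [[wA /not_wallsP wW] <-]]; exact: pattern_small wA wW.
rewrite !finset.inE => /andP[/asboolP fp /forallP fs].
have [v [theta [H v0]]] := positive_strict fp.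
have [||t0 wA] := @admissible_normalized g f v theta n0 H v0.
- by move=> i; apply/negbTE.
- have := H [ffun=> false]; have -> : f [ffun=> false] = false.
    apply/negbTE/negP => /(@positive_mono _ _ _ (unit_cube (Ordinal n0)) fp) h.
    by have := fs (Ordinal n0); rewrite h // => i; rewrite ffunE.
  have -> : lin v theta [ffun=> false] = - theta.
    by rewrite /lin big1 ?add0r // => i _; rewrite ffunE mulr0.
  rewrite opprK => t0; apply: (@le_lt_trans _ _ 0).
    have : (1 : rat) <= g%:R by rewrite ler1n.
    by move=> g1; apply: mulr_le0_ge0; [lra|exact: ltW].
  rewrite (bigD1 (Ordinal n0)) //=; apply: ltr_wpDr => //.
  by apply: sumr_ge0 => i _; exact: ltW.
have [wW wf] := normalized_pattern H t0.
by apply/asboolP; exists (realrow (theta^-1 *: v)); split=> //; split=> //; apply/not_wallsP.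
Qed.

Lemma patterns_zero : (0 < n)%N -> patterns R n 0 = small_ltf n :&: ample_ltf n.
Proof.
move=> n0; apply/finset.setP => f; apply/idP/idP.
  rewrite finset.inE => /asboolP[w [[wA /not_wallsP wW] <-]].
  by rewrite finset.in_setI (pattern_small wA wW) pattern_ample.
rewrite finset.in_setI => /andP[+ +]; rewrite !finset.inE => /andP[/asboolP fp /forallP fs].
case/andP => _ /asboolP fa; have [v [theta [H v0 vs]]] := ample_strict fp fa.
have [||t0 wA] := @admissible_normalized 0 f v theta n0 H v0.
- by move=> i; apply/negbTE.
- by rewrite mulr0 subr0.
have [wW wf] := normalized_pattern H t0.
by apply/asboolP; exists (realrow (theta^-1 *: v)); split=> //; split=> //; apply/not_wallsP.
Qed.

End Patterns.

(** * Asymptotics *)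

(** A form of [(e N / d) ^ d] with 4 in place of [e]: as [d ^ i <= (2 d) ^_ i] and
    [N ^_ i <= N ^ i], each term is at most ['C(2 d, i)] times [(N / d) ^ d], and these coefficients
    sum to at most [4 ^ d]. *)
Lemma sum_bin_le (N d : nat) : (d <= N)%N ->
  ((\sum_(i < d.+1) 'C(N, i)) * d ^ d <= N ^ d * 4 ^ d)%N.
Proof.
move=> dN; have H (i : nat) : (i <= d)%N -> ('C(N, i) * d ^ d <= N ^ d * 'C(2 * d, i))%N.
  move=> id; have ff m k : (m ^_ k <= m ^ k)%N.
    by elim: k => // k IH; rewrite ffactnSr expnSr leq_mul // leq_subr.
  have fl k : (k <= d)%N -> (d ^ k <= (2 * d) ^_ k)%N.
    by elim: k => // k IH kd; rewrite ffactnSr expnSr leq_mul ?IH //; lia.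
  rewrite -[X in (d ^ X)%N](subnKC id) -[X in (N ^ X)%N](subnKC id) !expnD.
  rewrite mulnA [leqRHS]mulnAC; apply: leq_mul; last first.
    by case: (d - i)%N => [|k]; rewrite ?expn0 // leq_exp2r.
  apply: (@leq_trans ('C(N, i) * (2 * d) ^_ i)); first by rewrite leq_mul2l fl ?orbT.
  by rewrite -bin_ffact mulnCA bin_ffact mulnC leq_mul2r ff orbT.
rewrite big_distrl /=; apply: (@leq_trans (\sum_(i < d.+1) N ^ d * 'C(2 * d, i))).
  by apply: leq_sum => i _; apply: H; rewrite -ltnS.
rewrite -big_distrr leq_mul2l /=; apply/orP; right.
have -> : (4 ^ d = \sum_(i < (2 * d).+1) 'C(2 * d, i))%N.
  have := Pascal 1 1 (2 * d); rewrite addn1 expnM => ->.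
  by apply: eq_bigr => i _; rewrite !exp1n !muln1.
rewrite -!(big_mkord xpredT (fun i => 'C(2 * d, i))) (@big_cat_nat _ _ _ d.+1 0 (2 * d).+1) //=.
  exact: leq_addr.
lia.
Qed.

Lemma pos_le_ltf n : (#|pos_ltf n| <= num_ltf n)%N.
Proof.
rewrite /num_ltf; apply: (@leq_trans #|[set f : bool_fun n | `[< is_ltf n f >]]|); last by rewrite cardsE.
apply/subset_leq_card/fintype.subsetP => f; rewrite !finset.inE => /asboolP[w [t [H _]]].
by apply/asboolP; exists w, t.
Qed.

Lemma small_upper n : (0 < n)%N -> (#|small_ltf n| * n ^ n <= 2 ^ (8 * n) * 2 ^ (n * n))%N.
Proof.
move=> n0.
apply: (@leq_trans (num_ltf n * n.+1 ^ n.+1)).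
  apply: leq_mul.
    by apply: leq_trans (pos_le_ltf n); apply/subset_leq_card/fintype.subsetP => f; rewrite finset.inE => /andP[].
  by rewrite (leq_trans (_ : _ <= n.+1 ^ n)%N) ?leq_exp2r // leq_pexp2l.
apply: (@leq_trans ((\sum_(i < n.+2) 'C(2 ^ n, i)) * n.+1 ^ n.+1)).
  by rewrite leq_mul2r card_ltf_le orbT.
apply: (leq_trans (sum_bin_le _)); first exact: ltn_expl.
(* The exponent is [n * n + 3 * n + 2], and [3 * n + 2 <= 8 * n] for [n > 0]. *)
rewrite -expnM (_ : 4 = 2 ^ 2)%N // -expnM -!expnD leq_pexp2l //; nia.
Qed.

(** Witnessed by the constant false function; it makes logarithms and quotients of the count
    meaningful. *)
Lemma small_pos n : (0 < #|small_ltf n|)%N.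
Proof.
apply/card_gt0P; exists [ffun=> false]; apply/semi_goldilocksP.
have H (t : rat) : t = n%:R -> realization n [ffun=> false] (const_mx 1) t.
  move=> -> x; rewrite ffunE /sgn; apply/esym/negbTE; rewrite -leNgt subr_le0.
  have -> : n%:R = \sum_(i < n) 1 :> rat by rewrite sumr_const card_ord.
  apply: ler_sum => i _.
  by rewrite mxE mul1r; case: (x i).
have H' := H _ (erefl _); split; first by exists (const_mx 1), n%:R.
- by exists (const_mx 1), n%:R; split=> // i; rewrite mxE.
- exists (const_mx 1), n%:R; split=> // i; rewrite mxE ler1n.
  exact: leq_ltn_trans (ltn_ord i).
Qed.

(** Growth gives [2 ^ n * P(n) <= 2 * P(n.+1)], and [P(n.+1)] exceeds the small functions by at most
    [n.+1 * P(n)]; as [4 * n.+1 <= 2 ^ n], this excess takes at most half of the left side. *)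
Lemma pos_small_ratio n : (5 <= n)%N ->
  (2 ^ n * #|pos_ltf n| <= 4 * #|small_ltf n.+1|)%N.
Proof.
move=> n5; have h2 : (4 * n.+1 <= 2 ^ n)%N.
  elim: n n5 => // n IH; rewrite leq_eqVlt => /orP[/eqP <- //|]; rewrite ltnS => h.
  by rewrite expnS; have := IH h; lia.
have [_ h _ _] := card_small_ample_bounds n; have g := pos_growth n.
have : (4 * n.+1 * #|pos_ltf n| <= 2 ^ n * #|pos_ltf n|)%N by rewrite leq_mul2r h2 orbT.
lia.
Qed.

Lemma small_lower (R : realType) : exists C N : nat, forall n, (N <= n)%N ->
  (2 ^ (n * n) <= 2 ^ (C * n) * n ^ n * #|small_ltf n|)%N.
Proof.
have [C [N H]] := ltf_lower R; exists (C + 2)%N, (N + 6)%N => -[|n] Nn; first lia.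
have n5 : (5 <= n)%N by lia.
have [_ h _ _] := card_small_ample_bounds n; have hr := pos_small_ratio n5.
have h2 : (4 * n.+1 <= 2 ^ n)%N.
  clear -n5; elim: n n5 => // n IH; rewrite leq_eqVlt => /orP[/eqP <- //|]; rewrite ltnS => h.
  by rewrite expnS; have := IH h; lia.
have h3 : (#|pos_ltf n.+1| <= 2 * #|small_ltf n.+1|)%N.
  have : (4 * n.+1 * #|pos_ltf n| <= 2 ^ n * #|pos_ltf n|)%N by rewrite leq_mul2r h2 orbT.
  lia.
have h4 := num_ltf_le_pos n.+1; have h5 := H n.+1 _; apply: (leq_trans (h5 _)); first lia.
rewrite mulnDl expnD -!mulnA leq_mul2l; apply/orP; right.
rewrite mulnCA leq_mul2l; apply/orP; right; apply: (leq_trans h4).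
apply: (@leq_trans (2 ^ n.+1 * (2 * #|small_ltf n.+1|))); first by rewrite leq_mul2l h3 orbT.
rewrite mulnA leq_mul2r; apply/orP; right; rewrite -expnSr leq_pexp2l //; lia.
Qed.

Section Asymptotics.
Variable R : realType.

Lemma ln2_gt0 : 0 < ln 2 :> R.
Proof. by rewrite ln_gt0 // ltr1n. Qed.

Lemma log2X (x : R) n : 0 < x -> log2 (x ^+ n) = n%:R * log2 x.
Proof. by move=> x0; rewrite /log2 lnXn // mulr_natl -mulrnAl. Qed.

Lemma log2M (x y : R) : 0 < x -> 0 < y -> log2 (x * y) = log2 x + log2 y.
Proof. by move=> x0 y0; rewrite /log2 lnM ?posrE // mulrDl. Qed.

Lemma log22 : log2 2 = 1 :> R.
Proof. by rewrite /log2 divff // gt_eqF // ln2_gt0. Qed.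

Lemma ler_log2 (x y : R) : 0 < x -> x <= y -> log2 x <= log2 y.
Proof.
move=> x0 xy; rewrite /log2 ler_wpM2r ?invr_ge0 ?(ltW ln2_gt0) // ler_ln ?posrE //.
exact: lt_le_trans xy.
Qed.

Lemma powR_log2 (x : R) : 0 < x -> 2 `^ log2 x = x.
Proof.
move=> x0; rewrite /powR pnatr_eq0 /= /log2 divfK ?lnK ?posrE // gt_eqF // ln2_gt0 //.
Qed.

(** Defined so that the formula reproduces the count exactly: the quotient in the first asymptotic
    claim is eventually constant, and the whole content lies in [errorterm_bound]. *)
Definition errorterm (n : nat) : R :=
  log2 (#|small_ltf n|%:R) - n%:R ^+ 2 + n%:R * log2 n%:R.

Lemma errorterm_bound : exists K N : nat, forall n, (N <= n)%N -> `|errorterm n| <= K%:R * n%:R.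
Proof.
have [C [N H]] := small_lower R; exists (C + 8)%N, (N + 1)%N => n Nn.
have n0 : (0 < n)%N by lia.
have nR : (0 : R) < n%:R by rewrite ltr0n.
have gR : (0 : R) < #|small_ltf n|%:R by rewrite ltr0n small_pos.
have p2 k : (0 : R) < 2 ^+ k by rewrite exprn_gt0.
have low : (n * n)%:R <= (C * n)%:R + n%:R * log2 n%:R + log2 #|small_ltf n|%:R :> R.
  have : (2 ^ (n * n) <= 2 ^ (C * n) * n ^ n * #|small_ltf n|)%N by apply: H; lia.
  rewrite -(ler_nat R) !natrM !natrX => /ler_log2.
  rewrite !log2M ?mulr_gt0 ?exprn_gt0 // !log2X // !log22 !mulr1 => h.
  by rewrite !natrM in h *; apply: h.
have up : log2 #|small_ltf n|%:R + n%:R * log2 n%:R <= (8 * n)%:R + (n * n)%:R :> R.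
  have := small_upper n0; rewrite -(ler_nat R) !natrM !natrX => /ler_log2.
  rewrite !log2M ?exprn_gt0 // !log2X // !log22 !mulr1 => h.
  by rewrite !natrM in h *; apply: h; rewrite mulr_gt0 // exprn_gt0.
rewrite /errorterm !natrM natrD in low up *; rewrite expr2 ler_norml.
have c0 : 0 <= C%:R * n%:R :> R by rewrite mulr_ge0.
by apply/andP; split; lra.
Qed.

Lemma powR_errorterm n : 2 `^ (n%:R ^+ 2 - n%:R * log2 n%:R + errorterm n) = #|small_ltf n|%:R.
Proof.
rewrite -[RHS]powR_log2 ?ltr0n ?small_pos //; congr (_ `^ _); rewrite /errorterm; ring.
Qed.

(** The relative error is at most [2 * n.+1 * P(n)] over the number of small functions, hence at
    most [8 * n.+1 / 2 ^ n] by [pos_small_ratio]. This is below [1 / n] once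
    [8 * n.+1 * n <= 2 ^ n], that is, from [n = 10] on. *)
Lemma ample_ratio n : (10 <= n)%N ->
  `|1 - #|small_ltf n.+1 :&: ample_ltf n.+1|%:R / (#|small_ltf n.+1|%:R / 2)| <= n%:R^-1 :> R.
Proof.
move=> n10; have [_ _ b1 b2] := card_small_ample_bounds n.
have n5 : (5 <= n)%N by lia.
have hr := pos_small_ratio n5; have G0 := small_pos n.+1.
have h2 : (8 * n.+1 * n <= 2 ^ n)%N.
  clear -n10; elim: n n10 => // n IH; rewrite leq_eqVlt => /orP[/eqP <- //|]; rewrite ltnS => h.
  by rewrite expnS; have := IH h; nia.
set G := #|small_ltf n.+1| in b1 b2 hr G0 *; set G1 := #|_ :&: _| in b1 b2 *.
set p := #|pos_ltf n| in b1 b2 hr.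
have hp : (2 * n.+1 * p * n <= G)%N.
  have : (8 * n.+1 * n * p <= 2 ^ n * p)%N by rewrite leq_mul2r h2 orbT.
  lia.
have GR : (0 : R) < G%:R by rewrite ltr0n.
have nR : (0 : R) < n%:R by rewrite ltr0n; lia.
have -> : 1 - G1%:R / (G%:R / 2) = (G%:R - 2 * G1%:R) / G%:R :> R.
  by field; rewrite gt_eqF.
rewrite normrM normfV (ger0_norm (ltW GR)) ler_pdivrMr //.
rewrite ler_pdivlMl //.
have c1 : 2 * G1%:R <= G%:R + n.+2%:R * p%:R :> R by rewrite -!natrM -natrD ler_nat.
have c2 : G%:R <= 2 * G1%:R + 2 * n.+1%:R * p%:R :> R by rewrite -!natrM -natrD ler_nat.
have c3 : 2 * n.+1%:R * p%:R * n%:R <= G%:R :> R by rewrite -!natrM ler_nat.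
have p0 : 0 <= p%:R :> R by [].
have c4 : n.+2%:R * p%:R <= 2 * n.+1%:R * p%:R :> R by rewrite -!natrM ler_nat leq_mul2r; apply/orP; right; lia.
have c5 : `|G%:R - 2 * G1%:R| <= 2 * n.+1%:R * p%:R :> R by rewrite ler_norml; apply/andP; split; lra.
by apply: le_trans c3; rewrite mulrC ler_wpM2r // ltW.
Qed.

Lemma cvg_ample_ratio :
  ((fun n => #|small_ltf n :&: ample_ltf n|%:R / (#|small_ltf n|%:R / 2) : R) @ \oo --> (1 : R))%classic.
Proof.
apply/cvgrPdist_le => eps eps0.
exists (Num.trunc eps^-1 + 12)%N => // -[|n] /= Nn; first lia.
apply: le_trans (ample_ratio _) _; first lia.
have n0 : (0 : R) < n%:R by rewrite ltr0n; lia.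
rewrite -[leRHS]invrK lef_pV2 ?posrE ?invr_gt0 //.
apply: le_trans (ltW (truncnS_gt _)) _; rewrite ler_nat; move: Nn; set m := Num.trunc _; clearbody m; clear; lia.
Qed.

End Asymptotics.

Local Open Scope classical_set_scope.

Theorem theorem1p3 (R : realType) :
  [/\ forall g n : nat, (0 < n)%N -> finite_set (fine_chambers R g n),
      (forall g n : nat, (0 < g)%N -> (0 < n)%N ->
         num_fine_chambers R g n = num_semi_goldilocks n) /\
      (forall n : nat, (0 < n)%N ->
         num_fine_chambers R 0 n = num_goldilocks n),
      exists e : nat -> R,
        e =O_\oo (fun n : nat => n%:R : R) /\
        forall g : nat, (0 < g)%N ->
          asymp_equiv (fun n => (num_fine_chambers R g n)%:R)
            (fun n => 2 `^ (n%:R ^+ 2 - n%:R * log2 n%:R + e n))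
    & forall g : nat, (0 < g)%N ->
        asymp_equiv (fun n => (num_fine_chambers R 0 n)%:R)
          (fun n => (num_fine_chambers R g n)%:R / 2 : R)].
Proof.
have Ng g n : (0 < g)%N -> (0 < n)%N -> num_fine_chambers R g n = #|small_ltf n|.
  by move=> g0 n0; rewrite num_fine_chambersE patterns_pos.
have N0 n : (0 < n)%N -> num_fine_chambers R 0 n = #|small_ltf n :&: ample_ltf n|.
  by move=> n0; rewrite num_fine_chambersE patterns_zero.
split.
- by move=> g n _; exact: finite_fine_chambers.
- split=> [g n g0 n0|n n0]; first by rewrite Ng // num_semi_goldilocksE.
  by rewrite N0 // num_goldilocksE.
- exists (@errorterm R); split.
    have [K [N H]] := errorterm_bound R.
    apply/eqO_exP; exists (K.+1%:R : R); first by rewrite ltr0n.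
    exists N => // n /= Nn; apply: le_trans (H n Nn) _.
    by rewrite ger0_norm // ler_wpM2r // ler_nat.
  move=> g g0; rewrite /asymp_equiv; apply: cvg_near_cst; exists 1%N => // n /= n0.
  by rewrite powR_errorterm Ng // divff // pnatr_eq0 -lt0n small_pos.
- move=> g g0; rewrite /asymp_equiv; apply: cvg_trans (@cvg_ample_ratio R).
  apply: near_eq_cvg; exists 1%N => // n /= n0; by rewrite (Ng g) // N0.
Qed.
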